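(* Let $(X,\mathrm{d}\mu)$ be a $\sigma$-finite measure space and let $\mathcal{Y}_1,\dots,\mathcal{Y}_d$ be quasi-normed spaces. Let $T_j:\mathcal{Y}_j\to\mathcal{M}(X)$ be linear operators, each of which saturates $X$. Let $0<p_j\le 2$ for all $j$, and let $\theta_j>0$ with $\sum_{j=1}^d\theta_j=1$. Assume that for some $0<q\le\infty$ we have $$\Big\|\prod_{j=1}^d|T_jf_j|^{p_j\theta_j}\Big\|_{L^q(\mathrm{d}\mu)}\le B\prod_{j=1}^d\|f_j\|_{\mathcal{Y}_j}^{p_j\theta_j}$$ for all $f_j\in\mathcal{Y}_j$, $1\le j\le d$. Suppose moreover that each space $\mathcal{Y}_j$ has Rademacher-type $r_j$, where $r_j=2$ for those $j$ with $p_j=2$, and $r_j>p_j$ for those $j$ with $p_j<2$. Then the following hold, with $C$ a finite constant depending only on $\{\theta_j,p_j,r_j\}_{j=1}^d$. Case I (Disentanglement). If $q=1$, then there exist nonnegative measurable functions $\phi_j$ on $X$ such that $\prod_{j=1}^d\phi_j(x)^{\theta_j}\ge1$ a.e. on $X$ and such that for each $j$, $\left(\int_X|T_jf_j|^{p_j}\phi_j\,\mathrm{d}\mu\right)^{1/p_j}\le C\,B^{1/p_j}R_{r_j}(\mathcal{Y}_j)\|f_j\|_{\mathcal{Y}_j}$ for all $f_j\in\mathcal{Y}_j$. Case II (Multilinear duality). If $q>1$, then for every nonnegative $G\in L^{q'}(X)$ there exist nonnegative measurable functions $g_j$ on $X$ such that $$G(x)\le\prod_{j=1}^dg_j(x)^{\theta_j}\quad\text{a.e.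 on }X,$$ and such that for each $j$, $$\left(\int_X|T_jf_j(x)|^{p_j}g_j(x)\,\mathrm{d}\mu(x)\right)^{1/p_j}\le C\,B^{1/p_j}R_{r_j}(\mathcal{Y}_j)\|G\|_{q'}^{1/p_j}\|f_j\|_{\mathcal{Y}_j}\quad\text{for all } f_j\in\mathcal{Y}_j.$$ Case III (Multilinear Maurey factorisation). If $0<q<1$, then there exist nonnegative measurable functions $g_j$ on $X$ such that $$\Big\|\prod_{j=1}^dg_j^{\theta_j}\Big\|_{q'}=1$$ and such that for each $j$, $$\left(\int_X|T_jf_j(x)|^{p_j}g_j(x)\,\mathrm{d}\mu(x)\right)^{1/p_j}\le C\,B^{1/p_j}R_{r_j}(\mathcal{Y}_j)\|f_j\|_{\mathcal{Y}_j}\quad\text{for all } f_j\in\mathcal{Y}_j.$$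
   Context: $\mathcal{M}(X)$ is the class of measurable functions on $X$. A quasi-normed space is defined like a normed space but with the triangle inequality replaced by $\|x+y\|\le K(\|x\|+\|y\|)$ for some $K\ge 1$. A linear map $T:\mathcal{Y}\to\mathcal{M}(X)$ saturates $X$ if for each measurable $E\subseteq X$ of positive measure there exist a measurable $E'\subseteq E$ with $\mu(E')>0$ and an $h\in\mathcal{Y}$ such that $|Th|>0$ a.e. on $E'$. For $0<r\le 2$, a quasi-normed space $\mathcal{Y}$ has Rademacher-type $r$ if there is a finite constant $R$ such that $\big(\mathbb{E}\|\sum_{k=1}^N\epsilon_kF_k\|_{\mathcal{Y}}^r\big)^{1/r}\le R\big(\sum_{k=1}^N\|F_k\|_{\mathcal{Y}}^r\big)^{1/r}$ for all finite sequences $(F_k)$ in $\mathcal{Y}$, where $(\epsilon_k)$ are independent random variables taking values $\pm1$ with probability $1/2$ each (Rademacher functions); the least such constant is denoted $R_r(\mathcal{Y})$. For $q\in(0,\infty)\setminus\{1\}$, $q':=q/(q-1)$ (and $q'=1$ if $q=\infty$), so $q'<0$ when $0<q<1$; the notation $\|g\|_s:=(\int_X|g|^s\,\mathrm{d}\mu)^{1/s}$ is used also for $s<0$ and $0<s<1$. *)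

(* Defs.v *)
From HB Require Import structures.
From mathcomp Require Import all_boot all_order all_algebra.
From mathcomp Require Import all_classical all_reals all_analysis.
From mathcomp Require Import complex.
Import Order.TTheory GRing.Theory Num.Theory.
Import numFieldNormedType.Exports.

Set Implicit Arguments.
Unset Strict Implicit.
Unset Printing Implicit Defensive.

Local Open Scope classical_set_scope.
Local Open Scope ring_scope.

(* Real and complex scalars are treated at once: [scalarType R k] is R or R[i]. *)
Inductive scalar_kind := RealScalars | ComplexScalars.

Definition scalarType (R : realType) (k : scalar_kind) : numFieldType :=
  match k with
  | RealScalars => R
  | ComplexScalars => R[i]
  end.

(* The R-valued modulus; the library norm on R[i] takes values in R[i]. *)
Definition modulus (R : realType) (k : scalar_kind) : scalarType R k -> R :=
  match k return scalarType R k -> R with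
  | RealScalars => fun x : R => `|x|
  | ComplexScalars => fun z : R[i] => ComplexField.Normc.normc z
  end.

Definition measurable_scalar_fun (R : realType) (k : scalar_kind)
    (dX : measure_display) (X : measurableType dX) : (X -> scalarType R k) -> Prop :=
  match k return (X -> scalarType R k) -> Prop with
  | RealScalars => fun f : X -> R => measurable_fun setT f
  | ComplexScalars => fun f : X -> R[i] =>
      measurable_fun setT (fun x => complex.Re (f x)) /\
      measurable_fun setT (fun x => complex.Im (f x))
  end.

Section QuasiNormedSpaces.
Variables (R : realType) (k : scalar_kind) (Y : lmodType (scalarType R k)).
Variable N : Y -> R.

Definition quasi_norm : Prop :=
  [/\ forall y, 0 <= N y,
      forall y, N y = 0 <-> y = 0,
      forall (a : scalarType R k) y, N (a *: y) = modulus a * N y &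
      exists2 K : R, 1 <= K & forall y z, N (y + z) <= K * (N y + N z)].

(* E || sum_i eps_i F_i ||^r, where the independent Rademacher variables
   eps_i = (-1)^(e i) are realized as the coordinates of a uniformly
   distributed e : {ffun 'I_m -> bool}. *)
Definition rademacher_mean (r : R) (m : nat) (F : 'I_m -> Y) : R :=
  (2 ^+ m)^-1 *
  \sum_(e : {ffun 'I_m -> bool})
     (N (\sum_(i < m) ((-1) ^+ e i : scalarType R k) *: F i)) `^ r.

Definition rademacher_type_bound (r C : R) : Prop :=
  forall (m : nat) (F : 'I_m -> Y),
    (rademacher_mean r F) `^ r^-1 <= C * (\sum_(i < m) N (F i) `^ r) `^ r^-1.

Definition has_rademacher_type (r : R) : Prop :=
  [/\ 0 < r, r <= 2 & exists C : R, rademacher_type_bound r C].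

(* The restriction 0 <= C only matters for Y = {0}, where every real C is a
   bound. *)
Definition rademacher_const (r : R) : R :=
  inf [set C : R | 0 <= C /\ rademacher_type_bound r C].

End QuasiNormedSpaces.

Section OperatorsIntoMeasurableFunctions.
Variables (R : realType) (k : scalar_kind) (Y : lmodType (scalarType R k)).
Variables (dX : measure_display) (X : measurableType dX).
Variable mu : {measure set X -> \bar R}.
Variable T : Y -> X -> scalarType R k.

(* Elements of M(X) are identified when equal a.e.: T picks representatives, so
   linearity holds a.e., with an exceptional set that depends on a, u, v. *)
Definition linear_operator : Prop :=
  (forall u, measurable_scalar_fun (T u)) /\
  forall (a : scalarType R k) (u v : Y),
    {ae mu, forall x, T (a *: u + v) x = a * T u x + T v x}.

Definition saturates : Prop :=
  forall E : set X, measurable E -> (0 < mu E)%E ->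
    exists (E' : set X) (h : Y),
      [/\ measurable E', E' `<=` E, (0 < mu E')%E &
          {ae mu, forall x, E' x -> 0 < modulus (T h x)}].

End OperatorsIntoMeasurableFunctions.

(* q' = q / (q - 1) for finite q != 1, and q' = 1 for q = +oo. *)
Definition dual_exponent (R : realType) (q : \bar R) : R :=
  if q is q0%:E then q0 / (q0 - 1) else 1.

(* x ^ s for x in [0, +oo], with 0 ^ s = +oo and +oo ^ s = 0 when s < 0.  The
   library's poweR has 0 ^ s = 0 and +oo ^ s = +oo for s < 0, so that Lnorm is
   not the intended functional for negative exponents. *)
Definition epow (R : realType) (x : \bar R) (s : R) : \bar R :=
  if s < 0 then ((x `^ (- s))^-1)%E else (x `^ s)%E.

Definition signed_Lnorm (R : realType) (dX : measure_display)
    (X : measurableType dX) (mu : {measure set X -> \bar R}) (s : R)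
    (g : X -> R) : \bar R :=
  epow (\int[mu]_x epow (`|g x|)%:E s)%E s^-1.

(* Main.v *)
Require Import Defs.
From HB Require Import structures.
From mathcomp Require Import all_boot all_order all_algebra.
From mathcomp Require Import all_classical all_reals all_analysis.
From mathcomp Require Import measurable_realfun measurable_fun_approximation.
From mathcomp Require ess_sup_inf.
From mathcomp Require Import complex ring lra zify.
Import Order.TTheory GRing.Theory Num.Theory.
Import numFieldNormedType.Exports.
Local Open Scope classical_set_scope.
Local Open Scope ring_scope.

(** The theorem combines a duality statement for convex sets of functions with
an inequality that makes the sets attached to the operators admissible.

Duality ([disentanglement]). Let the K_j be convex sets of nonnegative functions
with int G prod_j S_j^theta_j <= A whenever S_j is in K_j for all j. Take such a
tuple S for which the left side is almost maximal, and put P = G prod_i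
S_i^theta_i. Moving one S_j slightly towards another member V of K_j cannot
raise the integral noticeably, and to first order this says that int V (P / S_j)
<= A + epsilon. The functions phi_j = P / S_j satisfy prod_j phi_j^theta_j = G,
so they solve the problem for finitely many test functions V up to epsilon
([near_optimal_multiplier]). To pass to all V at once, one uses that the
constraints on phi are convex and closed under almost everywhere limits. The
functional phi |-> int w sum_j exp (- 2 phi_j) is strictly convex in the precise
form of the parallelogram identity for psi = exp (- phi). Near-minimisers of it
along a growing list of constraints are therefore Cauchy, and their limit meets
every constraint ([convex_compactness], [dual_compactness]). Saturation excludes
the value phi = +oo and extends the pointwise inequality to almost all of X.

The inequality ([averaging]). The set K_j consists of the sums S = sum_k c_k
|T_j f_k|^p_j for which sum_k c_k N_j(f_k)^p_j is bounded, whereas the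
hypothesis is about single vectors. So a sum is replaced by a random vector Z =
sum_k eta_k c_k^(1/p) f_k: one needs E |T Z|^s >= kap^s S^(s/p) pointwise, and E
N(Z)^s <= (R / kap)^s from the Rademacher type. With independent Z_j, averaging
the hypothesis gives the inequality for sums.

It is essential that kap does not depend on s. Indeed, when q < 1 the exponents
are q p_j theta_j, the outcome is raised to the power 1/q, and q may be
arbitrarily small. Plain random signs are excluded, because a signed sum may
vanish with a fixed positive probability. The eta_k are instead discrete
versions of p-stable variables (Gaussian ones for p = 2): many random signs with
weights, heavy-tailed for p < 2 and cut off where a weighted piece of f_k would
exceed the norm budget. The characteristic function of sum_k a_k eta_k then
decays like exp (- c |x|^p sum_k |a_k|^p), which yields a small-ball estimate
and through it the lower bound for all s at once; and r > p makes the r-th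
moments of the cut-off weights of the right size ([randomization]).

The cases. For q = 1 the duality is applied with weight 1; for q > 1 with weight
G, after Hoelder's inequality. For q < 1, write the q-th power of the product as
a product with exponents q theta_j and an additional factor 1^(1-q), and let the
additional coordinate range over the constants in [0,1]; its multiplier bounds
the functional with negative exponent q' ([reciprocal_disentanglement],
[small_exponent_factorisation]). *)

Set Implicit Arguments.
Unset Strict Implicit.
Unset Printing Implicit Defensive.

(** * Elementary inequalities *)

Section ElementaryInequalities.
Variable R : realType.
Implicit Types (s r x y u : R).

Lemma dyadic_scale x : 0 < x <= 1 -> exists l, 2^-1 < 2 ^+ l * x <= 1.
Proof.
move=> /andP[x0 x1].
have ex : exists n, 1 < 2 ^+ n * x.
  exists (Num.truncn x^-1).+1.
  rewrite -ltr_pdivrMr// mul1r (lt_trans (truncnS_gt _))//.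
  by rewrite -natrX ltr_nat ltn_expl.
case: (ex_minnP ex) => -[|n]; first by rewrite expr0 mul1r ltNge x1.
move=> n1 nmin; exists n; apply/andP; split.
  by rewrite -(ltr_pM2l (ltr0n R 2)) mulfV ?pnatr_eq0// mulrA -exprS.
by rewrite leNgt; apply/negP => /nmin; rewrite ltnn.
Qed.

Lemma subr1_cos_double u : 1 - cos (2 * u) <= 4 * (1 - cos u).
Proof.
rewrite mulr_natl cos_mulr2n.
have := cos_le1 u; set c := cos u => c1.
have : 0 <= (1 - c) ^+ 2 by exact: sqr_ge0.
rewrite sqrrB expr1n mul1r; lra.
Qed.

Lemma pi_ge1 : 1 <= pi :> R.
Proof. by apply: le_trans (@pi_ge2 R); rewrite ler1n. Qed.

Lemma cos_lt1 y : 0 < y <= 1 -> cos y < 1.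
Proof.
move=> /andP[y0 y1]; rewrite -(@cos0 R) ltr_cos// in_itv/= ?lexx ?pi_ge0//.
by rewrite (ltW y0) (le_trans y1) ?pi_ge1.
Qed.

Lemma le_cos_itv y z : 0 <= y -> y <= z -> z <= 1 -> cos z <= cos y.
Proof.
move=> y0 yz z1; have z0 : 0 <= z by exact: le_trans yz.
have h (w : R) : 0 <= w -> w <= 1 -> w \in `[0, pi].
  by move=> w0 w1; rewrite in_itv/= w0 (le_trans w1 pi_ge1).
move: yz; rewrite le_eqVlt => /predU1P[->//|yz].
by rewrite ltW// ltr_cos ?h// (le_trans (ltW yz)).
Qed.

(** Doubling u multiplies 1 - cos u by at most 4, so the claim for u follows from
that for the dyadic multiple of u in (1/2, 1], where the cosine is monotone. *)
Lemma cos_quadratic_gap u : `|u| <= 1 -> (1 - cos 2^-1) * u ^+ 2 <= 1 - cos u.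
Proof.
move=> u1; rewrite -(cos_norm u) -(real_normK (num_real u)).
have [->|u0] := eqVneq u 0; first by rewrite normr0 expr0n/= mulr0 cos0 subrr.
have {}u0 : 0 < `|u| by rewrite normr_gt0.
move: (`|u| : R) u0 u1 => {}u u0 u1.
have [|l /andP[l1 l2]] := @dyadic_scale u; first by rewrite u0.
have gap (v : R) n : 1 - cos (2 ^+ n * v) <= 4 ^+ n * (1 - cos v).
  elim: n => [|n IH]; first by rewrite !expr0 !mul1r.
  rewrite (exprS 2) -(mulrA 2) (exprS 4) -(mulrA 4).
  by apply: le_trans (subr1_cos_double _) _; rewrite ler_wpM2l.
have h : 1 - cos 2^-1 <= 1 - cos (2 ^+ l * u).
  by rewrite lerD2l lerN2 le_cos_itv ?invr_ge0// ltW.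
have := le_trans h (gap u l).
have c0 : 0 <= 1 - cos (2^-1 : R) by rewrite subr_ge0 cos_le1.
have l2' : 4 ^+ l * u ^+ 2 <= 1.
  rewrite (_ : 4 = 2 ^+ 2); last by rewrite -natrX.
  by rewrite exprAC -exprMn expr_le1// mulr_ge0 ?exprn_ge0// ltW.
move=> H; have u20 : 0 <= u ^+ 2 by rewrite sqr_ge0.
apply: le_trans (ler_wpM2r u20 H) _.
rewrite mulrAC -[leRHS]mul1r ler_wpM2r// subr_ge0; exact: cos_le1.
Qed.

(** Bernoulli's inequality, which is Young's inequality for x^a and 1 with the
exponents 1/a and 1/(1-a). *)
Lemma powR_le_tangent x a : 0 <= x -> 0 < a <= 1 -> x `^ a <= 1 - a + a * x.
Proof.
move=> x0 /andP[a0]; rewrite le_eqVlt => /predU1P[->|a1].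
  by rewrite powRr1// subrr add0r mul1r.
have := @conjugate_powR R (x `^ a) 1 a^-1 (1 - a)^-1.
rewrite powR_ge0 ler01 invr_gt0 a0 invr_gt0 subr_gt0 a1 !invrK.
move=> /(_ isT isT isT isT); rewrite addrC subrK => /(_ erefl).
by rewrite mulr1 -powRrM mulfV ?gt_eqF// powRr1// powR1 mul1r addrC [x * a]mulrC.
Qed.

Section FiniteProbability.
Variables (Om : finType) (rho : Om -> R).
Hypothesis rho0 : forall w, 0 <= rho w.
Hypothesis rho1 : \sum_w rho w = 1.

(** Jensen's inequality for the concave power s/r, through its tangent at the mean
of X^r. *)
Lemma finite_power_mean (X : Om -> R) s r : (forall w, 0 <= X w) -> 0 < s -> s <= r ->
  \sum_w rho w * X w `^ s <= (\sum_w rho w * X w `^ r) `^ (s / r).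
Proof.
move=> X0 s0 sr; have r0 : 0 < r by exact: lt_le_trans sr.
set M := \sum_w _ * _ `^ r.
have M0 : 0 <= M by apply: sumr_ge0 => w _; rewrite mulr_ge0 ?powR_ge0.
have a01 : 0 < s / r <= 1 by rewrite divr_gt0//= ler_pdivrMr// mul1r.
have XE w : X w `^ s = (X w `^ r) `^ (s / r).
  by rewrite -powRrM mulrC divfK// gt_eqF.
move: M0; rewrite le_eqVlt => /predU1P[M0|M0].
  rewrite -M0 powR0 ?mulf_neq0 ?invr_neq0 ?gt_eqF//.
  move/esym/eqP : M0; rewrite /M psumr_eq0; last by move=> w _; rewrite mulr_ge0 ?powR_ge0.
  move=> /allP M0; rewrite big1// => w _.
  have /M0 : w \in index_enum Om by rewrite mem_index_enum.
  rewrite /= mulf_eq0 powR_eq0 => /orP[/eqP->|/andP[/eqP-> _]]; first by rewrite mul0r.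
  by rewrite powR0 ?mulr0// gt_eqF.
rewrite -[leRHS]mulr1.
have -> : 1 = \sum_w rho w * (1 - s / r + s / r * (X w `^ r / M)) :> R.
  under eq_bigr do rewrite mulrDr mulrCA mulrA.
  rewrite big_split/= -mulr_suml rho1 mul1r.
  under eq_bigr do rewrite -mulrA.
  rewrite -mulr_sumr.
  rewrite (_ : \sum_i _ = 1) ?mulr1 ?subrK//.
  under eq_bigr do rewrite mulrA.
  by rewrite -mulr_suml -/M divff// gt_eqF.
rewrite mulr_sumr; apply: ler_sum => w _; rewrite mulrCA ler_wpM2l// XE.
have -> : (X w `^ r) `^ (s / r) = (X w `^ r / M) `^ (s / r) * M `^ (s / r).
  by rewrite -powRM ?divr_ge0 ?powR_ge0 ?(ltW M0)// divfK ?gt_eqF.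
by rewrite mulrC ler_wpM2l ?powR_ge0// powR_le_tangent// divr_ge0 ?powR_ge0// ltW.
Qed.

Lemma finite_jensen_exp2 (n : Om -> R) s : 0 <= s ->
  2 `^ (- (s * \sum_w rho w * n w)) <= \sum_w rho w * 2 `^ (- (s * n w)).
Proof.
move=> s0; set m := \sum_w _.
have -> : \sum_w rho w * 2 `^ (- (s * n w)) =
    2 `^ (- (s * m)) * \sum_w rho w * 2 `^ (s * m - s * n w).
  rewrite mulr_sumr; apply: eq_bigr => w _; rewrite mulrCA -powRD ?pnatr_eq0 ?implybT//.
  by rewrite addKr.
rewrite -[leLHS]mulr1 ler_wpM2l ?powR_ge0//.
apply: (@le_trans _ _ (\sum_w rho w * (1 + (s * m - s * n w) * ln 2))).
  under eq_bigr do rewrite mulrDr mulr1.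
  rewrite big_split/= rho1 lerDl.
  under eq_bigr do rewrite mulrA -mulrBr mulrCA.
  rewrite -mulr_suml -mulr_sumr.
  under eq_bigr do rewrite mulrBr.
  by rewrite big_split/= -mulr_suml rho1 mul1r sumrN subrr mulr0 mul0r.
apply: ler_sum => w _; rewrite ler_wpM2l// /powR pnatr_eq0/=; exact: expR_ge1Dx.
Qed.

End FiniteProbability.

Lemma powR_le x y a : 0 <= a -> 0 <= x -> x <= y -> x `^ a <= y `^ a.
Proof. by move=> a0 x0 xy; rewrite ge0_ler_powR// nnegrE (le_trans x0). Qed.

Lemma powR_le1 x a : 0 <= a -> 0 <= x -> x <= 1 -> x `^ a <= 1.
Proof. by move=> a0 x0 x1; rewrite -[leRHS](congr1 (fun f => f a) (@powR1 R)) powR_le. Qed.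

Lemma powR_gt1 x a : 0 < a -> 1 < x -> 1 < x `^ a.
Proof. by move=> a0 x1; rewrite /powR gt_eqF ?(lt_trans _ x1)// expR_gt1 mulr_gt0// ln_gt0. Qed.

End ElementaryInequalities.

(** * Small-ball estimates from characteristic functions *)

Section SmallBallEstimates.
Variable R : realType.
Implicit Types (s r x y u : R).

Section SignSums.
Variable I : finType.

(** The product of the 2 cos (c_i) is a product of sums of two complex exponentials;
expanding it gives one exponential for each choice of signs, of which the real
part is taken. *)
Lemma sum_cos_signs (c : I -> R) :
  \sum_(e : {ffun I -> bool}) cos (\sum_i (-1) ^+ e i * c i) = \prod_i (2 * cos (c i)).
Proof.
pose cis (x : R) : R[i] := (cos x +i* sin x)%C.
have cisD : {morph cis : x y / x + y >-> x * y}.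
  move=> x y; rewrite /cis cosD sinD; apply/eqP; rewrite eq_complex/=.
  by apply/andP; split; apply/eqP; ring.
have cis0 : cis 0 = 1 by rewrite /cis cos0 sin0.
have key : \prod_i (2 * cos (c i))%:C%C =
    \sum_(e : {ffun I -> bool}) cis (\sum_i (-1) ^+ e i * c i) :> R[i].
  under eq_bigr => i _.
    rewrite (_ : (2 * cos (c i))%:C%C = \sum_(b : bool) cis ((-1) ^+ b * c i)).
    over.
    rewrite big_bool/= expr0 expr1 mul1r mulN1r /cis cosN sinN.
    apply/eqP; rewrite eq_complex/= addNr eqxx andbT; apply/eqP; ring.
  rewrite bigA_distr_bigA; apply: eq_bigr => e _.
  by rewrite (big_morph _ cisD cis0).
have reD : {morph (@complex.Re R) : x y / x + y} by move=> [a b] [a' b'].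
have := congr1 (@complex.Re R) key.
rewrite (big_morph _ reD (erefl : complex.Re (0 : R[i]) = 0))/= => <-.
by rewrite -(rmorph_prod (@real_complex R)).
Qed.

Variables (La : finType) (rho W : La -> R).

Definition char_fun (x : R) : R := \sum_l rho l * cos (x * W l).

(** Independence in terms of characteristic functions: the i-th summand is a random
sign times c_i times a weight W drawn from rho. *)
Lemma mean_cos_random_sum (c : I -> R) :
  \sum_(w : {ffun I -> La}) (\prod_i rho (w i)) *
    ((2 ^+ #|I|)^-1 * \sum_(e : {ffun I -> bool})
       cos (\sum_i (-1) ^+ e i * (c i * W (w i)))) =
  \prod_i char_fun (c i).
Proof.
rewrite /char_fun bigA_distr_bigA; apply: eq_bigr => w _.
rewrite sum_cos_signs big_split/= prodr_const.
by rewrite mulKf ?expf_neq0 ?pnatr_eq0// big_split.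
Qed.

End SignSums.

Section SmallBall.
Variables (Om : finType) (rho : Om -> R) (Z : Om -> R).
Hypothesis rho0 : forall w, 0 <= rho w.
Hypothesis rho1 : \sum_w rho w = 1.

(** This is the square of the modulus of sum_l exp (i l z), a Fejer kernel up to
normalisation. It is nonnegative, and of size L^2 for |z| <= 1/L. *)
Lemma sum_cos_diff (L : nat) (z : R) :
  \sum_(l < L) \sum_(k < L) cos ((l%:R - k%:R) * z) =
  (\sum_(l < L) cos (l%:R * z)) ^+ 2 + (\sum_(l < L) sin (l%:R * z)) ^+ 2.
Proof.
rewrite !expr2 !mulr_suml -big_split/=; apply: eq_bigr => l _.
rewrite !mulr_sumr -big_split/=; apply: eq_bigr => k _.
by rewrite mulrBl cosB.
Qed.

Lemma sum_le_prefix (g : nat -> R) (n L : nat) : (forall m, 0 <= g m) -> (n <= L)%N ->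
  \sum_(0 <= m < n) g m <= \sum_(0 <= m < L) g m.
Proof. by move=> g0 nL; rewrite (@big_cat_nat _ _ _ n 0%N L)//= lerDl sumr_ge0. Qed.

(** Chebyshev's inequality for the Fejer kernel evaluated at Z. The kernel is at
least (L cos 1)^2 for |Z| <= 1/L, while its mean is a sum of L^2 values of the
characteristic function of Z, in which each difference occurs at most 2L times. *)
Lemma small_ball (L : nat) (g : nat -> R) (G : R) : (0 < L)%N ->
  (forall m, 0 <= g m) -> 1 <= g 0%N ->
  (forall m, (0 < m < L)%N -> \sum_w rho w * cos (m%:R * Z w) <= g m) ->
  \sum_(m < L) g m <= G ->
  \sum_(w | `|Z w| <= L%:R^-1) rho w <= 2 / cos 1 ^+ 2 * G / L%:R.
Proof.
move=> L0 g0 g1 gb sg.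
have LR0 : 0 < L%:R :> R by rewrite ltr0n.
have c0 : 0 < cos 1 :> R by exact: cos1_gt0.
(* D is the Fejer kernel of order L, up to a factor. *)
pose D (z : R) : R := \sum_(l < L) \sum_(k < L) cos ((l%:R - k%:R) * z).
have D0 (z : R) : 0 <= D z by rewrite /D sum_cos_diff addr_ge0 ?sqr_ge0.
have D1 (z : R) : `|z| <= L%:R^-1 -> (L%:R * cos 1) ^+ 2 <= D z.
  move=> zL; have cosL (l : 'I_L) : cos 1 <= cos (l%:R * z).
    rewrite -(cos_norm (_ * z)); apply: le_cos_itv => //.
    rewrite normrM normr_nat; apply: (@le_trans _ _ (L%:R * L%:R^-1)).
      by rewrite ler_pM// ler_nat ltnW.
    by rewrite mulfV// gt_eqF.
  rewrite /D sum_cos_diff -[leLHS]addr0 lerD ?sqr_ge0//.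
  rewrite lerXn2r// ?nnegrE ?mulr_ge0 ?(ltW c0)//; first apply: sumr_ge0.
    by move=> i _; exact: le_trans (ltW c0) (cosL i).
  rewrite (_ : L%:R * cos 1 = \sum_(l < L) cos 1); last by rewrite sumr_const card_ord mulr_natl.
  apply: ler_sum => l _; exact: cosL.
(* Values at m <= 0 are reduced to m >= 0 by evenness; the diagonal m = 0 is covered by
   1 <= g 0. *)
have Eg (i : 'I_L) (k : nat) (h : (k <= i)%N) :
    \sum_w rho w * cos ((i%:R - k%:R) * Z w) <= g (i - k)%N.
  rewrite -natrB//; have [->|ik] := posnP (i - k).
    by under eq_bigr do rewrite mul0r cos0 mulr1; rewrite rho1.
  by apply: gb; rewrite ik (leq_ltn_trans (leq_subr _ _)).
have ED : \sum_w rho w * D (Z w) <= 2 * G * L%:R.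
  rewrite /D; under eq_bigr do rewrite mulr_sumr.
  rewrite (_ : 2 * G * L%:R = \sum_(l < L) 2 * G); last by rewrite sumr_const card_ord mulr_natr.
  rewrite exchange_big/=.
  apply: ler_sum => i _; under eq_bigr do rewrite mulr_sumr.
  rewrite exchange_big/=.
  rewrite -(big_mkord xpredT (fun k => \sum_w rho w * cos ((i%:R - k%:R) * Z w))).
  rewrite (@big_cat_nat _ _ _ i 0%N L)//= ?(ltnW (ltn_ord i))// mulr_natl mulr2n.
  rewrite -(big_mkord xpredT g) in sg.
  rewrite lerD//; apply: le_trans sg.
    apply: le_trans (@sum_le_prefix (fun m => g m) i.+1 L g0 (ltn_ord i)).
    rewrite [leRHS]big_nat_recl// [leRHS]addrC -[leLHS]addr0 lerD//.
    rewrite big_nat_rev/= big_nat [leRHS]big_nat; apply: ler_sum => k /andP[_ ki].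
    by rewrite (le_trans (Eg _ _ _))// add0n ?leq_subr// subKn.
  apply: le_trans (@sum_le_prefix g (L - i) L g0 (leq_subr _ _)).
  rewrite -{1}[val i]add0n big_addn big_nat [leRHS]big_nat; apply: ler_sum => k /andP[_ ki].
  under eq_bigr do rewrite -opprB mulNr cosN natrD addrK.
  have [->|k0] := posnP k.
    by under eq_bigr do rewrite mul0r cos0 mulr1; rewrite rho1.
  by apply: gb; rewrite k0 (leq_trans ki)// leq_subr.
apply: (@le_trans _ _ (\sum_w rho w * (D (Z w) / (L%:R * cos 1) ^+ 2))).
  rewrite [leRHS](bigID (fun w => `|Z w| <= L%:R^-1))/= -[leLHS]addr0 lerD//.
    apply: ler_sum => w /D1 Zw; rewrite -[leLHS]mulr1 ler_wpM2l//.
    by rewrite ler_pdivlMr ?exprn_gt0 ?mulr_gt0// mul1r.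
  by apply: sumr_ge0 => w _; rewrite mulr_ge0// divr_ge0 ?sqr_ge0.
under eq_bigr do rewrite mulrA.
rewrite -mulr_suml ler_pdivrMr ?exprn_gt0 ?mulr_gt0//; apply: le_trans ED _.
rewrite le_eqVlt; apply/orP; left; apply/eqP; field.
by rewrite gt_eqF//= gt_eqF.
Qed.

End SmallBall.
End SmallBallEstimates.

Section MomentBounds.
Variable R : realType.
Implicit Types (s r x y u : R).

Lemma sum_geometric_half_le2 (n : nat) : \sum_(l < n) (2^-1 : R) ^+ l <= 2.
Proof.
suff -> : \sum_(l < n) (2^-1 : R) ^+ l = 2 - 2 * (2^-1) ^+ n.
  by rewrite lerBlDr lerDl mulr_ge0// exprn_ge0.
elim: n => [|n IH]; first by rewrite big_ord0 expr0 mulr1 subrr.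
rewrite big_ord_recr/= IH exprS; lra.
Qed.

Section MomentLower.
Variables (Om : finType) (rho : Om -> R) (Z : Om -> R).
Hypothesis rho0 : forall w, 0 <= rho w.
Hypothesis rho1 : \sum_w rho w = 1.

(** Let n be the number of l < lm with |Z| <= 2^-l. Then |Z| >= 2^-n unless n = lm,
and n has mean at most 2C. By Jensen's inequality for y |-> 2^(-s y), the
s-th moment is bounded below by the s-th power of a constant, up to an error that
lm makes small. The form of the bound is what keeps all later constants
independent of s. *)
Lemma moment_lower_bound (lm : nat) (C s : R) : 0 < s -> 0 <= C ->
  (forall l, (l < lm)%N -> \sum_(w | `|Z w| <= 2^-1 ^+ l) rho w <= C * 2^-1 ^+ l) ->
  2 `^ (- (s * (C * 2))) - 2 `^ (- (s * lm%:R)) <= \sum_w rho w * `|Z w| `^ s.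
Proof.
move=> s0 C0 sb.
(* The number of dyadic levels below which Z w lies. *)
pose n w : nat := (\sum_(l < lm) (`|Z w| <= 2^-1 ^+ l)%R)%N.
have nlm w : (n w <= lm)%N.
  apply: (@leq_trans (\sum_(l < lm) 1)%N); last by rewrite sum_nat_const card_ord muln1.
  by apply: leq_sum => l _; case: (_ <= _).
have pt w : 2 `^ (- (s * (n w)%:R)) - 2 `^ (- (s * lm%:R)) <= `|Z w| `^ s.
  move: (nlm w); rewrite leq_eqVlt => /predU1P[->|nl].
    by rewrite subrr powR_ge0.
  have h : 2^-1 ^+ (n w) <= `|Z w|.
    rewrite leNgt; apply/negP => Zn.
    have : (n w < n w)%N.
      rewrite {2}/n (leq_trans (_ : _ <= \sum_(l < lm) (l <= n w)))%N//.
        rewrite -(big_mkord xpredT (fun l => (l <= n w) : nat)).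
        rewrite (@big_cat_nat _ _ _ (n w).+1)//= -[leqLHS]addn0 leq_add//.
        rewrite big_nat (eq_bigr (fun=> 1%N)) -?big_nat ?sum_nat_const_nat ?subn0 ?muln1//.
        by move=> i /andP[_]; rewrite ltnS => ->.
      apply: leq_sum => l _; case: (leqP l (n w)) => // ln.
      by rewrite (le_trans (ltW Zn))// ler_wiXn2l// ?invr_ge0// invf_le1// ler1n.
    by rewrite ltnn.
  rewrite lerBlDr (@le_trans _ _ (`|Z w| `^ s))// ?lerDl ?powR_ge0//.
  rewrite mulrC -mulNr powRrM powR_invn// -exprVn.
  by rewrite ge0_ler_powR ?nnegrE ?exprn_ge0// ltW.
apply: (@le_trans _ _ (\sum_w rho w * (2 `^ (- (s * (n w)%:R)) - 2 `^ (- (s * lm%:R))))).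
  under [leRHS]eq_bigr do rewrite mulrBr.
  rewrite sumrB -mulr_suml rho1 mul1r lerB//.
  apply: le_trans (finite_jensen_exp2 rho0 rho1 (fun w => (n w)%:R) (ltW s0)).
  rewrite ler_powR ?ler1n// lerN2 ler_wpM2l ?(ltW s0)//.
  under eq_bigr do rewrite natr_sum mulr_sumr.
  rewrite exchange_big/=.
  apply: (@le_trans _ _ (\sum_(l < lm) C * 2^-1 ^+ l)).
    apply: ler_sum => l _; apply: le_trans (sb l (ltn_ord l)).
    rewrite [leRHS]big_mkcond/=; apply: ler_sum => w _.
    by case: ifP; rewrite ?mulr1// mulr0.
  by rewrite -mulr_sumr ler_wpM2l// sum_geometric_half_le2.
by apply: ler_sum => w _; rewrite ler_wpM2l.
Qed.

End MomentLower.

(** With k p >= 2, the bound exp y >= (y/k)^k makes the m-th term O(m^-2). *)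
Lemma exp_decay_summable (c p : R) : 0 < c -> 0 < p -> exists2 K : R, 0 <= K &
  forall L, \sum_(m < L) expR (- (c * m%:R `^ p)) <= K.
Proof.
move=> c0 p0.
pose k := (Num.truncn (2 / p)).+1.
have kp : 2 <= p * k%:R by rewrite mulrC -ler_pdivrMr// ltW// truncnS_gt.
have k0 : 0 < k%:R :> R by rewrite ltr0n.
have bd (m : nat) : (0 < m)%N -> expR (- (c * m%:R `^ p)) <= (k%:R / c) ^+ k / m%:R ^+ 2.
  move=> m0; have mR0 : 0 < m%:R :> R by rewrite ltr0n.
  have y0 : 0 < c * m%:R `^ p by rewrite mulr_gt0 ?powR_gt0.
  have e1 : (c * m%:R `^ p / k%:R) ^+ k <= expR (c * m%:R `^ p).
    rewrite -[X in expR X](@divfK _ k%:R) ?gt_eqF// expRM_natr.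
    rewrite lerXn2r// ?nnegrE ?divr_ge0 ?expR_ge0 ?ltW//.
    rewrite (lt_le_trans _ (expR_ge1Dx _))// ltrDr//.
  rewrite expRN; apply: (@le_trans _ _ ((c * m%:R `^ p / k%:R) ^+ k)^-1).
    by rewrite lef_pV2// ?posrE ?expR_gt0 ?exprn_gt0 ?divr_gt0.
  rewrite -[leLHS]exprVn.
  rewrite (_ : (c * m%:R `^ p / k%:R)^-1 = k%:R / c * (m%:R `^ p)^-1); last first.
    by field; rewrite !gt_eqF// powR_gt0.
  rewrite exprMn ler_wpM2l//.
    by rewrite exprn_ge0 ?divr_ge0 ?ltW.
  rewrite exprVn lef_pV2 ?posrE ?exprn_gt0 ?powR_gt0//.
  rewrite -!powR_mulrn ?powR_ge0 ?(ltW mR0)// -powRrM.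
  by rewrite ler_powR// ler1n.
have K0 : 0 <= (k%:R / c) ^+ k by rewrite exprn_ge0 ?divr_ge0 ?ltW.
exists (1 + (k%:R / c) ^+ k * 2); first by rewrite addr_ge0// mulr_ge0.
case=> [|L]; first by rewrite big_ord0 addr_ge0// mulr_ge0.
rewrite big_ord_recl/= lerD//.
  by rewrite expR_le1 oppr_le0 mulr_ge0 ?powR_ge0// ltW.
apply: (@le_trans _ _ (\sum_(i < L) (k%:R / c) ^+ k * (2 / ((i.+1)%:R * (i.+2)%:R)))).
  apply: ler_sum => i _; apply: le_trans (bd _ _) _ => //.
  rewrite ler_wpM2l// ler_pdivlMr ?mulr_gt0// mulrC ler_pdivrMr ?exprn_gt0//.
  rewrite /bump/= add1n expr2 -!natrM ler_nat; nia.
rewrite -mulr_sumr ler_wpM2l//.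
suff -> : \sum_(i < L) 2 / ((i.+1)%:R * (i.+2)%:R) = 2 - 2 / (L.+1)%:R :> R.
  by rewrite lerBlDr lerDl divr_ge0.
elim: L => [|L IH]; first by rewrite big_ord0 divr1 subrr.
rewrite big_ord_recr/= IH; field.
have L0 : 0 <= L%:R :> R by exact: ler0n.
by apply/andP; split; rewrite gt_eqF//; lra.
Qed.

End MomentBounds.

(** * Discrete laws that imitate stable laws *)

Section StableLikeLaws.
Variable R : realType.
Implicit Types (s r x y u : R).

Lemma sum_option (V : nmodType) (T : finType) (F : option T -> V) :
  \sum_o F o = F None + \sum_t F (Some t).
Proof.
rewrite (bigD1 None)//=; congr (_ + _).
rewrite (reindex_omap Some id)/=; last by case.
by apply: eq_bigl => t; rewrite eqxx.
Qed.

(** W is a nonnegative random weight with law rho. The fourth clause bounds its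
characteristic function like that of a p-stable law, up to an error of order 1/N
that stays harmless for about N independent copies. The last clause bounds the sum
of the r-th moments of n copies, each scaled by n^(-1/p) and by b; its hypothesis
says that b^p / n, the share of one copy, does not exceed 1/N. *)
Definition stable_like_law (p r c D : R) (N : nat) (La : finType) (rho W : La -> R) : Prop :=
  [/\ forall l, 0 <= rho l, \sum_l rho l = 1, forall l, 0 <= W l,
   (forall u, `|u| <= 1 -> 0 <= char_fun rho W u <= expR (- (c * (`|u| `^ p - N%:R^-1)))) &
   (forall (b : R) (n : nat), 0 <= b -> (0 < n)%N -> b `^ p <= n%:R / N%:R ->
     n%:R * (\sum_l rho l * (n%:R `^ (- p^-1) * W l * b) `^ r) <= D * b `^ p)].

(** The weight 1 with probability 1/4 and 0 otherwise: a sum of many signs is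
approximately Gaussian. The probability 1/4 keeps the characteristic function
nonnegative. *)
Lemma stable_like_law_exponent2 : exists c : R, 0 < c /\ forall N0 : nat, exists N : nat,
  (N0 < N)%N /\ exists (La : finType) (rho W : La -> R), stable_like_law 2 2 c 1 N rho W.
Proof.
pose g : R := 1 - cos 2^-1.
have g0 : 0 < g by rewrite subr_gt0 cos_lt1// invr_gt0 ltr0n invf_le1 ?ler1n.
exists (g / 4); split; first by rewrite divr_gt0.
move=> N0; exists N0.+1; split => //.
exists bool, (fun b : bool => if b then 4^-1 else 3 / 4), (fun b : bool => b%:R); split.
- by case.
- by rewrite big_bool/=; lra.
- by case.
- move=> u u1; rewrite /char_fun big_bool/= mulr1 mulr0 cos0 mulr1.
  have cg := cos_quadratic_gap u1.
  apply/andP; split.   by move: (cos_geN1 u); move: (cos u) => y c1; clear -c1; lra.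
  rewrite powR_mulrn// real_normK ?num_real//.
  apply: le_trans (expR_ge1Dx _).
  have : 0 <= g / 4 * N0.+1%:R^-1 by rewrite !mulr_ge0// ltW.
  move: cg; rewrite -/g; clearbody g.
  move: (cos u) (u ^+ 2) (N0.+1%:R^-1) => y v n; clear => h1 h2; lra.
- move=> b n b0 n0 _; rewrite big_bool/= !mulr0 !mul0r mulr1.
  rewrite powR0 ?pnatr_eq0// mulr0 addr0 mul1r powRM ?powR_ge0// -powRrM mulNr mulVf ?pnatr_eq0//.
  have nR : 0 < n%:R :> R by rewrite ltr0n.
  rewrite powR_inv1// mulrCA [n%:R * _]mulrA mulfV ?gt_eqF// mul1r.
  move: (powR_ge0 b 2); move: (b `^ 2) => v; clear => h; lra.
Qed.

(** The weight is 2^(l/p) with probability 2^-l / 4 for l < L, and 0 otherwise, which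
is the tail of a p-stable variable cut off at N^(1/p), N = 2^L. For |u|^p > 1/N
some l satisfies 1/2 < 2^l |u|^p <= 1, and this l alone contributes a fixed
multiple of 2^-l >= |u|^p to 1 minus the characteristic function. Since r > p, the
r-th moment is a geometric sum dominated by its last term, the cut-off. *)
Lemma stable_like_law_exists (p r : R) : 0 < p -> p < r ->
  exists c D : R, [/\ 0 < c, 0 <= D & forall N0 : nat, exists N : nat,
  (N0 < N)%N /\ exists (La : finType) (rho W : La -> R), stable_like_law p r c D N rho W].
Proof.
move=> p0 pr.
(* The smallest value of |u| W at the dyadic level that matches u. *)
pose a : R := 2^-1 `^ p^-1.
have a0 : 0 < a by rewrite powR_gt0// invr_gt0.
have a1 : a <= 1.
  by rewrite powR_le1 ?invr_ge0 ?(ltW p0)// invf_le1// ler1n.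
have ca : 0 < 1 - cos a by rewrite subr_gt0 cos_lt1// a0.
(* The r-th moment of the level l is proportional to q^l with q = 2^(r/p - 1) > 1. *)
pose be := r / p - 1.
have be0 : 0 < be by rewrite subr_gt0 ltr_pdivlMr// mul1r.
pose q : R := 2 `^ be.
have q1 : 1 < q by rewrite /q /powR pnatr_eq0/= expR_gt1 mulr_gt0// ln_gt0// ltr1n.
exists ((1 - cos a) / 4), (4^-1 / (q - 1)); split; first by rewrite divr_gt0.
  by rewrite divr_ge0// subr_ge0 ltW.
move=> L; exists (2 ^ L)%N; split; first by rewrite ltn_expl.
pose rho (o : option 'I_L) : R :=
  if o is Some l then 2^-1 ^+ l / 4 else 1 - \sum_(l < L) 2^-1 ^+ l / 4.
pose W (o : option 'I_L) : R := if o is Some l then (2 ^+ l) `^ p^-1 else 0.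
have srho : \sum_(l < L) 2^-1 ^+ l / 4 <= 2^-1 :> R.
  rewrite -mulr_suml ler_pdivrMr// (le_trans (sum_geometric_half_le2 R _))//; lra.
have rho0 o : 0 <= rho o.
  case: o => [l|]/=; first by rewrite mulr_ge0 ?exprn_ge0.
  by move: srho; set S := \sum_(l < L) _; lra.
exists (option 'I_L), rho, W; split => //.
- by rewrite sum_option/= subrK.
- by case=> [l|]//=; rewrite powR_ge0.
- move=> u u1.
  have cf : char_fun rho W u = 1 - \sum_(l < L) 2^-1 ^+ l / 4 * (1 - cos (u * W (Some l))).
    rewrite /char_fun sum_option/= mulr0 cos0 mulr1.
    under [X in _ = 1 - X]eq_bigr do rewrite mulrBr mulr1.
    by rewrite sumrB opprB addrA addrAC.
  have t0 (l : 'I_L) : 0 <= (2^-1 : R) ^+ l / 4 by rewrite mulr_ge0 ?exprn_ge0.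
  rewrite cf; apply/andP; split.
    rewrite subr_ge0 (@le_trans _ _ (\sum_(l < L) 2^-1 ^+ l / 4 * 2))//.
      by apply: ler_sum => l _; rewrite ler_wpM2l// lerBlDr -lerBlDl;
        move: (cos_geN1 (u * W (Some l))) => c1; clear -c1; lra.
    by rewrite -mulr_suml; lra.
  apply: le_trans (expR_ge1Dx _); rewrite lerD2l lerN2 natrX.
  have [Nu|Nu] := leP (2 ^+ L * `|u| `^ p) 1.
    apply: (@le_trans _ _ 0); last by apply: sumr_ge0 => l _; rewrite mulr_ge0// subr_ge0 cos_le1.
    rewrite mulr_ge0_le0 ?divr_ge0 ?(ltW ca)// subr_le0.
    by rewrite -[leRHS]div1r ler_pdivlMr ?exprn_gt0// mulrC.
  have u0 : 0 < `|u|.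
    rewrite lt_neqAle normr_ge0 andbT eq_sym; apply: contraTneq Nu => ->.
    by rewrite powR0 ?gt_eqF// mulr0 -leNgt.
  have up0 : 0 < `|u| `^ p <= 1.
    by rewrite powR_gt0//= powR_le1 ?(ltW p0).
  have [l /andP[l1 l2]] := dyadic_scale up0.
  have lL : (l < L)%N.
    rewrite ltnNge; apply/negP => Ll.
    suff : 2 ^+ L * `|u| `^ p <= 1 by rewrite leNgt Nu.
    by apply: le_trans l2; rewrite ler_wpM2r ?powR_ge0// ler_eXn2l ?ltr1n.
  rewrite (bigD1 (Ordinal lL))//= -[leLHS]addr0 lerD//; last first.
    by apply: sumr_ge0 => i _; rewrite mulr_ge0// subr_ge0 cos_le1.
  have uW : cos (u * (2 ^+ l) `^ p^-1) <= cos a.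
    rewrite -cos_norm normrM (ger0_norm (powR_ge0 _ _)).
    have -> : `|u| * (2 ^+ l) `^ p^-1 = (2 ^+ l * `|u| `^ p) `^ p^-1.
      rewrite powRM ?exprn_ge0 ?powR_ge0// -powRrM mulfV ?gt_eqF// powRr1// mulrC//.
    have h0 : 0 <= 2 ^+ l * `|u| `^ p by rewrite mulr_ge0 ?exprn_ge0 ?powR_ge0.
    apply: le_cos_itv; first exact: ltW.
      by rewrite powR_le ?invr_ge0 ?(ltW p0)// ltW.
    by rewrite powR_le1 ?invr_ge0 ?(ltW p0).
  apply: (@le_trans _ _ ((1 - cos a) / 4 * `|u| `^ p)).
    by rewrite ler_wpM2l ?divr_ge0 ?(ltW ca)// lerBlDr lerDl.
  rewrite /=; set h := 2^-1 ^+ l.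
  apply: (@le_trans _ _ ((1 - cos a) / 4 * h)).
    rewrite ler_wpM2l ?divr_ge0 ?(ltW ca)// /h exprVn.
    by rewrite -[leRHS]mul1r ler_pdivlMr ?exprn_gt0// mulrC.
  rewrite (_ : _ / 4 * h = h / 4 * (1 - cos a)); last by ring.
  by rewrite ler_wpM2l ?(t0 (Ordinal lL))// lerD2l lerN2.
- move=> b n b0 n0 bn; rewrite sum_option/= mulr0 mul0r.
  have r0 : 0 < r by exact: lt_trans pr.
  have nR : 0 < n%:R :> R by rewrite ltr0n.
  rewrite powR0 ?gt_eqF// mulr0 add0r.
  have term (l : 'I_L) : 2^-1 ^+ l / 4 * (n%:R `^ (- p^-1) * (2 ^+ l) `^ p^-1 * b) `^ r =
      n%:R `^ (- (r / p)) * b `^ r / 4 * q ^+ l.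
    have -> : q ^+ l = 2^-1 ^+ l * (2 ^+ l) `^ (r / p).
      rewrite exprVn -powR_invn// -(powR_mulrn l (ler0n R 2)) -powR_mulrn ?powR_ge0// /q -!powRrM.
      rewrite -powRD ?pnatr_eq0 ?implybT//.
      by congr (_ `^ _); rewrite /be; ring.
    rewrite !powRM ?mulr_ge0 ?powR_ge0 ?exprn_ge0// -!powRrM.
    rewrite mulNr [p^-1 * r]mulrC; ring.
  under eq_bigr do rewrite term.
  rewrite -mulr_sumr.
  have geo : \sum_(l < L) q ^+ l <= q ^+ L / (q - 1).
    have := subrX1 q L => /(congr1 (fun z => z / (q - 1))).
    rewrite mulrAC mulfV ?mul1r ?subr_eq0 ?gt_eqF// => <-.
    by rewrite ler_wpM2r ?invr_ge0 ?subr_ge0 ?(ltW q1)// lerBlDr lerDl.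
  have qL : q ^+ L = (2 ^+ L) `^ be.
    by rewrite /q -!powR_mulrn ?powR_ge0// -!powRrM mulrC.
  have bE : b `^ r = b `^ p * (b `^ p) `^ be.
    rewrite -powRrM -powRD; first by congr (_ `^ _); rewrite /be; field; rewrite gt_eqF.
    apply/implyP => /eqP e; exfalso; move/eqP: e; apply/negP; rewrite gt_eqF//.
    by rewrite addr_gt0// mulr_gt0.
  have bbe : (b `^ p) `^ be <= n%:R `^ be / q ^+ L.
    rewrite qL -powRN (_ : (2 ^+ L) `^ (- be) = (2 ^+ L)^-1 `^ be); last first.
      by rewrite -[X in _ = X `^ _]powR_inv1 ?exprn_ge0// -powRrM mulN1r.
    rewrite -powRM ?invr_ge0 ?exprn_ge0// powR_le ?(ltW be0) ?powR_ge0//.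
    by rewrite -natrX.
  have nE : n%:R * n%:R `^ (- (r / p)) * n%:R `^ be = 1 :> R.
    rewrite -[X in X * _ * _]powRr1// -!powRD ?(gt_eqF nR) ?implybT//.
    by rewrite /be (_ : _ + _ = 0) ?powRr0//; ring.
  have qL0 : 0 < q ^+ L by rewrite exprn_gt0// (lt_trans _ q1).
  rewrite bE.
  apply: (@le_trans _ _ (n%:R * (n%:R `^ (- (r / p)) * (b `^ p * (n%:R `^ be / q ^+ L)) / 4
       * (q ^+ L / (q - 1))))).
    rewrite ler_wpM2l//; apply: ler_pM => //.
    - by rewrite !mulr_ge0 ?powR_ge0.
    - by apply: sumr_ge0 => l _; rewrite exprn_ge0// ltW// (lt_trans _ q1).
    - by rewrite ler_wpM2r// ler_wpM2l ?powR_ge0// ler_wpM2l ?powR_ge0.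
  rewrite le_eqVlt; apply/orP; left; apply/eqP.
  transitivity ((n%:R * n%:R `^ (- (r / p)) * n%:R `^ be) * (4^-1 / (q - 1) * b `^ p)).
    by field; rewrite subr_eq0 !gt_eqF.
  by rewrite nE mul1r.
Qed.

End StableLikeLaws.

(** * Real and complex scalars *)

Section Scalars.
Variables (R : realType) (k : scalar_kind).
Local Notation S := (scalarType R k).

Definition real_scalar : R -> S :=
  match k return R -> scalarType R k with
  | RealScalars => id
  | ComplexScalars => fun x => (x%:C)%C
  end.

Definition scalar_re : S -> R :=
  match k return scalarType R k -> R with
  | RealScalars => id
  | ComplexScalars => @complex.Re R
  end.

Definition scalar_im : S -> R :=
  match k return scalarType R k -> R with
  | RealScalars => fun _ => 0
  | ComplexScalars => @complex.Im R
  end.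

End Scalars.

Section ScalarTheory.
Variables (R : realType) (k : scalar_kind).
Local Notation S := (scalarType R k).
Local Notation rs := (@real_scalar R k).
Implicit Types (x y : R) (z : S).

Lemma real_scalar0 : rs 0 = 0. Proof. by rewrite /real_scalar; case: k. Qed.
Lemma real_scalar1 : rs 1 = 1. Proof. by rewrite /real_scalar; case: k. Qed.
Lemma real_scalarD x y : rs (x + y) = rs x + rs y.
Proof. by rewrite /real_scalar; case: k => //=; rewrite rmorphD. Qed.
Lemma real_scalarM x y : rs (x * y) = rs x * rs y.
Proof. by rewrite /real_scalar; case: k => //=; rewrite rmorphM. Qed.
Lemma real_scalarN x : rs (- x) = - rs x.
Proof. by rewrite /real_scalar; case: k => //=; rewrite rmorphN. Qed.

Lemma real_scalar_sum (I : Type) (t : seq I) (P : pred I) (f : I -> R) :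
  rs (\sum_(i <- t | P i) f i) = \sum_(i <- t | P i) rs (f i).
Proof. exact: (big_morph _ real_scalarD real_scalar0). Qed.

Lemma real_scalar_sign (b : bool) : rs ((-1) ^+ b) = (-1) ^+ b.
Proof. by case: b; rewrite ?expr0 ?expr1 ?real_scalarN real_scalar1. Qed.

Lemma modulusM x z : modulus (rs x * z) = `|x| * modulus z.
Proof.
move: z; rewrite /real_scalar /modulus; case: k => /= [z|z]; first by rewrite normrM.
rewrite ComplexField.Normc.normcM /ComplexField.Normc.normc /=.
by rewrite expr0n/= addr0 sqrtr_sqr.
Qed.

Lemma modulus1 : modulus (1 : S) = 1.
Proof.
rewrite /modulus; case: k => /=; first by rewrite normr1.
by rewrite /ComplexField.Normc.normc /= expr0n expr1n addr0 sqrtr1.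
Qed.

Lemma modulus_ge0 z : 0 <= modulus z.
Proof. by move: z; rewrite /modulus; case: k => //= -[a b]; rewrite /ComplexField.Normc.normc sqrtr_ge0. Qed.

Lemma scalar_reD z z' : scalar_re (z + z') = scalar_re z + scalar_re z'.
Proof. by move: z z'; rewrite /scalar_re; case: k => //= -[a b] [a' b']. Qed.

Lemma scalar_imD z z' : scalar_im (z + z') = scalar_im z + scalar_im z'.
Proof. by move: z z'; rewrite /scalar_im; case: k => //= [? ?|[a b] [a' b']//]; rewrite addr0. Qed.

Lemma scalar_reM x z : scalar_re (rs x * z) = x * scalar_re z.
Proof. by move: z; rewrite /scalar_re /real_scalar; case: k => //= -[a b]/=; rewrite mul0r subr0. Qed.

Lemma scalar_imM x z : scalar_im (rs x * z) = x * scalar_im z.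
Proof.
by move: z; rewrite /scalar_im /real_scalar; case: k => //= [z|[a b]/=]; rewrite ?mulr0// mul0r addr0.
Qed.

Lemma scalar_re_sum (I : Type) (t : seq I) (P : pred I) (f : I -> S) :
  scalar_re (\sum_(i <- t | P i) f i) = \sum_(i <- t | P i) scalar_re (f i).
Proof. by apply: (big_morph _ scalar_reD); rewrite /scalar_re; case: k. Qed.

Lemma scalar_im_sum (I : Type) (t : seq I) (P : pred I) (f : I -> S) :
  scalar_im (\sum_(i <- t | P i) f i) = \sum_(i <- t | P i) scalar_im (f i).
Proof. by apply: (big_morph _ scalar_imD); rewrite /scalar_im; case: k. Qed.

Lemma norm_scalar_re z : `|scalar_re z| <= modulus z.
Proof.
move: z; rewrite /scalar_re /modulus; case: k => //= -[a b] /=.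
by rewrite /ComplexField.Normc.normc -sqrtr_sqr ler_sqrt ?addr_ge0 ?sqr_ge0// lerDl sqr_ge0.
Qed.

Lemma norm_scalar_im z : `|scalar_im z| <= modulus z.
Proof.
move: z; rewrite /scalar_im /modulus; case: k => //= [z|[a b]/=]; first by rewrite normr0.
by rewrite /ComplexField.Normc.normc -sqrtr_sqr ler_sqrt ?addr_ge0 ?sqr_ge0// lerDr sqr_ge0.
Qed.

Lemma modulus_le_re_im z : modulus z <= `|scalar_re z| + `|scalar_im z|.
Proof.
move: z; rewrite /scalar_im /scalar_re /modulus; case: k => //= [z|[a b]/=]; first by rewrite normr0 addr0.
rewrite /ComplexField.Normc.normc -[leRHS]ger0_norm ?addr_ge0// -sqrtr_sqr ler_sqrt ?sqr_ge0//.
rewrite sqrrD !real_normK ?num_real// -addrA lerD2l lerDr mulrn_wge0// mulr_ge0//.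
Qed.

End ScalarTheory.

(** The f k are to be split into n k equal pieces each; pi tells to which k a piece
belongs. *)
Lemma enumerate_multiset (m : nat) (n : 'I_m -> nat) :
  exists (K : nat) (pi : 'I_K -> 'I_m), forall (V : nmodType) (f : 'I_m -> V),
    \sum_(i < K) f (pi i) = \sum_k f k *+ n k.
Proof.
pose J := {k : 'I_m & 'I_(n k)}.
exists #|{: J}|, (fun i => tag (enum_val i)) => V f.
rewrite -(big_enum_val (A := {: J}) (fun j : J => f (tag j)))/=.
rewrite (eq_bigr (fun k => \sum_(j : 'I_(n k)) f k)); last by move=> k _; rewrite sumr_const card_ord.
by rewrite (@sig_big_dep _ _ _ _ _ xpredT (fun=> xpredT) (fun k (j : 'I_(n k)) => f k)).
Qed.

(** * Randomisation of p-sums *)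

Lemma rademacher_type_power (R : realType) (k : scalar_kind)
    (Y : lmodType (scalarType R k)) (N : Y -> R) (r C : R) (K : nat) (F : 'I_K -> Y) :
  0 < r -> 0 <= C -> rademacher_type_bound N r C ->
  rademacher_mean N r F <= C `^ r * \sum_(i < K) N (F i) `^ r.
Proof.
move=> r0 C0 /(_ K F).
have m0 : 0 <= rademacher_mean N r F.
  by rewrite mulr_ge0// ?invr_ge0 ?exprn_ge0// sumr_ge0// => e _; rewrite powR_ge0.
have s0 : 0 <= \sum_(i < K) N (F i) `^ r by apply: sumr_ge0 => i _; rewrite powR_ge0.
move=> /(@powR_le _ _ _ r (ltW r0) (powR_ge0 _ _)).
rewrite powRM ?powR_ge0// -!powRrM mulVf ?gt_eqF// !powRr1//.
Qed.

Section RandomPieces.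
Variables (R : realType) (m K : nat) (pi : 'I_K -> 'I_m).
Variables (La : finType) (rho W : La -> R) (cf : 'I_m -> R).
Hypothesis rho0 : forall l, 0 <= rho l.
Hypothesis rho1 : \sum_l rho l = 1.

Local Notation Om := ({ffun 'I_K -> bool} * {ffun 'I_K -> La})%type.

(** The K pieces carry independent uniform signs o.1 i and independent weights
W (o.2 i), with o.2 i of law rho. *)
Definition piece_prob (o : Om) : R := (2 ^+ K)^-1 * \prod_i rho (o.2 i).

Definition piece_coef (o : Om) (k : 'I_m) : R :=
  \sum_(i | pi i == k) (-1) ^+ o.1 i * (cf k * W (o.2 i)).

Lemma piece_prob_ge0 o : 0 <= piece_prob o.
Proof. by rewrite mulr_ge0 ?invr_ge0 ?exprn_ge0// prodr_ge0. Qed.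

Lemma piece_mean (f : Om -> R) :
  \sum_o piece_prob o * f o =
  \sum_(w : {ffun 'I_K -> La}) (\prod_i rho (w i)) *
    ((2 ^+ K)^-1 * \sum_(e : {ffun 'I_K -> bool}) f (e, w)).
Proof.
rewrite (eq_bigr (fun o : Om => piece_prob (o.1, o.2) * f (o.1, o.2))); last by move=> [].
rewrite -(pair_bigA _ (fun e w => piece_prob (e, w) * f (e, w)))/= exchange_big/=.
apply: eq_bigr => w _; rewrite mulrA mulr_sumr; apply: eq_bigr => e _.
by rewrite /piece_prob/= [_^-1 * _]mulrC.
Qed.

Lemma sum_prod_prob : \sum_(w : {ffun 'I_K -> La}) \prod_i rho (w i) = 1.
Proof. by rewrite -(bigA_distr_bigA (fun _ : 'I_K => rho)) big1. Qed.

Lemma piece_prob_sum : \sum_o piece_prob o = 1.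
Proof.
transitivity (\sum_o piece_prob o * 1); first by apply: eq_bigr => o _; rewrite mulr1.
rewrite (piece_mean (fun=> 1)) -[RHS]sum_prod_prob; apply: eq_bigr => w _.
rewrite sumr_const card_ffun card_bool card_ord -natrX mulVf ?mulr1//.
Qed.

Lemma marginal_mean (g : La -> R) (j : 'I_K) :
  \sum_(w : {ffun 'I_K -> La}) (\prod_i rho (w i)) * g (w j) = \sum_l rho l * g l.
Proof.
transitivity (\sum_(w : {ffun 'I_K -> La})
    \prod_i (rho (w i) * (if i == j then g (w i) else 1))).
  apply: eq_bigr => w _; rewrite big_split/=; congr (_ * _).
  by rewrite -big_mkcond/= big_pred1_eq.
rewrite -(bigA_distr_bigA (fun i l => rho l * (if i == j then g l else 1))).
rewrite (bigD1 j)//= eqxx [X in _ * X]big1 ?mulr1// => i /negPf ->.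
by under eq_bigr do rewrite mulr1.
Qed.

Lemma piece_coef_sum (a : 'I_m -> R) o :
  \sum_k a k * piece_coef o k =
  \sum_i (-1) ^+ o.1 i * (a (pi i) * cf (pi i) * W (o.2 i)).
Proof.
rewrite [RHS](partition_big pi xpredT)//=; apply: eq_bigr => k _.
rewrite mulr_sumr; apply: eq_bigr => i /eqP ->; ring.
Qed.

Lemma piece_mean_cos (a : 'I_m -> R) (x : R) :
  \sum_o piece_prob o * cos (x * \sum_k a k * piece_coef o k) =
  \prod_i char_fun rho W (x * (a (pi i) * cf (pi i))).
Proof.
rewrite piece_mean -mean_cos_random_sum; apply: eq_bigr => w _.
congr (_ * (_ * _)); first by rewrite card_ord.
apply: eq_bigr => e _; rewrite piece_coef_sum/= mulr_sumr; congr cos.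
by apply: eq_bigr => i _; rewrite mulrCA !mulrA.
Qed.

Hypothesis W0 : forall l, 0 <= W l.
Hypothesis cf0 : forall k, 0 <= cf k.

(** Conditionally on the weights, only the signs are random, and the type inequality
applies to the K weighted pieces. *)
Lemma piece_mean_type (k : scalar_kind) (Y : lmodType (scalarType R k)) (N : Y -> R)
    (r C : R) (b : 'I_m -> R) (F : 'I_m -> Y) : 0 < r -> 0 <= C -> quasi_norm N ->
  rademacher_type_bound N r C -> (forall j, N (F j) <= b j) ->
  \sum_o piece_prob o * N (\sum_j real_scalar k (piece_coef o j) *: F j) `^ r <=
  C `^ r * \sum_i \sum_l rho l * (cf (pi i) * W l * b (pi i)) `^ r.
Proof.
move=> r0 C0 [N0 Neq0 NZ _] NC Fb.
rewrite piece_mean.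
pose G (w : {ffun 'I_K -> La}) i := real_scalar k (cf (pi i) * W (w i)) *: F (pi i).
have GE e w : \sum_j real_scalar k (piece_coef (e, w) j) *: F j =
    \sum_i ((-1) ^+ e i : scalarType R k) *: G w i.
  rewrite [RHS](partition_big pi xpredT)//=; apply: eq_bigr => j _.
  rewrite real_scalar_sum scaler_suml; apply: eq_bigr => i /eqP <-.
  by rewrite real_scalarM real_scalar_sign scalerA.
apply: (@le_trans _ _ (\sum_(w : {ffun 'I_K -> La}) (\prod_i rho (w i)) *
    (C `^ r * \sum_i (cf (pi i) * W (w i) * b (pi i)) `^ r))).
  apply: ler_sum => w _; rewrite ler_wpM2l ?prodr_ge0//.
  under eq_bigr do rewrite GE.
  apply: le_trans (rademacher_type_power (G w) r0 C0 NC) _.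
  rewrite ler_wpM2l ?powR_ge0//; apply: ler_sum => i _.
  have cW : 0 <= cf (pi i) * W (w i) by rewrite mulr_ge0.
  rewrite powR_le ?(ltW r0)// NZ -[real_scalar _ _]mulr1 modulusM.
  by rewrite ger0_norm// modulus1 mulr1 ler_pM.
under eq_bigr do rewrite mulrCA mulr_sumr.
rewrite -mulr_sumr exchange_big/= ler_wpM2l ?powR_ge0//.
apply: ler_sum => i _.
by rewrite (marginal_mean (fun l => (cf (pi i) * W l * b (pi i)) `^ r)).
Qed.

End RandomPieces.

Section Randomization.
Variables (R : realType) (p r c D : R).
Hypotheses (p0 : 0 < p) (pr : p <= r) (c0 : 0 < c) (D0 : 0 <= D).

(** The characteristic function of the sum is a product over the pieces. The
exponents -c x^p |a_k|^p / n_k add up to -c x^p, and the K error terms c/N to at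
most 2c. The lower bound on n_k keeps every argument in [-1, 1]. *)
Lemma piece_char_decay (N m K : nat) (La : finType) (rho W : La -> R)
    (n : 'I_m -> nat) (pi : 'I_K -> 'I_m) (a : 'I_m -> R) (x : R) :
  stable_like_law p r c D N rho W -> (0 < N)%N ->
  (forall (V : nmodType) (f : 'I_m -> V), \sum_(i < K) f (pi i) = \sum_k f k *+ n k) ->
  (forall k, 0 < n k)%N -> K%:R <= 2 * N%:R :> R ->
  \sum_k `|a k| `^ p = 1 -> 0 <= x -> (forall k, x `^ p <= (n k)%:R) ->
  \sum_o piece_prob rho o *
     cos (x * \sum_k a k * piece_coef pi W (fun k => (n k)%:R `^ (- p^-1)) o k)
    <= expR (c * 2) * expR (- (c * x `^ p)).
Proof.
move=> [rho0 rho1 W0 chi _] N0 piE n0 KN a1 x0 xn.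
rewrite piece_mean_cos//.
have NR : 0 < N%:R :> R by rewrite ltr0n.
have nR k : 0 < (n k)%:R :> R by rewrite ltr0n.
have ak k : `|a k| <= 1.
  rewrite leNgt; apply/negP => /(powR_gt1 p0); rewrite ltNge => /negP; apply.
  by rewrite -a1 (bigD1 k)//= lerDl sumr_ge0// => j _; rewrite powR_ge0.
have pw k : (x * (`|a k| * (n k)%:R `^ (- p^-1))) `^ p = x `^ p * (`|a k| `^ p / (n k)%:R).
  rewrite !powRM ?mulr_ge0 ?powR_ge0// -powRrM mulNr mulVf ?gt_eqF//.
  by rewrite powR_inv1.
have nrm k : `|x * (a k * (n k)%:R `^ (- p^-1))| = x * (`|a k| * (n k)%:R `^ (- p^-1)).
  by rewrite !normrM (ger0_norm x0) (ger0_norm (powR_ge0 _ _)).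
have le1 k : `|x * (a k * (n k)%:R `^ (- p^-1))| <= 1.
  rewrite nrm leNgt; apply/negP => h.
  have := powR_gt1 p0 h.
  rewrite pw ltNge mulrA => /negP; apply.
  rewrite ler_pdivrMr// mul1r (le_trans _ (xn k))// ler_piMr ?powR_ge0//.
  by rewrite powR_le1 ?(ltW p0).
apply: (@le_trans _ _ (\prod_i expR (- (c * (x `^ p * (`|a (pi i)| `^ p / (n (pi i))%:R) - N%:R^-1))))).
  apply: ler_prod => i _; have := chi _ (le1 (pi i)).
  by rewrite nrm pw.
rewrite -expR_sum -expRD ler_expR sumrN -mulr_sumr sumrB -mulr_sumr.
rewrite (piE R (fun k => `|a k| `^ p / (n k)%:R)).
under eq_bigr do rewrite -(mulr_natr (_ / _)) divfK ?gt_eqF//.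
rewrite a1 mulr1 sumr_const card_ord mulrBr opprB lerD2r ler_wpM2l ?(ltW c0)//.
by rewrite -[leLHS]mulr_natl ler_pdivrMr.
Qed.

Lemma exists_powR2_le (v s : R) : 0 < v -> 0 < s -> exists lm : nat, 2 `^ (- (s * lm%:R)) <= v.
Proof.
move=> v0 s0; have l2 : 0 < ln 2 :> R by rewrite ln_gt0// ltr1n.
exists (Num.truncn (- (ln v / ln 2) / s)).+1.
have vE : 2 `^ (ln v / ln 2) = v by rewrite /powR pnatr_eq0/= divfK ?gt_eqF// lnK.
rewrite -[leRHS]vE ler_powR ?ler1n// lerNl.
rewrite -ler_pdivrMl// mulrC ltW// truncnS_gt//.
Qed.

(** The random coefficients eta may depend on s and on the bounds b for the norms
of the vectors, but not on a nor on the space; kap does not depend on s. The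
constants are written as kap^s and (C / kap)^s, so that their 1/s-th powers do not
degenerate as s tends to 0. *)
Definition randomizes (kap : R) : Prop :=
  forall (m : nat) (b : 'I_m -> R) (s : R), (forall k, 0 <= b k) ->
  \sum_k b k `^ p <= 1 -> 0 < s <= p ->
  exists (Om : finType) (prob : Om -> R) (eta : Om -> 'I_m -> R),
  [/\ forall o, 0 <= prob o, \sum_o prob o = 1,
      forall a : 'I_m -> R,
        kap `^ s * (\sum_k `|a k| `^ p) `^ (s / p) <=
        \sum_o prob o * `|\sum_k a k * eta o k| `^ s &
      forall (k : scalar_kind) (Y : lmodType (scalarType R k)) (N : Y -> R) (C : R)
        (F : 'I_m -> Y), 0 <= C -> quasi_norm N -> rademacher_type_bound N r C ->
        (forall j, N (F j) <= b j) ->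
        \sum_o prob o * N (\sum_j real_scalar k (eta o j) *: F j) `^ s <= (C / kap) `^ s].

Hypothesis gw : forall N0 : nat, exists N : nat,
  (N0 < N)%N /\ exists (La : finType) (rho W : La -> R), stable_like_law p r c D N rho W.

(** Each vector with norm bound b_k is split into n_k pieces with n_k about N b_k^p,
so that there are O(N) pieces in all and each has size at most N^(-1/p). The
small-ball estimate at the first lm dyadic levels gives the lower bound, and the
type r the upper one. *)
Lemma randomization_exists : exists2 kap : R, 0 < kap & randomizes kap.
Proof.
have [G0 G00 HG] := exp_decay_summable c0 p0.
pose G := expR (c * 2) * G0.
have G_ge0 : 0 <= G by rewrite mulr_ge0 ?expR_ge0.
pose Cs : R := 2 / cos 1 ^+ 2 * G.
have Cs0 : 0 <= Cs by rewrite mulr_ge0// divr_ge0// sqr_ge0.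
have r0 : 0 < r by exact: lt_le_trans pr.
(* k1 comes from the small-ball estimate, k2 from the r-th moments of the weights. *)
pose k1 : R := 2 `^ (- (Cs * 2 + 1)).
pose k2 : R := (D `^ r^-1 + 1)^-1.
have k10 : 0 < k1 by rewrite powR_gt0.
have k20 : 0 < k2 by rewrite invr_gt0 ltr_wpDl ?powR_ge0.
exists (Num.min k1 k2); first by rewrite lt_min k10.
move=> m b s b0 b1 /andP[s0 sp].
(* The number of levels depends on s; the constant k1 does not. *)
have [lm Hlm] : exists lm : nat,
    k1 `^ s <= 2 `^ (- (s * (Cs * 2))) - 2 `^ (- (s * lm%:R)).
  have v0 : 0 < 2 `^ (- (s * (Cs * 2))) * (1 - 2 `^ (- s)) :> R.
    rewrite mulr_gt0 ?powR_gt0// subr_gt0 powRN invf_lt1 ?powR_gt0//.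
    by rewrite /powR pnatr_eq0/= expR_gt1 mulr_gt0// ln_gt0// ltr1n.
  have [lm hlm] := exists_powR2_le v0 s0; exists lm.
  rewrite lerBrDl; apply: le_trans (lerD hlm (lexx _)) _.
  rewrite mulrBr mulr1 /k1 -powRrM -powRD ?pnatr_eq0 ?implybT//.
  rewrite (_ : - (Cs * 2 + 1) * s = - (s * (Cs * 2)) + - s); last by ring.
  by rewrite subrK.
(* At least L0 pieces for each vector keep the frequencies up to 2^lm in the range
   where the characteristic function is controlled; N exceeds m (L0 + 1), so that
   these additional pieces at most double the total. *)
pose L0 := (Num.truncn ((2 ^+ lm : R) `^ p)).+1.
have L0p : (2 ^+ lm) `^ p <= L0%:R :> R by rewrite ltW// truncnS_gt.
have [N [N0 [La [rho [W gwN]]]]] := gw (m * L0.+1)%N.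
have [rho0 rho1 W0 chi typ] := gwN.
have NR : 0 < N%:R :> R by rewrite ltr0n (leq_ltn_trans _ N0).
pose n k : nat := ((Num.truncn (N%:R * b k `^ p)).+1 + L0)%N.
have nlb k : N%:R * b k `^ p <= (n k)%:R.
  by rewrite natrD ltW// ltr_wpDr// truncnS_gt.
have nub k : (n k)%:R <= N%:R * b k `^ p + L0.+1%:R.
  rewrite /n addSnnS natrD lerD2r; have := @truncn_itv R (N%:R * b k `^ p).
  by rewrite mulr_ge0 ?powR_ge0// => /(_ isT)/andP[].
have n0 k : (0 < n k)%N by [].
have [K [pi piE]] := enumerate_multiset n.
have KN : K%:R <= 2 * N%:R :> R.
  have := piE R (fun=> 1); rewrite sumr_const card_ord => ->.
  apply: (le_trans (ler_sum _ (fun k _ => nub k))).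
  rewrite big_split/= -mulr_sumr sumr_const card_ord [leRHS]mulr_natl mulr2n lerD//.
    by rewrite ler_piMr.
  by rewrite -mulrnA ler_nat mulnC ltnW.
pose cf k := (n k)%:R `^ (- p^-1) : R.
have pg := piece_prob_ge0 (K := K) rho0.
have ps := piece_prob_sum K rho1.
exists _, (piece_prob rho (K := K)), (piece_coef pi W cf); split => //.
- move=> a; set A := \sum_k _ `^ p.
  have A0 : 0 <= A by apply: sumr_ge0 => k _; rewrite powR_ge0.
  move: A0; rewrite le_eqVlt => /predU1P[A0|A0].
    rewrite -A0 powR0 ?mulr0; last by rewrite gt_eqF// divr_gt0.
    by apply: sumr_ge0 => o _; rewrite mulr_ge0 ?powR_ge0.
  (* By homogeneity, sum_k |a k|^p = 1 may be assumed. *)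
  pose t := A `^ p^-1.
  have t0 : 0 < t by rewrite powR_gt0.
  pose a' k := a k / t.
  have a'1 : \sum_k `|a' k| `^ p = 1.
    under eq_bigr do rewrite normrM normfV (gtr0_norm t0) powRM ?invr_ge0 ?(ltW t0)//.
    have tp : t `^ p = A by rewrite /t -powRrM mulVf ?gt_eqF// powRr1// ltW.
    rewrite -mulr_suml -/A -{1}tp -powRM ?invr_ge0 ?(ltW t0)// mulfV ?gt_eqF//.
    by rewrite powR1.
  have ZE o : \sum_k a k * piece_coef pi W cf o k = t * \sum_k a' k * piece_coef pi W cf o k.
    rewrite mulr_sumr; apply: eq_bigr => k _; rewrite /a'; field.
    by rewrite gt_eqF.
  pose Z o := \sum_k a' k * piece_coef pi W cf o k.
  have main : k1 `^ s <= \sum_o piece_prob rho o * `|Z o| `^ s.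
    apply: le_trans Hlm _; apply: moment_lower_bound => // l llm.
    pose g j := expR (c * 2) * expR (- (c * j%:R `^ p)) : R.
    have gs : \sum_(j < (2 ^ l)%N) g j <= G.
      by rewrite -mulr_sumr ler_wpM2l ?expR_ge0//; exact: (HG (2 ^ l)%N).
    have := @small_ball R _ (piece_prob rho (K := K)) Z pg ps (2 ^ l)%N g G.
    rewrite expn_gt0/= => /(_ isT).
    rewrite natrX -exprVn; apply => //.
    - by move=> j; rewrite mulr_ge0 ?expR_ge0.
    - rewrite /g powR0 ?gt_eqF// mulr0 oppr0 expR0 mulr1.
      by rewrite (le_trans _ (expR_ge1Dx _))// lerDl mulr_ge0// ltW.
    - move=> j /andP[j0 jl]; apply: (@piece_char_decay N) => //.
        by rewrite -(ltr0n R).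
      move=> k; apply: (@le_trans _ _ L0%:R); last by rewrite ler_nat leq_addl.
      apply: le_trans L0p; rewrite powR_le ?(ltW p0)// -natrX ler_nat.
      by rewrite (leq_trans (ltnW jl))// leq_exp2l// ltnW.
  under eq_bigr do rewrite ZE normrM (gtr0_norm t0) powRM ?(ltW t0)// mulrCA.
  rewrite -mulr_sumr mulrC; apply: ler_pM; rewrite ?powR_ge0//.
    by rewrite /t -powRrM mulrC.
  apply: le_trans main; rewrite powR_le ?(ltW s0)//.
    by rewrite le_min !ltW.
  by rewrite ge_min lexx.
- move=> k Y Nm C F C0 qn tb Fb.
  have N0' y : 0 <= Nm y by case: qn.
  apply: (le_trans (finite_power_mean pg ps (fun o => N0' _) s0 (le_trans sp pr))).
  apply: (@le_trans _ _ ((C `^ r * D) `^ (s / r))).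
    apply: powR_le; first by rewrite divr_ge0 ?ltW.
      by apply: sumr_ge0 => o _; rewrite mulr_ge0 ?powR_ge0.
    apply: le_trans (piece_mean_type pi rho0 rho1 W0 _ r0 C0 qn tb Fb) _.
      by move=> j; rewrite powR_ge0.
    rewrite ler_wpM2l ?powR_ge0//.
    rewrite (piE R (fun j => \sum_l rho l * (cf j * W l * b j) `^ r)).
    apply: (@le_trans _ _ (\sum_j D * b j `^ p)).
      apply: ler_sum => j _; rewrite -[leLHS]mulr_natl; apply: typ => //.
      by rewrite ler_pdivlMr// mulrC.
    by rewrite -mulr_sumr ler_piMr.
  have -> : (C `^ r * D) `^ (s / r) = (C * D `^ r^-1) `^ s.
    rewrite !powRM ?powR_ge0// -!powRrM; congr (_ `^ _ * _ `^ _).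
      by field; rewrite gt_eqF.
    by rewrite mulrC.
  rewrite powR_le ?(ltW s0) ?mulr_ge0 ?powR_ge0// ler_wpM2l//.
  apply: (@le_trans _ _ k2^-1).
    by rewrite /k2 invrK lerDl.
  by rewrite lef_pV2 ?posrE ?lt_min ?k10// ge_min lexx orbT.
Qed.

End Randomization.

(** At p = 2 the Gaussian-like law suffices with r = p; below it the heavy tails make
the strict inequality p < r necessary. *)
Lemma randomization (R : realType) (p r : R) : 0 < p ->
  (p = 2 /\ r = 2) \/ p < r -> exists2 kap : R, 0 < kap & randomizes p r kap.
Proof.
move=> p0 [[-> ->]|pr].
  have [c [c0 gw]] := stable_like_law_exponent2 R.
  exact: randomization_exists gw.
have [c [D [c0 D0 gw]]] := stable_like_law_exists p0 pr.
exact: randomization_exists (ltW pr) c0 D0 gw.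
Qed.

(** * Convex compactness, abstractly *)

Section ConvexCompactness.
Variables (R : realType) (T I : Type) (mid : T -> T -> T) (J : T -> R) (D : I -> set T).
Variable M : R.
Hypothesis J0 : forall t, 0 <= J t.
Hypothesis JM : forall t, J t <= M.

Fixpoint meets (l : seq I) : set T :=
  if l is i :: l' then D i `&` meets l' else setT.

Hypothesis fip : forall l, meets l !=set0.
Hypothesis Dmid : forall i t t', D i t -> D i t' -> D i (mid t t').

Hypothesis complete : forall u : nat -> T,
  (forall n, (J (u n) + J (u n.+1)) / 2 - J (mid (u n) (u n.+1)) <= 2 * 4^-1 ^+ n) ->
  exists t, (forall V, (forall n, J (u n) <= V + 4^-1 ^+ n) -> J t <= V) /\
    forall i n0, (forall n, (n0 <= n)%N -> D i (u n)) -> D i t.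

Hypothesis sep : forall i t t',
  (J t + J t') / 2 <= J (mid t t') -> D i t -> D i t'.

Lemma meets_cat l l' t : meets (l ++ l') t <-> meets l t /\ meets l' t.
Proof. by elim: l => [|i l IH]/=; [split => // -[] | rewrite /setI/= IH; tauto]. Qed.

Lemma meets_mid l t t' : meets l t -> meets l t' -> meets l (mid t t').
Proof. by elim: l => //= i l IH [h1 h2] [h1' h2']; split; [exact: Dmid | exact: IH]. Qed.

(** Let V be the supremum of the infima of J over finitely many constraints. Along
a growing list of constraints whose infima tend to V, near-minimisers of J are
Cauchy because midpoints stay admissible and J is uniformly convex; their limit t0
has J t0 <= V. Repeating this with a further constraint i gives t1 in D i with
J t1 <= V, while the midpoint of t0 and t1 cannot go below V: so t0 and t1 are
indistinguishable and t0 lies in D i. The hypothesis on u is what the parallelogram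
identity requires of a Cauchy sequence. *)
Lemma convex_compactness : exists t, forall i, D i t.
Proof.
pose v l := inf (J @` meets l).
have vlb l t : meets l t -> v l <= J t.
  move=> lt; apply: ge_inf; last by exists t.
  by exists 0 => _ [t' _ <-].
have hinf l : has_inf (J @` meets l).
  split; last by exists 0 => _ [t' _ <-].
  by have [t ?] := fip l; exists (J t), t.
have vub l : v l <= M by have [t lt] := fip l; exact: le_trans (vlb _ _ lt) (JM t).
have vmono l l' : v l <= v (l' ++ l).
  apply: lb_le_inf; first exact: (hinf _).1.
  by move=> _ [t /meets_cat[_ lt] <-]; exact: vlb.
have vmono' l l' : v l <= v (l ++ l').
  apply: lb_le_inf; first exact: (hinf _).1.
  by move=> _ [t /meets_cat[lt _] <-]; exact: vlb.
pose V := sup (range v).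
have hsup : has_sup (range v).
  by split; [exists (v [::]), [::] | exists M => _ [l _ <-]].
have vV l : v l <= V by apply: ub_le_sup; [exact: hsup.2 | exists l].
have e0 n : 0 < (4^-1 : R) ^+ n by rewrite exprn_gt0// invr_gt0.
have [l lV] : {l : nat -> seq I & forall n, V - 4^-1 ^+ n < v (l n)}.
  apply: (@choice _ _ (fun n l => V - 4^-1 ^+ n < v l)) => n.
  have [_ [l _ <-] h] := sup_adherent (e0 n) hsup.
  by exists l.
(* Concatenation makes the lists increasing without lowering the infima. *)
pose L n := flatten (mkseq l n.+1).
have LS n : L n.+1 = L n ++ l n.+1.
  by rewrite /L /mkseq -[in LHS]addn1 iotaD map_cat flatten_cat/= cats0.
have LV n : V - 4^-1 ^+ n < v (L n).
  case: n => [|n]; first by rewrite /L/= cats0.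
  by rewrite LS; apply: lt_le_trans (vmono _ _).
have Lmono n n' t : (n <= n')%N -> meets (L n') t -> meets (L n) t.
  move=> /subnK <-; elim: (n' - n)%N => //= k IH; rewrite addSn LS => /meets_cat[+ _].
  exact: IH.
have lim b : exists t, [/\ J t <= V, meets b t & forall n, meets (L n) t].
  have [u uP] : {u : nat -> T & forall n, meets (b ++ L n) (u n) /\ J (u n) < V + 4^-1 ^+ n}.
    apply: (@choice _ _ (fun n t => meets (b ++ L n) t /\ J t < V + 4^-1 ^+ n)) => n.
    have [_ [t bt <-] h] := inf_adherent (e0 n) (hinf (b ++ L n)).
    by exists t; split => //; apply: lt_le_trans h _; rewrite lerD2r vV.
  have [n|t [Jt Dt]] := @complete u.
    have [/meets_cat[_ h1] j1] := uP n; have [/meets_cat[_ h2] j2] := uP n.+1.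
    have := vlb _ _ (meets_mid h1 (Lmono _ _ _ (leqnSn n) h2)).
    have := LV n; rewrite exprS in j2; move: (e0 n) j1 j2.
    move: (J _) (J _) (J _) (v _) (_ ^+ n) => x y z w e; clear => ? ? ? ? ?; lra.
  exists t; split; first by apply: Jt => n; rewrite ltW//; exact: (uP n).2.
    have : forall n, meets b (u n) by move=> n; have [/meets_cat[]] := uP n.
    elim: {uP} b => //= i b IH bu; split; first by apply: (Dt i 0) => n _; exact: (bu n).1.
    by apply: IH => n; exact: (bu n).2.
  move=> n; have : forall k, (n <= k)%N -> meets (L n) (u k).
    by move=> k nk; have [/meets_cat[_]] := uP k => h _; apply: Lmono nk h.
  elim: (L n) => //= i q IH bu; split; first by apply: (Dt i n) => k nk; exact: (bu k nk).1.
  by apply: IH => k nk; exact: (bu k nk).2.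
have [t0 [Jt0 _ Lt0]] := lim [::].
exists t0 => i; have [t1 [Jt1 [it1 _] Lt1]] := lim [:: i].
apply: sep it1.
suff : V <= J (mid t1 t0) by move: Jt0 Jt1; move: (J _) (J _) (J _) => x y z; clear => ? ? ?; lra.
apply/ler_addgt0Pr => e epos.
have [n hn] : exists n, 4^-1 ^+ n < e.
  have [n hn] : exists n, e^-1 < n%:R by exists (Num.truncn e^-1).+1; exact: truncnS_gt.
  exists n; rewrite exprVn invf_plt ?posrE ?exprn_gt0//.
  by apply: (lt_trans hn); rewrite -natrX ltr_nat ltn_expl.
have := vlb _ _ (meets_mid (Lt1 n) (Lt0 n)); have := LV n; move: hn.
move: (J _) (v _) (_ ^+ n) => x y z; clear => ? ? ?; lra.
Qed.

End ConvexCompactness.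

(** * Nonnegative integrals and almost everywhere limits *)

Section NonnegIntegrals.
Context {dX : measure_display} {X : measurableType dX} {R : realType}.
Variable mu : {measure set X -> \bar R}.
Implicit Types f g : X -> R.

Lemma ge0_int_le f g : measurable_fun setT f -> measurable_fun setT g ->
  (forall x, 0 <= f x) -> (forall x, 0 <= g x) -> {ae mu, forall x, f x <= g x} ->
  (\int[mu]_x (f x)%:E <= \int[mu]_x (g x)%:E)%E.
Proof.
move=> mf mg f0 g0 fg; apply: ae_ge0_le_integral => //.
- by move=> x _; rewrite lee_fin.
- exact/measurable_EFinP.
- by move=> x _; rewrite lee_fin.
- exact/measurable_EFinP.
- by apply: filterS fg => x ? _; rewrite lee_fin.
Qed.

Lemma ge0_intD f g : measurable_fun setT f -> measurable_fun setT g ->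
  (forall x, 0 <= f x) -> (forall x, 0 <= g x) ->
  (\int[mu]_x (f x + g x)%:E = \int[mu]_x (f x)%:E + \int[mu]_x (g x)%:E)%E.
Proof.
move=> mf mg f0 g0; under eq_integral do rewrite EFinD.
apply: ge0_integralD => //; do ?exact/measurable_EFinP;
  by move=> x _; rewrite lee_fin.
Qed.

Lemma ge0_intZ (c : R) f : measurable_fun setT f ->
  (forall x, 0 <= f x) -> 0 <= c ->
  (\int[mu]_x (c * f x)%:E = c%:E * \int[mu]_x (f x)%:E)%E.
Proof.
move=> mf f0 c0; under eq_integral do rewrite EFinM.
apply: ge0_integralZl_EFin => //; first by move=> x _; rewrite lee_fin.
exact/measurable_EFinP.
Qed.

Lemma ge0_int_sum (I : Type) (s : seq I) (F : I -> X -> R) :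
  (forall i, measurable_fun setT (F i)) -> (forall i x, 0 <= F i x) ->
  (\int[mu]_x (\sum_(i <- s) F i x)%:E = \sum_(i <- s) \int[mu]_x (F i x)%:E)%E.
Proof.
move=> mF F0; rewrite -ge0_integral_sum//; last 2 first.
- by move=> i; exact/measurable_EFinP.
- by move=> i x _; rewrite lee_fin.
by apply: eq_integral => x _; rewrite -sumEFin.
Qed.

Lemma nneseries_geometric_le (f : nat -> \bar R) (M : R) : 0 <= M ->
  (forall n, 0 <= f n)%E -> (forall n, (f n <= (M * 2^-1 ^+ n)%:E)%E) ->
  (\sum_(n <oo) f n <= (M * 2)%:E)%E.
Proof.
move=> M0 f0 fM; apply: lime_le; first exact: is_cvg_nneseries.
apply: nearW => n; apply: (@le_trans _ _ (\sum_(0 <= k < n) (M * 2^-1 ^+ k)%:E)%E).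
  by apply: lee_sum => k _.
rewrite sumEFin lee_fin -mulr_sumr ler_wpM2l// big_mkord.
exact: sum_geometric_half_le2.
Qed.

(** Almost everywhere inequalities between nonnegative functions can be integrated, so
the pointwise hypothesis of Fatou's lemma may fail on a null set. *)
Lemma fatou_bound (u : nat -> X -> \bar R) (h : X -> \bar R) (a : nat -> \bar R) (M : \bar R) :
  (forall n, measurable_fun setT (u n)) -> measurable_fun setT h ->
  (forall n x, 0 <= u n x)%E -> (forall x, 0 <= h x)%E ->
  {ae mu, forall x, (h x <= limn_einf (u ^~ x))%E} ->
  (\forall n \near \oo, \int[mu]_x u n x <= a n)%E -> a @ \oo --> M ->
  (\int[mu]_x h x <= M)%E.
Proof.
move=> mu_ mh u0 h0 hu ua aM.
apply: (@le_trans _ _ (\int[mu]_x limn_einf (u ^~ x))%E).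
  apply: ae_ge0_le_integral => //.
  - move=> x _; rewrite limn_einf_lim; apply: lime_ge; first exact: is_cvg_einfs.
    by apply: nearW => n; apply: le_ereal_inf_tmp => _ [k _ <-].
  - under eq_fun do rewrite -[limn_einf _]oppeK -limn_esupN.
    apply: measurableT_comp => //; apply: measurable_fun_limn_esup => n.
    exact: measurableT_comp.
  - by apply: filterS hu.
apply: le_trans (fatou _ measurableT mu_ _) _ => //.
rewrite -(cvg_limn_einf_sup aM).1 !limn_einf_lim.
have [n0 _ n0P] := ua.
apply: lee_lim; [exact: is_cvg_einfs | exact: is_cvg_einfs |].
exists n0 => // n /= n0n; apply: le_ereal_inf_tmp => _ [k /= nk <-].
apply: ereal_inf_le; exists (\int[mu]_x u k x)%E; first by exists k.
by apply: n0P => /=; exact: leq_trans nk.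
Qed.

End NonnegIntegrals.

(** On a sequence of sets of finite measure that covers X, weights that decrease like
2^-n / (1 + mu (F n)) are summable, pointwise and in the mean. *)
Lemma finite_weight (dX : measure_display) (X : measurableType dX) (R : realType)
    (mu : {sigma_finite_measure set X -> \bar R}) :
  exists w : X -> R, [/\ measurable_fun setT w, forall x, 0 < w x &
     (\int[mu]_x (w x)%:E < +oo)%E].
Proof.
have [F [FU _ Ff]] := iffLR (sigma_finiteP _ _) (sigma_finiteT mu).
pose c n : R := 2^-1 ^+ n / (1 + fine (mu (F n))).
have d0 n : 0 < 1 + fine (mu (F n)) by rewrite ltr_pwDl// fine_ge0.
have c0 n : 0 < c n by rewrite divr_gt0// exprn_gt0// invr_gt0.
have c1 n : c n <= 2^-1 ^+ n by rewrite ler_pdivrMr// ler_peMr ?exprn_ge0// lerDl fine_ge0.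
pose f n x : \bar R := (c n * \1_(F n) x)%:E.
have f0 n x : (0 <= f n x)%E by rewrite lee_fin mulr_ge0// ltW.
have mf n : measurable_fun setT (f n).
  apply/measurable_EFinP; apply: measurable_funM => //.
  by apply: measurable_indic; exact: (Ff n).1.
pose t x := (\sum_(n <oo) f n x)%E.
have t2 x : (t x <= 2%:E)%E.
  rewrite -(mul1r 2); apply: nneseries_geometric_le => // n.
  rewrite mul1r lee_fin (le_trans _ (c1 n))// indicE.
  by case: (_ \in _); rewrite ?mulr1// mulr0 ltW.
have t0 x : (0 < t x)%E.
  have : [set: X] x by [].
  rewrite FU => -[n _ Fx]; apply: (@lt_le_trans _ _ (f n x)).
    by rewrite /f indicE mem_set// mulr1 lte_fin.
  apply: le_trans (nneseries_lim_ge n.+1 _) => //.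
  by rewrite big_nat_recr//= leeDr// sume_ge0.
have tfin x : t x \is a fin_num.
  by rewrite ge0_fin_numE ?(ltW (t0 x))// (le_lt_trans (t2 x)) ?ltry.
have mt : measurable_fun setT t.
  exact: ge0_emeasurable_sum.
exists (fine \o t); split.
- by apply: measurableT_comp.
- by move=> x /=; rewrite fine_gt0// t0/= (le_lt_trans (t2 x)) ?ltry.
- under eq_integral do rewrite /= fineK//.
  rewrite /t integral_nneseries//.
  apply: (@le_lt_trans _ _ 2%:E); last exact: ltry.
  rewrite -(mul1r 2); apply: nneseries_geometric_le => // n.
    by apply: integral_ge0 => x _.
  rewrite mul1r /f; under eq_integral do rewrite EFinM.
  rewrite ge0_integralZl_EFin ?(ltW (c0 n))//; last first.
    by apply/measurable_EFinP/measurable_indic; exact: (Ff n).1.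
  rewrite integral_indic//; last exact: (Ff n).1.
  rewrite setIT -[X in (_ * X)%E]fineK; last first.
    by rewrite ge0_fin_numE//; exact: (Ff n).2.
  by rewrite -EFinM lee_fin /c mulrAC ler_pdivrMr// ler_wpM2l ?exprn_ge0// lerDr.
Qed.

(** The increments d_k satisfy |d_k| <= 2^-k + 2^k d_k^2, hence they are absolutely
summable. *)
Lemma fast_cauchy_cvg (R : realType) (u : nat -> R) (B : R) :
  (forall n, \sum_(0 <= k < n) 2 ^+ k * (u k - u k.+1) ^+ 2 <= B) -> cvgn u.
Proof.
move=> uB.
rewrite (_ : u = fun n => u 0%N + series (telescope u) n); last first.
  by apply/funext => n; exact: eq_sum_telescope.
apply: is_cvgD; first exact: is_cvg_cst.
apply: normed_cvg; apply: nondecreasing_is_cvgn.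
  by apply: nondecreasing_series => // n _ _; rewrite normr_ge0.
exists (2 + B) => _ [n _ <-]; rewrite /series/=.
apply: (@le_trans _ _ (\sum_(0 <= k < n) (2^-1 ^+ k + 2 ^+ k * (u k - u k.+1) ^+ 2))).
  apply: ler_sum => k _; rewrite /telescope distrC.
  have a0 : 0 < 2 ^+ k :> R by rewrite exprn_gt0.
  rewrite exprVn -(ler_pM2l a0) mulrDr mulfV ?gt_eqF//.
  rewrite -(real_normK (num_real (u k - _))) mulrA -expr2 -exprMn.
  move: (_ * `|_|) => y; have : 0 <= (y - 2^-1) ^+ 2 by exact: sqr_ge0.
  rewrite sqrrB; move: (y ^+ 2) => z; clear; rewrite expr2; lra.
rewrite big_split/= lerD// big_mkord; exact: sum_geometric_half_le2.
Qed.

Section AlmostEverywhereLimits.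
Context {dX : measure_display} {X : measurableType dX} {R : realType}.
Variable mu : {measure set X -> \bar R}.

(** Squared increments of integral O(4^-n) remain summable after multiplication by
2^n, for almost every x by monotone convergence. *)
Lemma ae_limit (w : X -> R) (u : nat -> X -> R) (M : R) :
  measurable_fun setT w -> (forall x, 0 < w x) ->
  (forall n, measurable_fun setT (u n)) -> (forall n x, 0 <= u n x <= 1) -> 0 <= M ->
  (forall n, \int[mu]_x (w x * (u n x - u n.+1 x) ^+ 2)%:E <= (M * 4^-1 ^+ n)%:E)%E ->
  exists h : X -> R, [/\ measurable_fun setT h, forall x, 0 <= h x <= 1 &
    {ae mu, forall x, u ^~ x @ \oo --> h x}].
Proof.
move=> mw w0 mu_ u01 M0 uM.
pose f n x : \bar R := (2 ^+ n * (w x * (u n x - u n.+1 x) ^+ 2))%:E.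
have f0 n x : (0 <= f n x)%E.
  by rewrite lee_fin mulr_ge0 ?exprn_ge0// mulr_ge0 ?sqr_ge0// (ltW (w0 x)).
have md n : measurable_fun setT (fun x => w x * (u n x - u n.+1 x) ^+ 2).
  by apply: measurable_funM => //; apply: measurable_funX; exact: measurable_funB.
have mf n : measurable_fun setT (f n).
  by apply/measurable_EFinP; apply: measurable_funM => //.
have intf : (\int[mu]_x (\sum_(n <oo) f n x) <= (M * 2)%:E)%E.
  rewrite integral_nneseries//; apply: nneseries_geometric_le => // n.
    exact: integral_ge0.
  rewrite /f ge0_intZ ?exprn_ge0//; last by move=> x; rewrite mulr_ge0 ?sqr_ge0// ltW.
  apply: (le_trans (lee_wpmul2l _ (uM n))); first by rewrite lee_fin exprn_ge0.
  by rewrite -EFinM lee_fin mulrCA ler_wpM2l// -exprMn (_ : 2 * 4^-1 = 2^-1)//; lra.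
have aef : {ae mu, forall x, (\sum_(n <oo) f n x)%E \is a fin_num}.
  have : mu.-integrable setT (fun x => \sum_(n <oo) f n x)%E.
    apply/integrableP; split; first exact: ge0_emeasurable_sum.
    under eq_integral do rewrite gee0_abs ?nneseries_ge0//.
    by apply: (le_lt_trans intf); rewrite ltry.
  by move=> /(integrable_ae measurableT); apply: filterS => x /(_ I).
(* The limit superior is measurable and agrees with the limit where that exists;
   clamping makes the bounds hold everywhere. *)
exists (fun x => Num.max 0 (Num.min 1 (limn_sup (u ^~ x)))); split.
- apply: measurable_maxr => //; apply: measurable_minr => //.
  apply: measurable_fun_limn_sup => // x _.
    by exists 1 => _ [n _ <-]; case/andP: (u01 n x).
  by exists 0 => _ [n _ <-]; case/andP: (u01 n x).
- by move=> x; rewrite le_max lexx/= ge_max ler01/= ge_min lexx.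
- apply: filterS aef => x fx.
  have cu : cvgn (u ^~ x).
    apply: (@fast_cauchy_cvg _ _ (fine (\sum_(n <oo) f n x)%E / w x)) => n.
    rewrite ler_pdivlMr// -lee_fin fineK//; apply: le_trans (nneseries_lim_ge n _) => //.
    rewrite sumEFin lee_fin mulr_suml le_eqVlt; apply/orP; left; apply/eqP.
    by apply: eq_bigr => k _; ring.
  rewrite cvg_limn_supE//.
  have l1 : limn (u ^~ x) <= 1 by apply: limr_le => //; apply: nearW => n; case/andP: (u01 n x).
  have l0 : 0 <= limn (u ^~ x) by apply: limr_ge => //; apply: nearW => n; case/andP: (u01 n x).
  by rewrite min_r// max_r//; exact/cvgP.
Qed.

End AlmostEverywhereLimits.

(** * Convex compactness for multipliers *)

Section RealLimits.
Variable R : realType.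
Implicit Types (y l t : R).

Lemma cvg_powR (u : nat -> R) l t : 0 < t -> (forall n, 0 <= u n) -> 
  u @ \oo --> l -> (fun n => u n `^ t) @ \oo --> l `^ t.
Proof.
move=> t0 u0 ul.
have l0 : 0 <= l.
  by rewrite -(cvg_lim (@Rhausdorff R) ul); apply: limr_ge; [apply/cvg_ex; exists l | exact: nearW].
move: l0; rewrite le_eqVlt => /predU1P[l0|l0].
  rewrite -l0 powR0 ?gt_eqF//; apply/cvgr0Pnorm_lt => e e0.
  have : \forall n \near \oo, u n < e `^ t^-1.
    by apply: (cvgr_lt _ ul); rewrite -l0 powR_gt0.
  apply: filterS => n un; rewrite ger0_norm ?powR_ge0//.
  have -> : e = (e `^ t^-1) `^ t by rewrite -powRrM mulVf ?gt_eqF// powRr1// ltW.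
  by apply: gt0_ltr_powR => //; rewrite nnegrE ?powR_ge0.
have h : (fun n => expR (t * ln (u n))) @ \oo --> l `^ t.
  rewrite /powR gt_eqF//; apply: continuous_cvg; first exact: continuous_expR.
  apply: cvgMr; apply: continuous_cvg => //; exact: continuous_ln.
apply: cvg_trans h; apply: near_eq_cvg.
have : \forall n \near \oo, 0 < u n by apply: (cvgr_gt _ ul).
by apply: filterS => n un; rewrite /powR gt_eqF.
Qed.

Lemma cvg_prod_seq (I : Type) (s : seq I) (u : I -> nat -> R) (l : I -> R) :
  (forall i, u i @ \oo --> l i) ->
  (fun n => \prod_(i <- s) u i n) @ \oo --> \prod_(i <- s) l i.
Proof.
move=> ul; elim: s => [|i s IH].
  by rewrite big_nil; under eq_fun do rewrite big_nil; exact: cvg_cst.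
by rewrite big_cons; under eq_fun do rewrite big_cons; exact: cvgM.
Qed.

(** The function ln takes the value 0 at 0; here 0 stands for an infinite multiplier. *)
Definition neglog y : \bar R := if y == 0 then +oo%E else (- ln y)%:E.

Lemma neglog_ge0 y : y <= 1 -> (0 <= neglog y)%E.
Proof. by move=> y1; rewrite /neglog; case: ifP => // _; rewrite lee_fin oppr_ge0 ln_le0. Qed.

Lemma measurable_neglog : measurable_fun setT neglog.
Proof.
apply: measurable_fun_ifT => //.
  by apply: measurable_fun_eqr.
by apply/measurable_EFinP; apply: measurableT_comp => //; exact: measurable_ln.
Qed.

Lemma neglog_mid y t : 0 <= y <= 1 -> 0 <= t <= 1 ->
  neglog ((y * t) `^ 2^-1) = (2^-1%:E * neglog y + 2^-1%:E * neglog t)%E.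
Proof.
move=> /andP[y0 y1] /andP[t0 t1]; rewrite /neglog powR_eq0 invr_eq0 pnatr_eq0 andbT mulf_eq0.
have h2 : (0 < 2^-1 :> R) by rewrite invr_gt0.
have [->|yn0] := eqVneq y 0.
  rewrite /= gt0_muley ?lte_fin// addye//.
  by case: ifP => _; rewrite ?gt0_muley ?lte_fin.
have [->|tn0] := eqVneq t 0; first by rewrite /= gt0_muley ?lte_fin// addey.
have yp : 0 < y by rewrite lt_neqAle eq_sym yn0.
have tp : 0 < t by rewrite lt_neqAle eq_sym tn0.
rewrite /= ln_powR lnM ?posrE//.
by rewrite -!EFinM -EFinD; congr EFin; ring.
Qed.

Lemma cvg_neglog (u : nat -> R) l : (forall n, 0 <= u n) -> 0 <= l ->
  u @ \oo --> l -> (fun n => neglog (u n)) @ \oo --> neglog l.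
Proof.
move=> u0 l0 ul; rewrite {2}/neglog; case: eqVneq => [l_eq0|ln0].
  apply/cvgeyPge => M.
  have : \forall n \near \oo, u n < expR (- M) by apply: (cvgr_lt _ ul); rewrite l_eq0 expR_gt0.
  apply: filterS => n un; rewrite /neglog; case: eqVneq => [_|un0]; first by rewrite leey.
  have ugt : 0 < u n by rewrite lt_neqAle eq_sym un0 u0.
  by rewrite lee_fin lerNr -ler_expR lnK// ltW.
have lgt : 0 < l by rewrite lt_neqAle eq_sym ln0.
have h : (fun n => (- ln (u n))%:E) @ \oo --> (- ln l)%:E.
  apply: cvg_EFin; first exact: nearW.
  by apply: cvgN; apply: continuous_cvg => //; exact: continuous_ln.
apply: cvg_trans h; apply: near_eq_cvg.
have : \forall n \near \oo, 0 < u n by apply: (cvgr_gt _ ul).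
by apply: filterS => n un; rewrite /neglog gt_eqF.
Qed.

End RealLimits.

Lemma opp_mul_le_sqr_half (R : realFieldType) (u v : R) :
  - u * - v <= - (2^-1 * (u + v)) * - (2^-1 * (u + v)).
Proof. have : 0 <= (u - v) ^+ 2 by exact: sqr_ge0.
by rewrite sqrrB => h; nra. Qed.

Section DualCompactness.
Context {dX : measure_display} {X : measurableType dX} {R : realType}.
Variable mu : {sigma_finite_measure set X -> \bar R}.
Variables (Ix : finType) (theta : Ix -> R) (G : X -> R).
Hypothesis theta0 : forall j, 0 < theta j.
Hypothesis G0 : forall x, 0 <= G x.

(** A nonnegative, possibly infinite function phi is encoded by psi = exp (- phi),
with values in [0, 1]; psi = 0 stands for phi = +oo. *)
Definition multipliers : Type :=
  {psi : Ix -> X -> R | forall j, measurable_fun setT (psi j) /\ forall x, 0 <= psi j x <= 1}.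

Implicit Types (psi : multipliers) (S : Ix -> X -> R) (a : R).

Lemma multiplier_meas psi j : measurable_fun setT (sval psi j).
Proof. by case: psi => /= f /(_ j)[]. Qed.

Lemma multiplier_itv psi j x : 0 <= sval psi j x <= 1.
Proof. by case: psi => /= f /(_ j)[]. Qed.

Lemma multiplier_ge0 psi j x : 0 <= sval psi j x.
Proof. by case/andP: (multiplier_itv psi j x). Qed.

Lemma multiplier_le1 psi j x : sval psi j x <= 1.
Proof. by case/andP: (multiplier_itv psi j x). Qed.

(** In terms of phi = - ln psi this is the midpoint of two multipliers. *)
Definition geometric_mean psi psi' : multipliers.
Proof.
exists (fun j x => (sval psi j x * sval psi' j x) `^ 2^-1) => j; split.
  apply: (measurableT_comp (measurable_powR _)) => //.
  by apply: measurable_funM; exact: multiplier_meas.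
move=> x; rewrite powR_ge0 powR_le1 ?invr_ge0 ?mulr_ge0 ?multiplier_ge0//.
by rewrite mulr_ile1 ?multiplier_ge0 ?multiplier_le1.
Defined.

(** The product inequality is required only where all S_j are positive and all phi_j
finite. In this form it is closed under limits and midpoints, and it is all that a
single tuple S can give; the integral bounds together with saturation show later
that the remaining points are negligible. *)
Definition dual_constraint (S : Ix -> X -> R) (a : R) psi : Prop :=
  {ae mu, forall x, (forall j, 0 < S j x) -> (forall j, 0 < sval psi j x) ->
     G x <= \prod_j (- ln (sval psi j x)) `^ theta j} /\
  forall j, (\int[mu]_x ((S j x)%:E * neglog (sval psi j x)) <= a%:E)%E.

(** The weighted geometric mean is concave and the integrals are linear in phi. For
the former, ((a + b)/2)^2 >= a b in each coordinate already suffices. *)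
Lemma dual_constraint_mid S a psi psi' :
  (forall j, measurable_fun setT (S j)) -> (forall j x, 0 <= S j x) -> 
  dual_constraint S a psi -> dual_constraint S a psi' ->
  dual_constraint S a (geometric_mean psi psi').
Proof.
move=> mS S0 [h1 h2] [h1' h2']; split.
  apply: filterS2 h1 h1' => x /[swap] H' H Sx px /=.
  have /all_and2[p0 p0'] : forall j, 0 < sval psi j x /\ 0 < sval psi' j x.
    move=> j; have h : 0 < sval psi j x * sval psi' j x.
      apply: (@gt0_powR _ _ 2^-1); last exact: px.
        by rewrite invr_gt0.
      by rewrite mulr_ge0 ?multiplier_ge0.
    have := multiplier_ge0 psi j x; have := multiplier_ge0 psi' j x.
    rewrite !le_eqVlt => /predU1P[e|//]; first by rewrite -e mulr0 ltxx in h.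
    by move=> p /predU1P[e|//]; rewrite -e mul0r ltxx in h.
  have {}H := H Sx p0; have {}H' := H' Sx p0'.
  have l0 (q : multipliers) j : 0 <= - ln (sval q j x).
    by rewrite oppr_ge0 ln_le0// multiplier_le1.
  rewrite -[leLHS](@ger0_norm _ (G x))// -sqrtr_sqr expr2.
  apply: (@le_trans _ _ (Num.sqrt (\prod_j (- ln (sval psi j x)) `^ theta j *
       \prod_j (- ln (sval psi' j x)) `^ theta j))).
    by apply: ler_wsqrtr; rewrite ler_pM.
  rewrite -[leRHS]ger0_norm; last by apply: prodr_ge0 => j _; rewrite powR_ge0.
  rewrite -[leRHS]sqrtr_sqr; apply: ler_wsqrtr.
  rewrite expr2 -!big_split/=; apply: ler_prod => j _.
  have lm := l0 (geometric_mean psi psi') j.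
  rewrite mulr_ge0 ?powR_ge0//= -(powRM _ (l0 psi j) (l0 psi' j)) -(powRM _ lm lm).
  rewrite powR_le ?(ltW (theta0 j)) ?mulr_ge0//.
  rewrite /= ln_powR lnM ?posrE ?p0 ?p0'//.
  exact: opp_mul_le_sqr_half.
move=> j.
have mn (q : multipliers) : measurable_fun setT (fun x => (S j x)%:E * neglog (sval q j x))%E.
  apply: emeasurable_funM; first exact/measurable_EFinP.
  by apply: (measurableT_comp (@measurable_neglog R)); exact: multiplier_meas.
have n0 (q : multipliers) x : (0 <= (S j x)%:E * neglog (sval q j x))%E.
  by rewrite mule_ge0 ?lee_fin ?neglog_ge0 ?multiplier_le1.
have h0 : (0 <= 2^-1 :> R) by rewrite invr_ge0.
under eq_integral => x _.
  rewrite /= neglog_mid ?multiplier_itv// ge0_muleDr; last 2 first.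
    by rewrite mule_ge0 ?lee_fin ?neglog_ge0 ?multiplier_le1.
    by rewrite mule_ge0 ?lee_fin ?neglog_ge0 ?multiplier_le1.
  rewrite muleCA [X in (_ + X)%E]muleCA; over.
rewrite ge0_integralD//; last 4 first.
- by move=> x _; rewrite mule_ge0 ?lee_fin.
- exact: emeasurable_funM.
- by move=> x _; rewrite mule_ge0 ?lee_fin.
- exact: emeasurable_funM.
rewrite !ge0_integralZl_EFin//.
apply: (@le_trans _ _ (2^-1%:E * a%:E + 2^-1%:E * a%:E)%E).
  by apply: leeD; apply: lee_wpmul2l; rewrite ?lee_fin.
by rewrite -!EFinM -EFinD lee_fin; lra.
Qed.

(** The integral bounds pass to the limit by Fatou's lemma, where neglog is continuous
as a map into [0, +oo]. Where the limit is positive, so are the psi_n eventually,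
and the product converges. *)
Lemma dual_constraint_lim S a (u : nat -> multipliers) psi n0 :
  (forall j, measurable_fun setT (S j)) -> (forall j x, 0 <= S j x) ->
  {ae mu, forall x, forall j, (fun n => sval (u n) j x) @ \oo --> sval psi j x} ->
  (forall n, (n0 <= n)%N -> dual_constraint S a (u n)) -> dual_constraint S a psi.
Proof.
move=> mS S0 up ua; split.
  have : {ae mu, forall x, forall n, (forall j, 0 < S j x) ->
     (forall j, 0 < sval (u (n + n0)%N) j x) ->
     G x <= \prod_j (- ln (sval (u (n + n0)%N) j x)) `^ theta j}.
    by apply: ae_foralln => n; exact: (ua (n + n0)%N (leq_addl _ _)).1.
  apply: filterS2 up => x ux H Sx px.
  have cv : (fun n => \prod_j (- ln (sval (u n) j x)) `^ theta j) @ \oo -->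
      \prod_j (- ln (sval psi j x)) `^ theta j.
    apply: (@cvg_prod_seq R _ _ (fun j n => (- ln (sval (u n) j x)) `^ theta j)
      (fun j => (- ln (sval psi j x)) `^ theta j)) => j.
    apply: cvg_powR => //.
      by move=> n; rewrite oppr_ge0 ln_le0// multiplier_le1.
    by apply: cvgN; apply: continuous_cvg => //; exact: continuous_ln.
  rewrite -(cvg_lim (@Rhausdorff R) cv); apply: limr_ge; first by apply/cvg_ex; eexists; exact: cv.
  have : \forall n \near \oo, forall j, 0 < sval (u n) j x.
    by apply: filter_forall => j; exact: (cvgr_gt _ (ux j)).
  have : \forall n \near \oo, (n0 <= n)%N by exact: nbhs_infty_ge.
  apply: filterS2 => n nn0 un; have := H (n - n0)%N; rewrite subnK//; exact.
move=> j.
have mn (q : multipliers) : measurable_fun setT (fun x => (S j x)%:E * neglog (sval q j x))%E.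
  apply: emeasurable_funM; first exact/measurable_EFinP.
  by apply: (measurableT_comp (@measurable_neglog R)); exact: multiplier_meas.
have n0' (q : multipliers) x : (0 <= (S j x)%:E * neglog (sval q j x))%E.
  by rewrite mule_ge0 ?lee_fin ?neglog_ge0 ?multiplier_le1.
apply: (@fatou_bound _ _ _ mu (fun n x => (S j x)%:E * neglog (sval (u n) j x))%E _ (fun=> a%:E)) => //.
- apply: filterS up => x /(_ j) ux.
  have cv : (fun n => (S j x)%:E * neglog (sval (u n) j x))%E @ \oo -->
      ((S j x)%:E * neglog (sval psi j x))%E.
    apply: cvgeZl => //; apply: cvg_neglog => //.
      by move=> n; exact: multiplier_ge0.
    exact: multiplier_ge0.
  by rewrite (cvg_limn_einf_sup cv).1.
- by exists n0 => // n /= /ua [_ /(_ j)].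
- exact: cvg_cst.
Qed.

(** Convex compactness with J psi = int w sum_j psi_j^2. The square of
sqrt (psi psi') is psi psi', so the parallelogram identity
psi^2 + psi'^2 - 2 psi psi' = (psi - psi')^2 controls the distance by the defect of
convexity, with no loss. *)
Lemma dual_compactness (I : Type) (S : I -> Ix -> X -> R) (a : I -> R) :
  (forall i j, measurable_fun setT (S i j)) -> (forall i j x, 0 <= S i j x) ->
  (forall l, meets (fun i => dual_constraint (S i) (a i)) l !=set0) ->
  exists psi, forall i, dual_constraint (S i) (a i) psi.
Proof.
move=> mS S0 fip.
have [w [mw w0 wfin]] := finite_weight mu.
pose e psi x := w x * \sum_j sval psi j x ^+ 2.
have e0 psi x : 0 <= e psi x by rewrite mulr_ge0 ?(ltW (w0 x))// sumr_ge0// => j _; rewrite sqr_ge0.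
have me psi : measurable_fun setT (e psi).
  by apply: measurable_funM => //; apply: measurable_sum => j; apply: measurable_funX; exact: multiplier_meas.
pose M : R := #|Ix|%:R * fine (\int[mu]_x (w x)%:E)%E.
have wE : (\int[mu]_x (w x)%:E)%E \is a fin_num.
  by rewrite ge0_fin_numE//; apply: integral_ge0 => x _; rewrite lee_fin ltW.
have eM psi : (\int[mu]_x (e psi x)%:E <= M%:E)%E.
  rewrite /M EFinM fineK// -ge0_intZ//; last by move=> x; rewrite ltW.
  apply: ge0_int_le => //.
  - exact: measurable_funM.
  - by move=> x; rewrite mulr_ge0// ltW.
  - apply: nearW => x; rewrite /e mulrC ler_wpM2r ?(ltW (w0 x))//.
    rewrite -sum1_card natr_sum; apply: ler_sum => j _.
    by rewrite expr_le1// ?multiplier_ge0 ?multiplier_le1.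
have efin psi : (\int[mu]_x (e psi x)%:E)%E \is a fin_num.
  rewrite ge0_fin_numE; first by rewrite (le_lt_trans (eM psi))// ltry.
  by apply: integral_ge0 => x _; rewrite lee_fin.
pose J psi : R := fine (\int[mu]_x (e psi x)%:E)%E.
have JE psi : (J psi)%:E = (\int[mu]_x (e psi x)%:E)%E by rewrite /J fineK.
pose dl psi psi' x := w x * \sum_j (sval psi j x - sval psi' j x) ^+ 2.
have dl0 psi psi' x : 0 <= dl psi psi' x.
  by rewrite mulr_ge0 ?(ltW (w0 x))// sumr_ge0// => j _; rewrite sqr_ge0.
have mdl psi psi' : measurable_fun setT (dl psi psi').
  apply: measurable_funM => //; apply: measurable_sum => j; apply: measurable_funX.
  by apply: measurable_funB; exact: multiplier_meas.
have para psi psi' : (\int[mu]_x (dl psi psi' x)%:E)%E =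
    (2 * ((J psi + J psi') / 2 - J (geometric_mean psi psi')))%:E.
  have H : ((J psi)%:E + (J psi')%:E = 2%:E * (J (geometric_mean psi psi'))%:E +
      \int[mu]_x (dl psi psi' x)%:E)%E.
    rewrite !JE -ge0_intZ// -!ge0_intD//; last 2 first.
    - exact: measurable_funM.
    - by move=> x; rewrite mulr_ge0.
    apply: eq_integral => x _; congr EFin.
    rewrite /e /dl /= mulrCA -!mulrDr; congr (_ * _).
    rewrite mulr_sumr -!big_split/=; apply: eq_bigr => j _.
    have -> (y : R) : 0 <= y -> (y `^ 2^-1) ^+ 2 = y.
      by move=> y0; rewrite -powR_mulrn ?powR_ge0// -powRrM mulVf ?pnatr_eq0// powRr1.
      by ring.
    by rewrite mulr_ge0 ?multiplier_ge0.
  move: H; rewrite -EFinM -EFinD addeC => /eqP.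
  rewrite -sube_eq// => [/eqP <-|]; last by rewrite fin_num_adde_defl.
  by rewrite -EFinB; congr EFin; field.
apply: (@convex_compactness R multipliers I geometric_mean J
  (fun i => dual_constraint (S i) (a i)) M) => //.
- by move=> psi; rewrite -lee_fin JE; apply: integral_ge0 => x _; rewrite lee_fin.
- by move=> psi; rewrite -lee_fin JE.
- by move=> i psi psi'; exact: dual_constraint_mid.
- move=> u uJ.
  have /choice[h hP] : forall j : Ix, exists hj : X -> R, [/\ measurable_fun setT hj,
      forall x, 0 <= hj x <= 1 & {ae mu, forall x, (fun n => sval (u n) j x) @ \oo --> hj x}].
    move=> j.
    apply: (@ae_limit _ _ _ mu w (fun n => sval (u n) j) 4) => //.
    + by move=> n; exact: multiplier_meas.
    + by move=> n x; exact: multiplier_itv.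
    + move=> n; apply: (@le_trans _ _ (\int[mu]_x (dl (u n) (u n.+1) x)%:E)%E).
        apply: ge0_int_le => //.
        * apply: measurable_funM => //; apply: measurable_funX.
          by apply: measurable_funB; exact: multiplier_meas.
        * by move=> x; rewrite mulr_ge0 ?sqr_ge0// ltW.
        * apply: nearW => x; rewrite ler_wpM2l ?(ltW (w0 x))// (bigD1 j)//= lerDl.
          by apply: sumr_ge0 => k _; rewrite sqr_ge0.
      rewrite para lee_fin (_ : 4 * _ = 2 * (2 * 4^-1 ^+ n)); last by rewrite mulrA -natrM.
      by rewrite ler_pM2l.
  have hm j : measurable_fun setT (h j) /\ forall x, 0 <= h j x <= 1.
    by have [? ? _] := hP j.
  pose psi : multipliers := exist _ h hm.
  have cv : {ae mu, forall x, forall j, (fun n => sval (u n) j x) @ \oo --> sval psi j x}.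
    by apply: filter_forall => j; have [_ _] := hP j.
  exists psi; split; last by move=> i n0 H; apply: dual_constraint_lim H.
  move=> V JV; rewrite -lee_fin JE.
  apply: (@fatou_bound _ _ _ mu (fun n x => (e (u n) x)%:E) _ (fun n => (V + 4^-1 ^+ n)%:E)) => //.
  + by move=> n; exact/measurable_EFinP.
  + exact/measurable_EFinP.
  + by move=> n x; rewrite lee_fin.
  + by move=> x; rewrite lee_fin.
  + apply: filterS cv => x cx.
    have c2 : (fun n => (e (u n) x)%:E) @ \oo --> (e psi x)%:E.
      apply: cvg_EFin; first exact: nearW.
      apply: cvgMr; rewrite /=.
      elim: (index_enum Ix) => [|j s IH].
        by rewrite big_nil; under eq_fun do rewrite big_nil; exact: cvg_cst.
      rewrite big_cons; under eq_fun do rewrite big_cons; apply: cvgD => //.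
      by rewrite expr2; under eq_fun do rewrite expr2; apply: cvgM.
    by rewrite (cvg_limn_einf_sup c2).1.
  + by apply: nearW => n; rewrite -JE lee_fin.
  + apply: cvg_EFin; first exact: nearW.
    rewrite -[X in _ --> X]addr0; apply: cvgD; first exact: cvg_cst.
    by apply: cvg_expr; rewrite ger0_norm ?invr_ge0// invf_lt1// ltr1n.
- move=> i psi psi' JJ H.
  have d0 : (\int[mu]_x (dl psi psi' x)%:E)%E = 0%E.
    apply/eqP; rewrite eq_le; apply/andP; split; last by apply: integral_ge0 => x _; rewrite lee_fin.
    by rewrite para lee_fin pmulr_rle0// subr_le0.
  have ae0 : {ae mu, forall x j, sval psi j x = sval psi' j x}.
    have mE : measurable_fun setT (EFin \o dl psi psi') by exact/measurable_EFinP.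
    have [+ _] := ae_eq_integral_abs mu measurableT mE.
    under eq_integral do rewrite /= ger0_norm//.
    move=> /(_ d0); apply: filterS => x /(_ Logic.I)/= [] /eqP.
    rewrite mulf_eq0 gt_eqF//= psumr_eq0; last by move=> j _; rewrite sqr_ge0.
    move=> /allP z j; have := z j; rewrite mem_index_enum => /(_ isT)/=.
    by rewrite sqrf_eq0 subr_eq0 => /eqP.
  apply: (@dual_constraint_lim (S i) (a i) (fun=> psi) psi' 0) => //.
  by apply: filterS ae0 => x ex j; rewrite -ex; exact: cvg_cst.
Qed.

End DualCompactness.

(** * Disentanglement for convex sets of functions *)

(** From 1 + a z <= exp (a z) with z = ln (1 + y) >= y / (1 + y) >= y - 2 y^2. *)
Lemma powR_ge_quadratic (R : realType) (y a : R) : - 2^-1 <= y -> 0 < a ->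
  1 + a * (y - 2 * y ^+ 2) <= (1 + y) `^ a.
Proof.
move=> y1 a0; have y0 : 0 < 1 + y by lra.
rewrite /powR gt_eqF//; apply: le_trans (expR_ge1Dx _).
rewrite lerD2l ler_wpM2l ?(ltW a0)//.
have h := @le_ln1Dx R ((1 + y)^-1 - 1).
have {}h : ln (1 + y)^-1 <= (1 + y)^-1 - 1.
  by rewrite (addrC 1 (_ - 1)) subrK in h; apply: h; rewrite ltrBrDl subrr invr_gt0.
rewrite lnV ?posrE// lerNl opprB in h; apply: le_trans h.
have -> : 1 - (1 + y)^-1 = y / (1 + y) by field; rewrite gt_eqF.
rewrite ler_pdivlMr//; have : 0 <= y ^+ 2 * (1 + 2 * y) by rewrite mulr_ge0 ?sqr_ge0//; lra.
by rewrite expr2; nra.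
Qed.

(** The step t makes the second-order term smaller than e/4, and the tolerance dl
makes the loss of near-optimality smaller than e/4 after division by th t. The
factor 1 - eta on the right pays for the mixing with a dominating tuple. tau is a
lower bound for all the exponents th. *)
Lemma perturbation_choice (R : realFieldType) (A e L th tau : R) (eta := e / (2 * (A + e)))
    (t := e / (8 * L ^+ 2 * (A + 1 + e))) (dl := t * (e / 4) * tau) :
  0 <= A -> 0 < e -> 1 <= L -> 0 < tau <= th ->
  dl / (th * t) + (1 + 2 * t * L ^+ 2) * A <= (1 - eta) * (A + e).
Proof.
move=> A0 e0 L1 /andP[tau0 tauth].
have th0 : 0 < th by exact: lt_le_trans tauth.
have L0 : 0 < L by exact: lt_le_trans L1.
have Ae : 0 < A + e by rewrite ltr_wpDl.
have Ae1 : 0 < A + 1 + e by rewrite addr_gt0// ltr_wpDl.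
have t0 : 0 < t by rewrite divr_gt0// !mulr_gt0// exprn_gt0.
have -> : (1 - eta) * (A + e) = A + e / 2 by rewrite /eta; field; rewrite gt_eqF.
have -> : dl / (th * t) = e / 4 * (tau / th) by rewrite /dl; field; rewrite !gt_eqF.
have -> : 2 * t * L ^+ 2 = e / 4 * (A + 1 + e)^-1.
  by rewrite /t; field; rewrite !gt_eqF.
have h1 : tau / th <= 1 by rewrite ler_pdivrMr// mul1r.
have h2 : (A + 1 + e)^-1 * A <= 1 by rewrite mulrC ler_pdivrMr// mul1r; lra.
have e4 : 0 < e / 4 by rewrite divr_gt0.
have h1' := ler_wpM2l (ltW e4) h1; have h2' := ler_wpM2l (ltW e4) h2.
rewrite mulrDl mul1r -mulrA; lra.
Qed.

Lemma norm_subr1_le (R : realFieldType) (u L : R) :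
  0 <= u -> u <= L -> 1 <= L -> `|u - 1| <= L.
Proof. by move=> u0 uL L1; rewrite ler_norml; apply/andP; split; lra. Qed.

Lemma measurable_fun_div (dX : measure_display) (X : measurableType dX) (R : realType)
    (f g : X -> R) : measurable_fun setT f -> measurable_fun setT g ->
  (forall x, 0 <= g x) -> measurable_fun setT (fun x => f x / g x).
Proof.
move=> mf mg g0; under eq_fun do rewrite -powR_inv1//.
by apply: measurable_funM => //; exact: (measurableT_comp (measurable_powR _)).
Qed.

Section Perturbation.
Context {dX : measure_display} {X : measurableType dX} {R : realType}.
Variable mu : {sigma_finite_measure set X -> \bar R}.
Variables (Ix : finType) (theta : Ix -> R) (G : X -> R).
Hypothesis theta0 : forall j, 0 < theta j.
Hypothesis mG : measurable_fun setT G.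
Hypothesis G0 : forall x, 0 <= G x.
Implicit Types (S U V : Ix -> X -> R).

Definition geom_product S x := G x * \prod_j S j x `^ theta j.

Lemma geom_product_ge0 S x : 0 <= geom_product S x.
Proof. by rewrite mulr_ge0// prodr_ge0// => j _; rewrite powR_ge0. Qed.

Lemma measurable_geom_product S : (forall j, measurable_fun setT (S j)) ->
  measurable_fun setT (geom_product S).
Proof.
move=> mS; apply: measurable_funM => //; apply: measurable_prod => j _.
exact: (measurableT_comp (measurable_powR _)).
Qed.

Definition update S (j : Ix) (f : X -> R) : Ix -> X -> R :=
  fun i => if i == j then f else S i.

Lemma geom_product_update S j f x :
  geom_product (update S j f) x = G x * (f x `^ theta j * \prod_(i | i != j) S i x `^ theta i).
Proof.
rewrite /geom_product (bigD1 j)//= /update eqxx; congr (_ * (_ * _)).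
by apply: eq_bigr => i /negPf ->.
Qed.

Lemma geom_productD1 S j x :
  geom_product S x = G x * (S j x `^ theta j * \prod_(i | i != j) S i x `^ theta i).
Proof. by rewrite /geom_product (bigD1 j). Qed.

(** A second-order lower bound for t |-> ((1 - t) S_j + t V)^theta_j at t = 0, where
V / S_j <= L. The first-order term is theta_j t (V / S_j - 1) times the product. *)
Lemma perturbation_pointwise S j (V : X -> R) (L t : R) x :
  (forall x, 0 <= S j x) -> (forall x, 0 <= V x) -> 
  (forall x, V x <= L * S j x) -> 1 <= L -> 0 < t -> t * L <= 2^-1 ->
  geom_product S x + theta j * t * (V x * (geom_product S x / S j x)) <=
  geom_product (update S j (fun x => (1 - t) * S j x + t * V x)) x +
  (theta j * t + 2 * theta j * (t * L) ^+ 2) * geom_product S x.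
Proof.
move=> S0 V0 VL L1 t0 tL.
have := S0 x; rewrite le_eqVlt => /predU1P[Sx|Sx].
  have -> : geom_product S x = 0.
    by rewrite (geom_productD1 S j) -Sx powR0 ?mul0r ?mulr0// gt_eqF.
  by rewrite mul0r !mulr0 addr0 addr_ge0 ?geom_product_ge0.
pose u := V x / S j x.
have u0 : 0 <= u by rewrite divr_ge0.
have uL : u <= L by rewrite ler_pdivrMr.
pose y := t * (u - 1).
have y2 : y ^+ 2 <= (t * L) ^+ 2.
  rewrite /y !exprMn ler_wpM2l ?sqr_ge0// -(real_normK (num_real (u - 1))).
  have L0 : 0 <= L by exact: le_trans L1.
  by rewrite lerXn2r ?nnegrE// norm_subr1_le.
have tl : t <= 2^-1 by apply: le_trans tL; rewrite ler_peMr ?(ltW t0).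
have yge : - 2^-1 <= y.
  rewrite /y (@le_trans _ _ (- t))//; first by rewrite lerN2.
  by rewrite mulrBr mulr1 lerBrDr addNr mulr_ge0// ltW.
have := powR_ge_quadratic yge (theta0 j) => H.
have -> : geom_product (update S j (fun x => (1 - t) * S j x + t * V x)) x =
    geom_product S x * (1 + y) `^ theta j.
  rewrite geom_product_update (geom_productD1 S j).
  have -> : (1 - t) * S j x + t * V x = S j x * (1 + y).
    by rewrite /y /u; field; rewrite gt_eqF.
  rewrite powRM ?(ltW Sx)//; first by ring.
  by lra.
have -> : V x * (geom_product S x / S j x) = geom_product S x * u by rewrite /u; field; rewrite gt_eqF.
apply: (@le_trans _ _ (geom_product S x * (1 + theta j * (y - 2 * y ^+ 2)) +
   (theta j * t + 2 * theta j * (t * L) ^+ 2) * geom_product S x)); last first.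
  by rewrite lerD2r ler_wpM2l ?geom_product_ge0.
rewrite -subr_ge0 (_ : _ - _ = geom_product S x * (2 * theta j * ((t * L) ^+ 2 - y ^+ 2))).
  by rewrite mulr_ge0 ?geom_product_ge0// mulr_ge0 ?subr_ge0// mulr_ge0// ltW.
rewrite /y; ring.
Qed.

(** If the integral cannot rise above a, nor was it below a - dl, then the first-order
term of the perturbation is bounded. *)
Lemma perturbation_integral S j (V : X -> R) (L t dl a : R) :
  (forall i, measurable_fun setT (S i)) -> measurable_fun setT V ->
  (forall i x, 0 <= S i x) -> (forall x, 0 <= V x) ->
  (forall x, V x <= L * S j x) -> 1 <= L -> 0 < t -> t * L <= 2^-1 -> 0 <= a ->
  ((a - dl)%:E <= \int[mu]_x (geom_product S x)%:E)%E -> (\int[mu]_x (geom_product S x)%:E <= a%:E)%E ->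
  (\int[mu]_x (geom_product (update S j (fun x => (1 - t) * S j x + t * V x)%R) x)%:E <= a%:E)%E ->
  (\int[mu]_x (V x * (geom_product S x / S j x))%:E <=
     (dl / (theta j * t) + (1 + 2 * t * L ^+ 2) * a)%:E)%E.
Proof.
move=> mS mV S0 V0 VL L1 t0 tL a0 lo hi hu.
set W := update _ _ _ in hu.
have mg := measurable_geom_product mS.
have mW : measurable_fun setT (geom_product W).
  apply: measurable_geom_product => i; rewrite /W /update; case: eqP => // _.
  by apply: measurable_funD; apply: measurable_funM.
have mq : measurable_fun setT (fun x => V x * (geom_product S x / S j x)).
  by apply: measurable_funM => //; apply: measurable_fun_div.
have q0 x : 0 <= V x * (geom_product S x / S j x) by rewrite mulr_ge0// divr_ge0 ?geom_product_ge0.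
set I := (\int[mu]_x (V x * _)%:E)%E.
pose k := theta j * t + 2 * theta j * (t * L) ^+ 2.
have tt0 : 0 < theta j * t by rewrite mulr_gt0.
have k0 : 0 <= k by rewrite addr_ge0 ?(ltW tt0)// mulr_ge0 ?sqr_ge0// mulr_ge0// ltW.
have gfin : (\int[mu]_x (geom_product S x)%:E)%E \is a fin_num.
  rewrite ge0_fin_numE; first by rewrite (le_lt_trans hi)// ltry.
  by apply: integral_ge0 => x _; rewrite lee_fin geom_product_ge0.
have key : (\int[mu]_x (geom_product S x)%:E + (theta j * t)%:E * I <=
            a%:E + k%:E * \int[mu]_x (geom_product S x)%:E)%E.
  apply: (@le_trans _ _ (\int[mu]_x (geom_product W x)%:E + k%:E * \int[mu]_x (geom_product S x)%:E)%E).
    rewrite -!ge0_intZ ?(ltW tt0)//; last by move=> x; exact: geom_product_ge0.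
    rewrite -!ge0_intD//; do ?[by move=> x; exact: geom_product_ge0 | exact: measurable_funM
       | by move=> x; rewrite mulr_ge0 ?geom_product_ge0 ?(ltW tt0)].
    apply: ge0_int_le.
    - by apply: measurable_funD => //; exact: measurable_funM.
    - by apply: measurable_funD => //; exact: measurable_funM.
    - by move=> x; rewrite addr_ge0 ?geom_product_ge0// mulr_ge0 ?(ltW tt0).
    - by move=> x; rewrite addr_ge0 ?geom_product_ge0// mulr_ge0 ?geom_product_ge0.
    - by apply: nearW => x; apply: perturbation_pointwise.
  by rewrite leeD2r.
have gi : (\int[mu]_x (geom_product S x)%:E)%E =
    (fine (\int[mu]_x (geom_product S x)%:E)%E)%:E by rewrite fineK.
move: key lo hi; rewrite gi -EFinM -EFinD !lee_fin; set p := fine _ => key lo hi.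
have I0 : (0 <= I)%E by apply: integral_ge0 => x _; rewrite lee_fin.
have Ifin : I \is a fin_num.
  rewrite ge0_fin_numE// ltNge leye_eq; apply/negP => /eqP Iy.
  by move: key; rewrite Iy gt0_muley ?lte_fin// addey// leNgt ltry.
rewrite -(fineK Ifin) -EFinM -EFinD lee_fin in key.
rewrite -(fineK Ifin) lee_fin -(ler_pM2l tt0).
apply: (@le_trans _ _ (dl + k * a)).
  have : k * p <= k * a by rewrite ler_wpM2l.
  move: key lo; move: (k * p) (k * a) (_ * fine I) => u v z; lra.
rewrite le_eqVlt; apply/orP; left; apply/eqP; rewrite /k; field.
by rewrite !gt_eqF.
Qed.

End Perturbation.

Lemma meets_impl (T T' I : Type) (D : I -> set T) (D' : I -> set T') t t' l :
  (forall i, D i t -> D' i t') -> meets D l t -> meets D' l t'.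
Proof. by move=> DD'; elim: l => //= i l IH [h1 h2]; split; [exact: DD' | exact: IH]. Qed.

Lemma mixing_lt1 (R : realFieldType) (A e : R) : 0 <= A -> 0 < e -> e / (2 * (A + e)) < 1.
Proof.
move=> A0 e0; have Ae : 0 < A + e by rewrite ltr_wpDl.
by rewrite ltr_pdivrMr ?mulr_gt0// mul1r; lra.
Qed.

Lemma step_small (R : realFieldType) (A e L : R) : 0 <= A -> 0 < e -> 1 <= L ->
  e / (8 * L ^+ 2 * (A + 1 + e)) * L <= 2^-1.
Proof.
move=> A0 e0 L1; have L0 : 0 < L by exact: lt_le_trans L1.
have Ae1 : 0 < A + 1 + e by rewrite addr_gt0// ltr_wpDl.
have -> : e / (8 * L ^+ 2 * (A + 1 + e)) * L = e / (8 * (L * (A + 1 + e))).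
  by field; rewrite !gt_eqF.
rewrite ler_pdivrMr ?mulr_gt0//.
have : A + 1 + e <= L * (A + 1 + e) by rewrite ler_peMl// ltW.
move: (L * _) => z; lra.
Qed.

Section DisentanglementTheorem.
Context {dX : measure_display} {X : measurableType dX} {R : realType}.
Variable mu : {sigma_finite_measure set X -> \bar R}.
Variables (Ix : finType) (theta : Ix -> R) (G : X -> R) (K : Ix -> set (X -> R)) (A : R).
Hypothesis theta0 : forall j, 0 < theta j.
Hypothesis theta1 : \sum_j theta j = 1.
Hypothesis mG : measurable_fun setT G.
Hypothesis G0 : forall x, 0 <= G x.
Hypothesis mK : forall j f, K j f -> measurable_fun setT f.
Hypothesis K0 : forall j f, K j f -> forall x, 0 <= f x.
Hypothesis convK : forall j f g (t : R), K j f -> K j g -> 0 <= t <= 1 ->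
  K j (fun x => (1 - t) * f x + t * g x).
Hypothesis A0 : 0 <= A.
Hypothesis KA : forall S : Ix -> X -> R, (forall j, K j (S j)) ->
  (\int[mu]_x (geom_product theta G S x)%:E <= A%:E)%E.
Implicit Types (S U V : Ix -> X -> R).

Lemma prod_theta_le j : 0 < \prod_i theta i <= theta j.
Proof.
have t1 i : theta i <= 1.
  by rewrite -theta1 (bigD1 i)//= lerDl sumr_ge0// => k _; rewrite ltW.
rewrite prodr_gt0//= (bigD1 j)//= ler_piMr ?(ltW (theta0 j))//.
by apply: prodr_ile1 => i; rewrite t1 ltW.
Qed.

(** Every competitor is mixed with a small multiple eta of Sb. Then V / S'_j is
bounded by L whenever S is dominated by Sb / c, which the second-order expansion
needs, and S'_j > 0 wherever S_j > 0. The multiplier is P / S'_j, where S' is a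
nearly optimal mixed tuple and P its product; the theta_j sum to 1, so the product
of the (P / S'_j)^theta_j is G. *)
Lemma near_optimal_multiplier (Sb : Ix -> X -> R) (c e : R) :
  (forall j, K j (Sb j)) -> 0 < c <= 1 -> 0 < e ->
  exists phi : Ix -> X -> R,
  [/\ forall j, measurable_fun setT (phi j), forall j x, 0 <= phi j x &
   forall S, (forall j, K j (S j)) -> (forall j x, c * S j x <= Sb j x) ->
    (forall x, (forall j, 0 < S j x) -> G x <= \prod_j phi j x `^ theta j) /\
    forall j, (\int[mu]_x (S j x * phi j x)%:E <= (A + e)%:E)%E].
Proof.
move=> KSb /andP[c0 c1] e0.
pose eta := e / (2 * (A + e)).
have Ae : 0 < A + e by rewrite ltr_wpDl.
have eta0 : 0 < eta by rewrite divr_gt0// mulr_gt0.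
have eta1 : eta < 1 by exact: mixing_lt1.
have eta01 : 0 <= eta <= 1 by rewrite !ltW.
pose L := (c^-1 + 1) / eta.
have L1 : 1 <= L.
  rewrite /L ler_pdivlMr// mul1r (le_trans (ltW eta1))// lerDr invr_ge0 ltW//.
have L0 : 0 < L by exact: lt_le_trans L1.
pose t := e / (8 * L ^+ 2 * (A + 1 + e)).
have Ae1 : 0 < A + 1 + e by rewrite addr_gt0// ltr_wpDl.
have t0 : 0 < t by rewrite /t divr_gt0// !mulr_gt0// ?addr_gt0 ?invr_gt0.
have tL : t * L <= 2^-1 by exact: step_small.
have t1 : 0 <= t <= 1.
  rewrite (ltW t0)/=; apply: (@le_trans _ _ (t * L)); first by rewrite ler_peMr// ltW.
  by apply: le_trans tL _; rewrite invf_le1// ler1n.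
(* The product of the exponents is a positive lower bound for each of them. *)
pose dl := t * (e / 4) * \prod_j theta j.
pose mix U : Ix -> X -> R := fun j x => (1 - eta) * U j x + eta * Sb j x.
have Kmix U : (forall j, K j (U j)) -> forall j, K j (mix U j).
  by move=> KU j; exact: convK.
have gfin U : (forall j, K j (U j)) -> (\int[mu]_x (geom_product theta G U x)%:E)%E \is a fin_num.
  move=> KU; rewrite ge0_fin_numE; first by rewrite (le_lt_trans (KA KU))// ltry.
  by apply: integral_ge0 => x _; rewrite lee_fin geom_product_ge0.
pose Q := [set fine (\int[mu]_x (geom_product theta G (mix U) x)%:E)%E | U in [set U | forall j, K j (U j)]].
have hQ : has_sup Q.
  split; first by eexists; exists Sb.
  exists A => _ [U KU <-]; rewrite -lee_fin fineK; last exact/gfin/Kmix.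
  exact/KA/Kmix.
pose a := sup Q.
have dl0 : 0 < dl.
  by apply: mulr_gt0; [apply: mulr_gt0 => //; exact: divr_gt0 | exact: prodr_gt0].
have [_ [U KU <-] Uhi] := sup_adherent dl0 hQ.
have Qa V : (forall j, K j (V j)) -> (\int[mu]_x (geom_product theta G (mix V) x)%:E <= a%:E)%E.
  move=> KV; rewrite -(fineK (gfin _ (Kmix _ KV))) lee_fin.
  by apply: ub_le_sup; [exact: hQ.2 | exists V].
have aA : a <= A.
  apply: ge_sup; first exact: hQ.1.
  move=> _ [V KV <-]; rewrite -lee_fin fineK; last exact/gfin/Kmix.
  exact/KA/Kmix.
have a0 : 0 <= a.
  by rewrite -lee_fin; apply: le_trans (Qa _ KSb);
  apply: integral_ge0 => x _; rewrite lee_fin geom_product_ge0.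
pose S' := mix U.
have KS' : forall j, K j (S' j) by exact: Kmix.
have S'0 j x : 0 <= S' j x by exact: (K0 (KS' j)).
have Sb0 j x : 0 <= Sb j x by exact: (K0 (KSb j)).
have mS' j : measurable_fun setT (S' j) by exact: (mK (KS' j)).
pose P := geom_product theta G S'.
have P0 x : 0 <= P x by exact: geom_product_ge0.
have mP : measurable_fun setT P by exact: measurable_geom_product.
exists (fun j x => P x / S' j x); split.
- by move=> j; exact: measurable_fun_div.
- by move=> j x; rewrite divr_ge0.
- move=> S KS cS; have S0 j x : 0 <= S j x by exact: (K0 (KS j)).
  split.
    move=> x Sx.
    have S'x j : 0 < S' j x.
      rewrite /S' /mix ltr_wpDl ?mulr_ge0 ?subr_ge0 ?(ltW eta1)//.
        by exact: (K0 (KU j)).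
      by rewrite mulr_gt0// (lt_le_trans _ (cS j x))// mulr_gt0.
    have q0 : 0 < \prod_j S' j x `^ theta j by apply: prodr_gt0 => j _; rewrite powR_gt0.
    have -> : \prod_j (P x / S' j x) `^ theta j = \prod_j P x `^ theta j / \prod_j S' j x `^ theta j.
      rewrite -prodf_div; apply: eq_bigr => j _.
      by rewrite powRM ?invr_ge0// -powR_inv1// -powRrM mulN1r powRN.
    (* At P x = 0 the empty index set is excluded by the sum of the exponents. *)
    have -> : \prod_j P x `^ theta j = P x.
      have [Px|Px] := eqVneq (P x) 0.
        have [j _] : exists j : Ix, true.
          case: (pickP Ix) => [j _|Ix0]; first by exists j.
          by move: theta1 => /eqP; rewrite big_pred0// eq_sym oner_eq0.
        by rewrite (bigD1 j)//= Px powR0 ?mul0r// gt_eqF.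
      rewrite -[RHS]powRr1// -theta1; elim/big_rec2: _ => [|j y z _ ->]; first by rewrite powRr0.
      by rewrite powRD ?Px ?implybT.
    by rewrite /P /geom_product mulfK ?gt_eqF.
  move=> j.
  pose V x := (1 - eta) * S j x + eta * Sb j x.
  have V0 x : 0 <= V x by rewrite addr_ge0// mulr_ge0 ?subr_ge0 ?S0 ?(ltW eta1) ?(ltW eta0).
  have mV : measurable_fun setT V by exact: (mK (convK (KS j) (KSb j) eta01)).
  have VL x : V x <= L * S' j x.
    apply: (@le_trans _ _ ((c^-1 + 1) * Sb j x)).
      rewrite mulrDl mul1r lerD//; last by rewrite ler_piMl// ltW.
      apply: (@le_trans _ _ (S j x)); first by rewrite ler_piMl// gerBl ltW.
      by rewrite -ler_pdivrMl ?invr_gt0// invrK.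
    rewrite /L -mulrA ler_wpM2l ?addr_ge0 ?invr_ge0 ?(ltW c0)//.
    rewrite ler_pdivlMl// /S' /mix lerDr mulr_ge0 ?subr_ge0 ?(ltW eta1)//.
    exact: (K0 (KU j)).
  (* Perturbing the mixed tuple is the same as mixing the perturbed tuple, so the
     perturbation remains a competitor. *)
  pose U' := update U j (fun x => (1 - t) * U j x + t * S j x).
  have KU' i : K i (U' i).
    by rewrite /U' /update; case: eqP => // ->; exact: convK.
  have UE : geom_product theta G (update S' j (fun x => (1 - t) * S' j x + t * V x)) =
      geom_product theta G (mix U').
    apply/funext => x; congr (_ * _); apply: eq_bigr => i _; congr (_ `^ _).
    rewrite /update /mix /U' /S' /update; case: eqP => // ->.
    by rewrite /V /mix; ring.
  have := @perturbation_integral _ _ _ mu Ix theta G theta0 mG G0 S' j V L t dl a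
    mS' mV S'0 V0 VL L1 t0 tL a0.
  rewrite UE => H.
  have {}H : (\int[mu]_x (V x * (P x / S' j x))%:E <=
     (dl / (theta j * t) + (1 + 2 * t * L ^+ 2) * a)%:E)%E.
    apply: H; [|exact: Qa|exact: Qa].
    by rewrite -[leRHS](fineK (gfin _ KS')) lee_fin ltW.
  have e1 : 0 < 1 - eta by rewrite subr_gt0.
  have mSphi : measurable_fun setT (fun x => S j x * (P x / S' j x)).
    by apply: measurable_funM; [exact: (mK (KS j))|exact: measurable_fun_div].
  have Sphi0 x : 0 <= S j x * (P x / S' j x) by rewrite mulr_ge0 ?S0// divr_ge0.
  have : ((1 - eta)%:E * \int[mu]_x (S j x * (P x / S' j x))%:E <= ((1 - eta) * (A + e))%:E)%E.
    rewrite -ge0_intZ ?(ltW e1)//.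
    apply: (@le_trans _ _ (\int[mu]_x (V x * (P x / S' j x))%:E)%E).
      apply: ge0_int_le.
      - exact: measurable_funM.
      - by apply: measurable_funM => //; exact: measurable_fun_div.
      - by move=> x; rewrite mulr_ge0// ltW.
      - by move=> x; rewrite mulr_ge0// divr_ge0.
      - apply: nearW => x; rewrite mulrA ler_wpM2r ?divr_ge0// lerDl mulr_ge0// ltW//.
    apply: (le_trans H); rewrite lee_fin.
    apply: le_trans (perturbation_choice A0 e0 L1 (prod_theta_le j)).
    rewrite lerD2l ler_wpM2l// addr_ge0//.
    exact: mulr_ge0 (mulr_ge0 (ler0n R 2) (ltW t0)) (sqr_ge0 L).
  by rewrite EFinM lee_pmul2l ?lte_fin.
Qed.

Hypothesis K_inhab : exists S, forall j, K j (S j).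
Hypothesis satK : forall j E, measurable E -> (0 < mu E)%E ->
  exists f E', [/\ K j f, measurable E', E' `<=` E, (0 < mu E')%E & forall x, E' x -> 0 < f x].

Lemma ae_meets_positive (P : X -> Prop) E : {ae mu, forall x, P x} -> measurable E -> (0 < mu E)%E ->
  exists2 x, E x & P x.
Proof.
move=> [N [mN N0 PN]] mE E0; apply: contrapT => H.
have EN : E `<=` N by move=> x Ex; apply: PN => Px; apply: H; exists x.
by move: E0; rewrite lt0e (subset_measure0 mE mN EN N0) eqxx.
Qed.

Lemma update_mem S j f : (forall i, K i (S i)) -> K j f -> forall i, K i (update S j f i).
Proof. by move=> KS Kf i; rewrite /update; case: eqP => // ->. Qed.

Lemma positive_tuple E (s : seq Ix) : measurable E -> (0 < mu E)%E ->
  exists S E', [/\ forall j, K j (S j), measurable E', E' `<=` E, (0 < mu E')%E &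
    forall j x, j \in s -> E' x -> 0 < S j x].
Proof.
move=> mE E0; elim: s => [|j s [S [E' [KS mE' sE' E'0 SE']]]].
  by have [S KS] := K_inhab; exists S, E; split.
have [f [E2 [Kf mE2 sE2 E20 fE2]]] := satK j mE' E'0.
exists (update S j f), E2; split => //.
- exact: update_mem.
- exact: subset_trans sE'.
- move=> i x; rewrite inE /update; case: eqP => [_ _|_ /= si] xE2; first exact: fE2.
  by apply: SE' => //; exact: sE2.
Qed.

(* A constraint is given by a tuple in the K_j and an integer n, which stands for the
   tolerance 1/(n+1). *)
Let idx : Type := ({S : Ix -> X -> R | forall j, K j (S j)} * nat)%type.

Let level (i : idx) : R := A + i.2.+1%:R^-1.

(** Repeated averaging produces one tuple that dominates all the listed ones up to a
constant. *)
Lemma dominating_tuple (l : seq idx) : exists q : (Ix -> X -> R) * R * nat,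
  [/\ forall j, K j (q.1.1 j), 0 < q.1.2 <= 1 &
   meets (fun i : idx => [set q : (Ix -> X -> R) * R * nat |
     (forall j x, q.1.2 * sval i.1 j x <= q.1.1 j x) /\ (i.2 <= q.2)%N]) l q].
Proof.
have h2 : 0 <= (2^-1 : R) <= 1 by rewrite invr_ge0 ler0n invf_le1// ler1n.
have e2 : 1 - 2^-1 = 2^-1 :> R by field.
elim: l => [|[[S KS] n] l [[[Sb c] N] /= [KSb /andP[c0 c1] IH]]].
  by have [S KS] := K_inhab; exists (S, 1, 0%N); split => //=; rewrite ltr01 lexx.
exists (fun j x => (1 - 2^-1) * Sb j x + 2^-1 * S j x, 2^-1 * c, maxn n N); split => /=.
- by move=> j; exact: convK.
- by rewrite mulr_gt0//=; case/andP: h2 => *; apply: mulr_ile1 => //; exact: ltW.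
split; first split.
- move=> j x; rewrite /= -mulrA ler_wpDl// ?mulr_ge0 ?(K0 (KSb j))// ?e2//.
  rewrite ler_wpM2l//; apply: ler_piMl => //; exact: (K0 (KS j)).
- exact: leq_maxl.
apply: meets_impl IH => -[[S' KS'] n'] /= [cS' nN]; split.
  move=> j x; rewrite e2 -mulrA ler_wpDr ?mulr_ge0 ?(K0 (KS j))//.
  by rewrite ler_wpM2l.
by rewrite (leq_trans nN)// leq_maxr.
Qed.

(** A list of constraints concerns finitely many tuples and tolerances; one
near-optimal multiplier for a dominating tuple and the smallest tolerance meets
them all. *)
Lemma dual_fip (l : seq idx) :
  meets (fun i : idx => dual_constraint mu theta G (sval i.1) (level i)) l !=set0.
Proof.
have [[[Sb c] N] /= [KSb c01 HS]] := dominating_tuple l.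
have [|phi [mphi phi0 phiP]] := @near_optimal_multiplier Sb c N.+1%:R^-1 KSb c01.
  by rewrite invr_gt0.
have psiP j : measurable_fun setT (fun x => expR (- phi j x)) /\ forall x, 0 <= expR (- phi j x) <= 1.
  split; first by apply: (measurableT_comp (@measurable_expR R)); exact: measurable_funN.
  by move=> x; rewrite expR_ge0 expR_le1 oppr_le0 phi0.
exists (exist _ (fun j x => expR (- phi j x)) psiP).
apply: meets_impl HS => -[[S KS] n] /= [cS nN].
have [h1 h2] := phiP S KS cS; split.
  apply: nearW => x Sx _ /=; under eq_bigr do rewrite expRK opprK.
  exact: h1.
move=> j /=; under eq_integral do rewrite /neglog gt_eqF ?expR_gt0// expRK opprK -EFinM.
apply: le_trans (h2 j) _; rewrite lee_fin lerD2l lef_pV2 ?posrE// ler_nat//.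
Qed.

(** Compactness yields a multiplier psi for all tuples with tolerance 0. If psi_j = 0
on a set of positive measure, some f in K_j would be positive on a part of it,
and the integral of f phi_j would be infinite. If the product inequality failed on
a set of positive measure, a tuple positive on a part of it would violate its
constraint. *)
Theorem disentanglement : exists phi : Ix -> X -> R,
  [/\ forall j, measurable_fun setT (phi j), forall j x, 0 <= phi j x,
   {ae mu, forall x, G x <= \prod_j phi j x `^ theta j} &
   forall j f, K j f -> (\int[mu]_x (f x * phi j x)%:E <= A%:E)%E].
Proof.
have mI (i : idx) j : measurable_fun setT (sval i.1 j) by exact: mK (proj2_sig i.1 j).
have I0 (i : idx) j x : 0 <= sval i.1 j x by exact: K0 (proj2_sig i.1 j) x.
have [psi psiP] := dual_compactness theta0 G0 mI I0 dual_fip.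
have [S0 KS0] := K_inhab.
have bound S n (KS : forall j, K j (S j)) := psiP (exist _ S KS, n).
have mn j f : K j f -> measurable_fun setT (fun x => (f x)%:E * neglog (sval psi j x))%E.
  move=> Kf; apply: emeasurable_funM; first by apply/measurable_EFinP; exact: mK Kf.
  by apply: (measurableT_comp (@measurable_neglog R)); exact: multiplier_meas.
have n0 j f x : K j f -> (0 <= (f x)%:E * neglog (sval psi j x))%E.
  by move=> Kf; rewrite mule_ge0 ?lee_fin ?(K0 Kf)// neglog_ge0// multiplier_le1.
have boundj j f n : K j f ->
    (\int[mu]_x ((f x)%:E * neglog (sval psi j x)) <= (A + n.+1%:R^-1)%:E)%E.
  move=> Kf; have [_ /(_ j)] := bound _ n (update_mem KS0 Kf).
  by rewrite /= /update eqxx.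
have pos j : {ae mu, forall x, 0 < sval psi j x}.
  pose E := [set x | sval psi j x = 0].
  have mE : measurable E.
    have -> : E = [set: X] `&` sval psi j @^-1` [set 0] by rewrite setTI.
    by apply: multiplier_meas => //; exact: measurable_set1.
  exists E; split => //; last first.
    move=> x /= h; rewrite /E/=; apply: contrapT => /eqP ne; apply: h.
    by rewrite lt_neqAle eq_sym ne multiplier_ge0.
  apply/eqP; rewrite eq_le measure_ge0 andbT leNgt; apply/negP => E0.
  have [f [E' [Kf mE' sE' E'0 fE']]] := satK j mE E0.
  have int : mu.-integrable setT (fun x => (f x)%:E * neglog (sval psi j x))%E.
    apply/integrableP; split; first exact: mn.
    under eq_integral do rewrite gee0_abs ?n0//.
    by rewrite (le_lt_trans (boundj _ _ 0%N Kf))// ltry.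
  have [x xE' /(_ Logic.I)] := ae_meets_positive (integrable_ae measurableT int) mE' E'0.
  by rewrite /neglog (sE' _ xE') eqxx gt0_muley ?lte_fin ?fE'.
have posall : {ae mu, forall x, forall j, 0 < sval psi j x} by exact: filter_forall.
pose phi j x := - ln (sval psi j x).
have phi0 j x : 0 <= phi j x by rewrite oppr_ge0 ln_le0// multiplier_le1.
have mphi j : measurable_fun setT (phi j).
  apply: measurable_funN; apply: (measurableT_comp (@measurable_ln R)).
  exact: multiplier_meas.
exists phi; split => //.
- pose E := [set x | \prod_j phi j x `^ theta j < G x].
  have mE : measurable E.
    have -> : E = [set: X] `&` (fun x => \prod_j phi j x `^ theta j < G x) @^-1` [set true].
      by rewrite setTI.
    apply: measurable_fun_ltr => //; apply: measurable_prod => j _.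
    exact: (measurableT_comp (measurable_powR _)).
  exists E; split => //; last by move=> x /=; move/negP; rewrite -ltNge.
  apply/eqP; rewrite eq_le measure_ge0 andbT leNgt; apply/negP => E0.
  have [S [E' [KS mE' sE' E'0 SE']]] := positive_tuple (index_enum Ix) mE E0.
  have [h1 _] := bound S 0%N KS.
  have [x xE' [hx px]] := ae_meets_positive (filterI h1 posall) mE' E'0.
  have := sE' _ xE'; rewrite /E/= ltNge => /negP; apply.
  by apply: hx => // j; apply: SE' => //; rewrite mem_index_enum.
- move=> j f Kf; apply/lee_addgt0Pr => e e0.
  apply: (@le_trans _ _ (\int[mu]_x ((f x)%:E * neglog (sval psi j x)))%E).
    apply: ge0_le_integral => //.
    + by move=> x _; rewrite lee_fin mulr_ge0// (K0 Kf).
    + by apply/measurable_EFinP; apply: measurable_funM => //; exact: mK Kf.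
    + exact: mn.
    + move=> x _; rewrite EFinM lee_wpmul2l ?lee_fin ?(K0 Kf)//.
      by rewrite /neglog /phi; case: eqP => // _; rewrite leey.
  apply: (le_trans (boundj _ _ (Num.truncn e^-1) Kf)).
  rewrite -EFinD lee_fin lerD2l -[leRHS]invrK lef_pV2 ?posrE ?invr_gt0//.
  exact: ltW (truncnS_gt _).
Qed.

End DisentanglementTheorem.

(** * Operators and the cones that they generate *)

(** Distributivity when the summation ranges T_ i depend on i, as for independent
variables on different probability spaces. *)
Lemma prod_sum_fprod (R : comPzSemiRingType) (I : finType) (T_ : I -> finType)
    (F : forall i, T_ i -> R) :
  \prod_i \sum_(o : T_ i) F i o = \sum_(t : fprod T_) \prod_i F i (t i).
Proof.
pose P i := [ffun o : T_ i => F i o].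
transitivity (\sum_(t : fprod T_) \prod_i P i (t i)); last first.
  by apply: eq_bigr => t _; apply: eq_bigr => i _; rewrite ffunE.
rewrite big_fprod -(bigA_distr_big_dep (tagged_with T_) (fun i o => untag 0 (P i) o)).
apply: eq_bigr => i _; rewrite (eq_bigr (P i)); last by move=> o _; rewrite ffunE.
rewrite (big_tag (fun i (o : T_ i) => P i o) i); exact: eq_bigl.
Qed.

Section ScalarRandomization.
Variables (R : realType) (p r kap : R) (k : scalar_kind).
Hypothesis p0 : 0 < p.

(** The constant lost in passing from real to complex coefficients by looking only at
the larger of the real and the imaginary part. *)
Definition complex_loss : R := 2 `^ (- ((p + 1) / p)).

Lemma complex_loss_gt0 : 0 < complex_loss. Proof. by rewrite powR_gt0. Qed.

Lemma sum_modulus_powR_le (m : nat) (z : 'I_m -> scalarType R k) :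
  \sum_i modulus (z i) `^ p <= 2 `^ (p + 1) *
    Num.max (\sum_i `|scalar_re (z i)| `^ p) (\sum_i `|scalar_im (z i)| `^ p).
Proof.
set a := \sum_i `|scalar_re _| `^ _; set b := \sum_i `|scalar_im _| `^ _.
apply: (@le_trans _ _ (2 `^ p * (a + b))).
  rewrite -big_split/= mulr_sumr; apply: ler_sum => i _.
  have [h|h] := leP `|scalar_re (z i)| `|scalar_im (z i)|.
    apply: (@le_trans _ _ ((2 * `|scalar_im (z i)|) `^ p)).
      rewrite powR_le ?modulus_ge0 ?(ltW p0)// (le_trans (modulus_le_re_im _))//.
      by rewrite mulr_natl mulr2n lerD2r.
    by rewrite powRM// ler_wpM2l ?powR_ge0// lerDr powR_ge0.
  apply: (@le_trans _ _ ((2 * `|scalar_re (z i)|) `^ p)).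
    rewrite powR_le ?modulus_ge0 ?(ltW p0)// (le_trans (modulus_le_re_im _))//.
    by rewrite mulr_natl mulr2n lerD2l ltW.
  by rewrite powRM// ler_wpM2l ?powR_ge0// lerDl powR_ge0.
rewrite powRD ?pnatr_eq0 ?implybT// powRr1// -mulrA ler_wpM2l ?powR_ge0//.
by rewrite mulr_natl mulr2n lerD// le_max lexx ?orbT.
Qed.

Lemma scalar_randomization (Om : finType) (prob : Om -> R) (m : nat) (eta : Om -> 'I_m -> R) s
    (z : 'I_m -> scalarType R k) : 0 < s -> 0 < kap -> (forall o, 0 <= prob o) ->
  (forall a : 'I_m -> R, kap `^ s * (\sum_i `|a i| `^ p) `^ (s / p) <=
        \sum_o prob o * `|\sum_i a i * eta o i| `^ s) ->
  (kap * complex_loss) `^ s * (\sum_i modulus (z i) `^ p) `^ (s / p) <=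
  \sum_o prob o * modulus (\sum_i real_scalar k (eta o i) * z i) `^ s.
Proof.
move=> s0 k0 prob0 H.
set a := \sum_i `|scalar_re (z i)| `^ p; set b := \sum_i `|scalar_im (z i)| `^ p.
have a0 : 0 <= a by apply: sumr_ge0 => i _; rewrite powR_ge0.
have b0 : 0 <= b by apply: sumr_ge0 => i _; rewrite powR_ge0.
have sp : 0 <= s / p by rewrite divr_ge0 ?ltW.
apply: (@le_trans _ _ (kap `^ s * (Num.max a b) `^ (s / p))).
  rewrite powRM ?(ltW k0) ?powR_ge0// -mulrA ler_wpM2l ?powR_ge0//.
  apply: (le_trans (ler_wpM2l (powR_ge0 _ _) (powR_le sp _ (sum_modulus_powR_le z)))).
    by apply: sumr_ge0 => i _; rewrite powR_ge0.
  rewrite -/a -/b powRM ?powR_ge0 ?le_max ?a0// mulrA -!powRrM -powRD ?pnatr_eq0 ?implybT//.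
  rewrite (_ : - ((p + 1) / p) * s + (p + 1) * (s / p) = 0) ?powRr0 ?mul1r//.
  by field; rewrite gt_eqF.
have [ab|ba] := leP a b.
  apply: le_trans (H (fun i => scalar_im (z i))) _; apply: ler_sum => o _.
  rewrite ler_wpM2l// powR_le ?(ltW s0)//; apply: le_trans (norm_scalar_im _).
  rewrite scalar_im_sum le_eqVlt; apply/orP; left; apply/eqP; congr `|_|.
  by apply: eq_bigr => i _; rewrite scalar_imM mulrC.
apply: le_trans (H (fun i => scalar_re (z i))) _; apply: ler_sum => o _.
rewrite ler_wpM2l// powR_le ?(ltW s0)//; apply: le_trans (norm_scalar_re _).
rewrite scalar_re_sum le_eqVlt; apply/orP; left; apply/eqP; congr `|_|.
by apply: eq_bigr => i _; rewrite scalar_reM mulrC.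
Qed.

End ScalarRandomization.

Section LinearOperators.
Context {dX : measure_display} {X : measurableType dX} {R : realType} {k : scalar_kind}.
Variable mu : {measure set X -> \bar R}.
Variables (Y : lmodType (scalarType R k)) (T : Y -> X -> scalarType R k).
Hypothesis linT : linear_operator mu T.

Lemma linear_operator0 : {ae mu, forall x, T 0 x = 0}.
Proof.
have := linT.2 1 0 0; rewrite scaler0 addr0; apply: filterS => x.
by rewrite mul1r => /eqP; rewrite eq_sym -subr_eq0 addrK => /eqP.
Qed.

Lemma linear_operator_sum (I : Type) (s : seq I) (a : I -> scalarType R k) (f : I -> Y) :
  {ae mu, forall x, T (\sum_(i <- s) a i *: f i) x = \sum_(i <- s) a i * T (f i) x}.
Proof.
elim: s => [|i s IH].
  by apply: filterS linear_operator0 => x Tx; rewrite !big_nil.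
apply: filterS2 (linT.2 (a i) (f i) (\sum_(i <- s) a i *: f i)) IH => x h1 h2.
by rewrite !big_cons h1 h2.
Qed.

Lemma measurable_modulus (f : Y) : measurable_fun setT (fun x => modulus (T f x)).
Proof.
move: (linT.1 f); rewrite /measurable_scalar_fun /modulus.
move: (T f); case: k => /= g; first by move=> mg; exact: measurableT_comp.
move=> [mre mim].
have -> : (fun x => ComplexField.Normc.normc (g x)) =
    (fun x => (complex.Re (g x) ^+ 2 + complex.Im (g x) ^+ 2) `^ 2^-1).
  apply/funext => x; rewrite powR12_sqrt ?addr_ge0 ?sqr_ge0//.
  by case: (g x).
apply: (measurableT_comp (measurable_powR _)).
by apply: measurable_funD; exact: measurable_funX.
Qed.

(** The coefficients c make the convexity of this set immediate: two families are
concatenated. The budget gam is the size of a single vector that may enter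
with coefficient 1. *)
Definition power_cone (N : Y -> R) (p gam : R) : set (X -> R) :=
  [set S | exists m (c : 'I_m -> R) (f : 'I_m -> Y), [/\ forall i, 0 <= c i,
     \sum_i c i * N (f i) `^ p <= gam `^ p &
     S = fun x => \sum_i c i * modulus (T (f i) x) `^ p]].

Variables (N : Y -> R) (p gam : R).

Lemma power_cone_measurable S : power_cone N p gam S -> measurable_fun setT S.
Proof.
move=> [m [c [f [_ _ ->]]]]; apply: measurable_sum => i.
apply: measurable_funM => //; apply: (measurableT_comp (measurable_powR _)).
exact: measurable_modulus.
Qed.

Lemma power_cone_ge0 S x : power_cone N p gam S -> 0 <= S x.
Proof.
by move=> [m [c [f [c0 _ ->]]]]; apply: sumr_ge0 => i _; rewrite mulr_ge0 ?powR_ge0.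
Qed.

Lemma power_cone0 : power_cone N p gam (fun=> 0).
Proof.
exists 0%N, (fun=> 0), (fun=> 0); split => //; first by rewrite big_ord0 powR_ge0.
by apply/funext => x; rewrite big_ord0.
Qed.

Lemma power_cone_single (c : R) (f : Y) : 0 <= c -> c * N f `^ p <= gam `^ p ->
  power_cone N p gam (fun x => c * modulus (T f x) `^ p).
Proof.
move=> c0 cf; exists 1%N, (fun=> c), (fun=> f); split => //; first by rewrite big_ord1.
by apply/funext => x; rewrite big_ord1.
Qed.

Lemma power_cone_convex S S' (t : R) : power_cone N p gam S -> power_cone N p gam S' ->
  0 <= t <= 1 -> power_cone N p gam (fun x => (1 - t) * S x + t * S' x).
Proof.
move=> [m [c [f [c0 cN ->]]]] [m' [c' [f' [c0' cN' ->]]]] /andP[t0 t1].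
exists (m + m')%N,
  (fun i => match fintype.split i with inl i => (1 - t) * c i | inr i => t * c' i end),
  (fun i => match fintype.split i with inl i => f i | inr i => f' i end); split.
- by move=> i; case: (fintype.split i) => j; rewrite mulr_ge0 ?subr_ge0.
- rewrite big_split_ord/=.
  under eq_bigr do rewrite (unsplitK (inl _)) -mulrA.
  under [X in _ + X <= _]eq_bigr do rewrite (unsplitK (inr _)) -mulrA.
  rewrite -!mulr_sumr; apply: (@le_trans _ _ ((1 - t) * gam `^ p + t * gam `^ p)).
    by rewrite lerD// ler_wpM2l ?subr_ge0.
  by rewrite -mulrDl subrK mul1r.
- apply/funext => x; rewrite big_split_ord/= !mulr_sumr; congr (_ + _).
    by apply: eq_bigr => i _; rewrite (unsplitK (inl _)) -mulrA.
  by apply: eq_bigr => i _; rewrite (unsplitK (inr _)) -mulrA.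
Qed.

(** The saturation of T gives positivity only almost everywhere on E'; the points
where it fails are removed. *)
Lemma power_cone_saturates E : 0 < p -> 0 < gam -> quasi_norm N -> saturates mu T ->
  measurable E -> (0 < mu E)%E ->
  exists f E', [/\ power_cone N p gam f, measurable E', E' `<=` E, (0 < mu E')%E &
     forall x, E' x -> 0 < f x].
Proof.
move=> p0 g0 [N0 _ _ _] sat mE E0; have [E1 [h [mE1 sE1 E10 hE1]]] := sat E mE E0.
pose E2 := E1 `&` [set x | 0 < modulus (T h x)].
have mE2 : measurable E2.
  apply: measurableI => //.
  have -> : [set x | 0 < modulus (T h x)] =
     [set: X] `&` (fun x => 0 < modulus (T h x)) @^-1` [set true] by rewrite setTI.
  by apply: measurable_fun_ltr => //; exact: measurable_modulus.
have E2E1 : mu E2 = mu E1.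
  move: hE1 => [Z [mZ Z0 hZ]]; apply/eqP; rewrite eq_le; apply/andP; split.
    by apply: le_measure; rewrite ?inE//; exact: subIsetl.
  apply: (@le_trans _ _ (mu (E2 `|` Z))).
    apply: le_measure; rewrite ?inE//; first exact: measurableU.
    move=> x xE1; have [hx|hx] := pselect (0 < modulus (T h x)); first by left.
    by right; apply: hZ => /= /(_ xE1).
  apply: (le_trans (measureU2 mu mE2 mZ)).
  have Zle : (mu Z <= 0)%E by rewrite [X in (X <= _)%E]Z0.
  by rewrite -[leRHS]adde0; apply: leeD.
pose c := gam `^ p / (1 + N h `^ p).
have d0 : 0 < 1 + N h `^ p by rewrite ltr_pwDl// powR_ge0.
have c0 : 0 < c by rewrite divr_gt0// powR_gt0.
exists (fun x => c * modulus (T h x) `^ p), E2; split => //.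
- apply: power_cone_single; first exact: ltW.
  by rewrite /c mulrAC ler_pdivrMr// ler_wpM2l ?powR_ge0// lerDr.
- by apply: subset_trans sE1; exact: subIsetl.
- by rewrite E2E1.
- by move=> x [_ /= hx]; rewrite mulr_gt0// powR_gt0.
Qed.

End LinearOperators.

(** * Averaging the hypothesis over random vectors *)

(** The least type constant is attained. It can only be 0 if all vectors have norm 0,
because a single vector already forces the constant 1; then 1 may replace it. *)
Lemma positive_type_bound (R : realType) (k : scalar_kind) (Y : lmodType (scalarType R k))
    (N : Y -> R) (r : R) : quasi_norm N -> has_rademacher_type N r ->
  exists Rc : R, [/\ 0 < Rc, rademacher_type_bound N r Rc &
    forall f, Rc * N f <= rademacher_const N r * N f].
Proof.
move=> [N0 Neq0 NZ _] [r0 r2 [C0 HC0]].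
have bound_mono C C' : C <= C' -> rademacher_type_bound N r C -> rademacher_type_bound N r C'.
  by move=> CC' HC m F; apply: le_trans (HC m F) _; rewrite ler_wpM2r ?powR_ge0.
set Cs := [set C : R | 0 <= C /\ rademacher_type_bound N r C].
have hinf : has_inf Cs.
  split; last by exists 0 => C [].
  exists (Num.max 0 C0); split; first by rewrite le_max lexx.
  by apply: bound_mono HC0; rewrite le_max lexx orbT.
have rc0 : 0 <= rademacher_const N r by apply: lb_le_inf; [exact: hinf.1 | move=> C []].
have rcb : rademacher_type_bound N r (rademacher_const N r).
  move=> m F; set q := (\sum_(i < m) _) `^ _.
  have q0 : 0 <= q by rewrite powR_ge0.
  move: q0; rewrite le_eqVlt => /predU1P[q0|q0].
    by have := HC0 m F; rewrite -/q -q0 !mulr0.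
  rewrite -ler_pdivrMr//; apply: lb_le_inf; first exact: hinf.1.
  by move=> C [_ HC]; rewrite ler_pdivrMr//; exact: HC.
move: (rc0); rewrite le_eqVlt => /predU1P[rc|rc]; last by exists (rademacher_const N r).
exists 1; split => //; first by apply: bound_mono rcb; rewrite -rc.
move=> f; suff -> : N f = 0 by rewrite !mulr0.
have := rcb 1%N (fun=> f); rewrite -rc mul0r.
have -> : rademacher_mean N r (fun _ : 'I_1 => f) = N f `^ r.
  rewrite /rademacher_mean (eq_bigr (fun=> N f `^ r)).
    rewrite sumr_const card_ffun card_bool card_ord -(mulr_natl (N f `^ r)) mulrA.
    by rewrite -natrX mulVf ?mul1r// pnatr_eq0.
  move=> e _; rewrite big_ord1 NZ -real_scalar_sign -[real_scalar _ _]mulr1 modulusM.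
  by rewrite modulus1 mulr1 normrX normrN1 expr1n mul1r.
rewrite -powRrM mulfV ?gt_eqF// powRr1// => h.
by apply/eqP; rewrite eq_le h N0.
Qed.

Section ConeRandomization.
Context {dX : measure_display} {X : measurableType dX} {R : realType} {k : scalar_kind}.
Variable mu : {measure set X -> \bar R}.
Variables (Y : lmodType (scalarType R k)) (N : Y -> R) (T : Y -> X -> scalarType R k).
Variables (p r kap Rc : R).
Hypotheses (linT : linear_operator mu T) (qN : quasi_norm N) (p0 : 0 < p).
Hypotheses (kap0 : 0 < kap) (Rc0 : 0 < Rc) (typN : rademacher_type_bound N r Rc).
Hypothesis rand : randomizes p r kap.

(** With this budget the constants from the lower bound of the operator and the upper
bound of the norm cancel, so that averaging over the cones loses no factor. *)
Definition cone_budget : R := kap ^+ 2 * complex_loss p / Rc.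

Lemma cone_budget_gt0 : 0 < cone_budget.
Proof. by rewrite divr_gt0// mulr_gt0 ?exprn_gt0 ?complex_loss_gt0. Qed.

(** The lower moment bound and the type bound for Z = sum_i eta_i e_i f_i with
e_i = c_i^(1/p) / gam, rescaled so that the norm has mean at most 1. The resulting
constant appears as a factor C of the weights, which need not sum to 1. *)
Lemma power_cone_random (th : R) (S : X -> R) : 0 < th <= 1 ->
  power_cone T N p cone_budget S ->
  exists D : {Om : finType & ((Om -> R) * (Om -> Y))%type},
  [/\ forall o, 0 <= (projT2 D).1 o,
      {ae mu, forall x, S x `^ th <=
         \sum_o (projT2 D).1 o * modulus (T ((projT2 D).2 o) x) `^ (p * th)} &
      \sum_o (projT2 D).1 o * N ((projT2 D).2 o) `^ (p * th) <= 1].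
Proof.
move=> /andP[th0 th1] [m [c [f [c0 cN ->]]]].
have [N0 Neq0 NZ _] := qN.
have g0 := cone_budget_gt0; set gam := cone_budget in g0 cN *.
have s0 : 0 < p * th by rewrite mulr_gt0.
have sp : p * th <= p by rewrite ler_piMr// ltW.
have sthE : p * th / p = th by field; rewrite gt_eqF.
pose e i := c i `^ p^-1 / gam.
have e0 i : 0 <= e i by rewrite divr_ge0 ?powR_ge0 ?(ltW g0).
have ep i : e i `^ p = c i / gam `^ p.
  rewrite powRM ?powR_ge0 ?invr_ge0 ?(ltW g0)// -powRrM mulVf ?gt_eqF// powRr1//.
  by rewrite -powR_inv1 ?(ltW g0)// -powRrM mulN1r powRN.
have gp : 0 < gam `^ p by rewrite powR_gt0.
pose F i := real_scalar k (e i) *: f i.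
have NF i : N (F i) = e i * N (f i).
  by rewrite NZ -[real_scalar _ _]mulr1 modulusM modulus1 mulr1 ger0_norm.
have bsum : \sum_i N (F i) `^ p <= 1.
  rewrite (eq_bigr (fun i => c i * N (f i) `^ p / gam `^ p)).
    by rewrite -mulr_suml ler_pdivrMr// mul1r.
  by move=> i _; rewrite NF powRM// ep mulrAC.
have [|Om [prob [eta [prob0 prob1 Hlo Hup]]]] := @rand m (fun i => N (F i)) (p * th) (fun i => N0 (F i)) bsum.
  by rewrite s0.
(* The factor that normalises the operator side; by the choice of gam it equals
   (kap / Rc)^(p th), the inverse of the bound on the norm side. *)
pose C := (gam / (kap * complex_loss p)) `^ (p * th).
have kl0 : 0 < kap * complex_loss p by rewrite mulr_gt0 ?complex_loss_gt0.
pose Z o := \sum_i real_scalar k (eta o i) *: F i.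
exists (existT _ Om (fun o => C * prob o, Z)) => /=; split.
- by move=> o; rewrite mulr_ge0 ?powR_ge0.
- have ZE o : {ae mu, forall x, T (Z o) x =
      \sum_i real_scalar k (eta o i) * (real_scalar k (e i) * T (f i) x)}.
    have -> : Z o = \sum_i (real_scalar k (eta o i) * real_scalar k (e i)) *: f i.
      by apply: eq_bigr => i _; rewrite scalerA.
    apply: filterS (linear_operator_sum linT (index_enum 'I_m)
      (fun i => real_scalar k (eta o i) * real_scalar k (e i)) f) => x ->.
    by apply: eq_bigr => i _; rewrite mulrA.
  have ZEall : {ae mu, forall x, forall o, T (Z o) x =
      \sum_i real_scalar k (eta o i) * (real_scalar k (e i) * T (f i) x)}.
    exact: filter_forall.
  apply: filterS ZEall => x Zx.
  have := scalar_randomization p0 (fun i => real_scalar k (e i) * T (f i) x) s0 kap0 prob0 Hlo.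
  rewrite sthE.
  have -> : \sum_i modulus (real_scalar k (e i) * T (f i) x) `^ p =
      (\sum_i c i * modulus (T (f i) x) `^ p) / gam `^ p.
    rewrite mulr_suml; apply: eq_bigr => i _.
    by rewrite modulusM ger0_norm// powRM ?modulus_ge0// ep mulrAC.
  have S0 : 0 <= \sum_i c i * modulus (T (f i) x) `^ p.
    by apply: sumr_ge0 => i _; rewrite mulr_ge0 ?powR_ge0.
  move=> H; under [leRHS]eq_bigr do rewrite Zx -mulrA.
  rewrite -mulr_sumr; apply: le_trans (ler_wpM2l (powR_ge0 _ _) H).
  rewrite le_eqVlt; apply/orP; left; apply/eqP.
  have CE : C * (kap * complex_loss p) `^ (p * th) = (gam `^ p) `^ th.
    by rewrite /C -powRM ?(ltW kl0) ?(ltW (divr_gt0 g0 kl0))// divfK ?gt_eqF// powRrM.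
  rewrite mulrA CE -powRM ?(ltW gp) ?divr_ge0 ?(ltW gp)//.
  by rewrite mulrCA mulfV ?gt_eqF// mulr1.
- have := Hup k Y N Rc F (ltW Rc0) qN typN (fun i => lexx _).
  move=> H; under eq_bigr do rewrite -mulrA.
  rewrite -mulr_sumr; apply: (le_trans (ler_wpM2l (powR_ge0 _ _) H)).
  rewrite -powRM ?(ltW (divr_gt0 g0 kl0)) ?(ltW (divr_gt0 Rc0 kap0))//.
  rewrite (_ : _ * _ = 1) ?powR1// /gam /cone_budget.
  by field; rewrite !gt_eqF// complex_loss_gt0.
Qed.

(** A vector of nonzero norm belongs to the cone after division by its norm; a vector
of norm zero is zero and contributes nothing. *)
Lemma cone_bound (phi : X -> R) (A : R) (f : Y) : 0 <= A ->
  measurable_fun setT phi -> (forall x, 0 <= phi x) ->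
  (forall S, power_cone T N p cone_budget S -> (\int[mu]_x (S x * phi x)%:E <= A%:E)%E) ->
  (\int[mu]_x (modulus (T f x) `^ p * phi x)%:E <= (A * (N f / cone_budget) `^ p)%:E)%E.
Proof.
move=> A0 mphi phi0 HA; have [N0 Neq0 NZ _] := qN.
have g0 := cone_budget_gt0; set gam := cone_budget in g0 HA *.
have mT : measurable_fun setT (fun x => modulus (T f x) `^ p * phi x).
  apply: measurable_funM => //; apply: (measurableT_comp (measurable_powR _)).
  exact: (measurable_modulus linT).
have i0 x : 0 <= modulus (T f x) `^ p * phi x by rewrite mulr_ge0 ?powR_ge0.
have := N0 f; rewrite le_eqVlt => /predU1P[Nf|Nf].
  have f0 : f = 0 by apply/Neq0.
  rewrite -Nf mul0r powR0 ?mulr0 ?gt_eqF//.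
  have : (\int[mu]_x (modulus (T f x) `^ p * phi x)%:E <= \int[mu]_x (0 : R)%:E)%E.
    apply: ge0_int_le => //; apply: filterS (linear_operator0 linT) => x.
    rewrite f0 => ->; rewrite -(mul0r (1 : scalarType R k)) -(real_scalar0 R k) modulusM normr0 mul0r.
    by rewrite powR0 ?mul0r// gt_eqF.
  by rewrite integral0.
pose c := (gam / N f) `^ p.
have c0 : 0 < c by rewrite powR_gt0// divr_gt0.
have H := HA (fun x => c * modulus (T f x) `^ p).
have {}H : (c%:E * \int[mu]_x (modulus (T f x) `^ p * phi x)%:E <= A%:E)%E.
  rewrite -ge0_intZ ?(ltW c0)//; under eq_integral do rewrite mulrA.
  apply: H; apply: power_cone_single; first exact: ltW.
  by rewrite /c -powRM ?(ltW (divr_gt0 g0 Nf))// divfK// gt_eqF.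
rewrite -(@lee_pmul2l _ c%:E) ?lte_fin//; apply: (le_trans H).
rewrite -EFinM lee_fin mulrCA /c.
rewrite -powRM ?(ltW (divr_gt0 g0 Nf)) ?(ltW (divr_gt0 Nf g0))//.
rewrite (_ : gam / N f * (N f / gam) = 1) ?powR1 ?mulr1//.
by field; rewrite !gt_eqF.
Qed.

End ConeRandomization.

(** The hypothesis is applied to independent random vectors Z_j: the mean of the
products is the product of the means, on both sides. *)
Lemma averaging (dX : measure_display) (X : measurableType dX) (R : realType)
    (k : scalar_kind) (mu : {measure set X -> \bar R}) (Ix : finType)
    (Y : Ix -> lmodType (scalarType R k)) (N : forall j, Y j -> R)
    (T : forall j, Y j -> X -> scalarType R k) (p r kap Rc theta : Ix -> R) (G : X -> R) (B : R) :
  (forall j, linear_operator mu (@T j)) -> (forall j, quasi_norm (@N j)) ->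
  (forall j, 0 < p j) -> (forall j, 0 < kap j) -> (forall j, 0 < Rc j) ->
  (forall j, rademacher_type_bound (@N j) (r j) (Rc j)) ->
  (forall j, randomizes (p j) (r j) (kap j)) ->
  (forall j, 0 < theta j <= 1) -> measurable_fun setT G -> (forall x, 0 <= G x) -> 0 <= B ->
  (forall f : forall j, Y j,
    (\int[mu]_x (G x * \prod_j modulus (T j (f j) x) `^ (p j * theta j))%:E <=
      (B * \prod_j N j (f j) `^ (p j * theta j))%:E)%E) ->
  forall S : Ix -> X -> R,
  (forall j, power_cone (@T j) (@N j) (p j) (cone_budget (p j) (kap j) (Rc j)) (S j)) ->
  (\int[mu]_x (geom_product theta G S x)%:E <= B%:E)%E.
Proof.
move=> linT qN p0 kap0 Rc0 typ rand th mG G0 B0 HB S KS.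
have HD j := power_cone_random (linT j) (qN j) (p0 j) (kap0 j) (Rc0 j) (typ j) (rand j) (th j) (KS j).
pose D j := sval (cid (HD j)).
pose Om j : finType := projT1 (D j).
pose prob j : Om j -> R := (projT2 (D j)).1.
pose Z j : Om j -> Y j := (projT2 (D j)).2.
have prob0 j o : 0 <= prob j o by have [+ _ _] := svalP (cid (HD j)); exact.
have Sle : {ae mu, forall x, forall j, S j x `^ theta j <=
    \sum_o prob j o * modulus (T j (Z j o) x) `^ (p j * theta j)}.
  by apply: filter_forall => j; have [_ + _] := svalP (cid (HD j)).
have Nle j : \sum_o prob j o * N j (Z j o) `^ (p j * theta j) <= 1.
  by have [_ _ +] := svalP (cid (HD j)).
pose I (t : fprod Om) x := G x * \prod_j modulus (T j (Z j (t j)) x) `^ (p j * theta j).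
have I0 t x : 0 <= I t x by rewrite mulr_ge0// prodr_ge0// => j _; rewrite powR_ge0.
have mI t : measurable_fun setT (I t).
  apply: measurable_funM => //; apply: measurable_prod => j _.
  apply: (measurableT_comp (measurable_powR _)); exact: (measurable_modulus (linT j)).
pose w (t : fprod Om) := \prod_j prob j (t j).
have w0 t : 0 <= w t by exact: prodr_ge0.
apply: (@le_trans _ _ (\int[mu]_x (\sum_(t : fprod Om) w t * I t x)%:E)%E).
  apply: ge0_int_le.
  - apply: measurable_geom_product => // j; exact: (power_cone_measurable (linT j) (KS j)).
  - by apply: measurable_sum => t; exact: measurable_funM.
  - by move=> x; exact: geom_product_ge0.
  - by move=> x; apply: sumr_ge0 => t _; exact: mulr_ge0.
  - apply: filterS Sle => x Sx.
    have -> : \sum_(t : fprod Om) w t * I t x =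
        G x * \prod_j \sum_o prob j o * modulus (T j (Z j o) x) `^ (p j * theta j).
      rewrite prod_sum_fprod mulr_sumr; apply: eq_bigr => t _.
      by rewrite /w /I mulrCA -big_split.
    by rewrite ler_wpM2l//; apply: ler_prod => j _; rewrite powR_ge0/=.
rewrite ge0_int_sum//; last 2 first.
- by move=> t; exact: measurable_funM.
- by move=> t x; exact: mulr_ge0.
apply: (@le_trans _ _ (\sum_(t : fprod Om) (w t * (B * \prod_j N j (Z j (t j)) `^ (p j * theta j)))%:E)%E).
  apply: lee_sum => t _; rewrite ge0_intZ// EFinM; apply: lee_wpmul2l; first by rewrite lee_fin.
  exact: (HB (fun j => Z j (t j))).
rewrite sumEFin lee_fin.
under eq_bigr do rewrite mulrCA /w -big_split/=.
rewrite -mulr_sumr -(prod_sum_fprod (fun j o => prob j o * N j (Z j o) `^ (p j * theta j))).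
rewrite ler_piMr//; apply: prodr_ile1 => j _; rewrite Nle andbT.
by apply: sumr_ge0 => o _; rewrite mulr_ge0 ?powR_ge0.
Qed.

(** * The three cases *)

Lemma powR_prod (R : realType) (I : Type) (s : seq I) (f : I -> R) (a : R) :
  (forall i, 0 <= f i) -> (\prod_(i <- s) f i) `^ a = \prod_(i <- s) f i `^ a.
Proof.
move=> f0; elim: s => [|i s IH]; first by rewrite !big_nil powR1.
by rewrite !big_cons powRM ?IH ?prodr_ge0.
Qed.

Lemma powR_sum_exponent (R : realType) (I : finType) (x : R) (a : I -> R) : 0 < x ->
  \prod_i x `^ a i = x `^ (\sum_i a i).
Proof.
move=> x0; elim/big_rec2: _ => [|i y z _ ->]; first by rewrite powRr0.
by rewrite powRD// (gt_eqF x0) implybT.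
Qed.

Section Cases.
Variables (R : realType) (d : nat) (theta p r kap : 'I_d -> R).
Hypotheses (p0 : forall j, 0 < p j) (theta0 : forall j, 0 < theta j).
Hypothesis theta1 : \sum_j theta j = 1.
Hypotheses (kap0 : forall j, 0 < kap j) (rand : forall j, randomizes (p j) (r j) (kap j)).
Variables (k : scalar_kind) (dX : measure_display) (X : measurableType dX).
Variable mu : {sigma_finite_measure set X -> \bar R}.
Variables (Y : 'I_d -> lmodType (scalarType R k)) (N : forall j, Y j -> R).
Variable T : forall j, Y j -> X -> scalarType R k.
Hypotheses (qN : forall j, quasi_norm (@N j)) (linT : forall j, linear_operator mu (@T j)).
Hypotheses (satT : forall j, saturates mu (@T j)).
Hypothesis typN : forall j, has_rademacher_type (@N j) (r j).

(** Only the exponents and the randomisation constants enter, so the constant does not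
depend on the operators, the spaces, the measure or q. *)
Definition case_constant : R := \sum_j (kap j ^+ 2 * complex_loss (p j))^-1.

Lemma case_constant_ge j : (kap j ^+ 2 * complex_loss (p j))^-1 <= case_constant.
Proof.
rewrite /case_constant (bigD1 j)//= lerDl sumr_ge0// => i _.
by rewrite invr_ge0 mulr_ge0 ?sqr_ge0// ltW// complex_loss_gt0.
Qed.

Lemma theta_le1 j : theta j <= 1.
Proof. by rewrite -theta1 (bigD1 j)//= lerDl sumr_ge0// => i _; rewrite ltW. Qed.

Definition test_product (f : forall j, Y j) x : R :=
  \prod_j modulus (T (f j) x) `^ (p j * theta j).

Lemma test_product_ge0 f x : 0 <= test_product f x.
Proof. by rewrite prodr_ge0// => j _; rewrite powR_ge0. Qed.

Lemma measurable_test_product f : measurable_fun setT (test_product f).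
Proof.
apply: measurable_prod => j _; apply: (measurableT_comp (measurable_powR _)).
exact: (measurable_modulus (linT j)).
Qed.

Definition norm_product (f : forall j, Y j) : R := \prod_j N (f j) `^ (p j * theta j).

Lemma norm_product_ge0 f : 0 <= norm_product f.
Proof. by rewrite prodr_ge0// => j _; rewrite powR_ge0. Qed.

Lemma type_bounds : exists Rc : 'I_d -> R, forall j,
  [/\ 0 < Rc j, rademacher_type_bound (@N j) (r j) (Rc j) &
    forall f : Y j, Rc j * N f <= rademacher_const (@N j) (r j) * N f].
Proof.
have /choice[Rc RcP] : forall j : 'I_d, exists C : R,
    [/\ 0 < C, rademacher_type_bound (@N j) (r j) C &
    forall f : Y j, C * N f <= rademacher_const (@N j) (r j) * N f].
  by move=> j; exact: positive_type_bound.
by exists Rc.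
Qed.

Variable Rc : 'I_d -> R.
Hypothesis RcP : forall j, [/\ 0 < Rc j, rademacher_type_bound (@N j) (r j) (Rc j) &
    forall f : Y j, Rc j * N f <= rademacher_const (@N j) (r j) * N f].

Definition cone j : set (X -> R) :=
  power_cone (@T j) (@N j) (p j) (cone_budget (p j) (kap j) (Rc j)).

Lemma Rc_gt0 j : 0 < Rc j. Proof. by have [] := RcP j. Qed.

(** The factor 1 / cone_budget is split into the type constant and the part that is
bounded by case_constant. *)
Lemma weighted_norm_bound (phi : 'I_d -> X -> R) (A : R) j (f : Y j) : 0 <= A ->
  measurable_fun setT (phi j) -> (forall x, 0 <= phi j x) ->
  (forall S, cone j S -> (\int[mu]_x (S x * phi j x)%:E <= A%:E)%E) ->
  ((\int[mu]_x (modulus (T f x) `^ p j * phi j x)%:E) `^ (p j)^-1 <=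
    (case_constant * A `^ (p j)^-1 * rademacher_const (@N j) (r j) * N f)%:E)%E.
Proof.
move=> A0 mphi phi0 HA.
have [Rc0 _ RcN] := RcP j.
have Nf0 : 0 <= N f by case: (qN j).
have b0 := cone_budget_gt0 (p j) (kap0 j) Rc0.
have H := cone_bound (linT j) (qN j) (p0 j) (kap0 j) Rc0 f A0 mphi phi0 HA.
have pV0 : 0 <= (p j)^-1 by rewrite invr_ge0 ltW.
have I0 : (0 <= \int[mu]_x (modulus (T f x) `^ p j * phi j x)%:E)%E.
  by apply: integral_ge0 => x _; rewrite lee_fin mulr_ge0 ?powR_ge0.
have {}H := @gt0_ler_poweR R _ pV0 _ _ _ _ H.
apply: le_trans (H _ _) _.
- by rewrite in_itv/= I0 leey.
- by rewrite in_itv/= leey andbT lee_fin mulr_ge0 ?powR_ge0.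
rewrite poweR_EFin lee_fin powRM ?powR_ge0// -powRrM mulfV ?gt_eqF// powRr1; last first.
  by rewrite divr_ge0// ltW.
have -> : N f / cone_budget (p j) (kap j) (Rc j) =
    (kap j ^+ 2 * complex_loss (p j))^-1 * (Rc j * N f).
  have l0 := complex_loss_gt0 (p j); have k0 := kap0 j.
  by rewrite /cone_budget; field; rewrite !gt_eqF.
rewrite (_ : case_constant * _ * _ * _ =
  A `^ (p j)^-1 * (case_constant * (rademacher_const (@N j) (r j) * N f))); last by ring.
rewrite ler_wpM2l ?powR_ge0//.
have k0 : 0 < kap j ^+ 2 * complex_loss (p j).
  by rewrite mulr_gt0 ?complex_loss_gt0 ?exprn_gt0.
apply: ler_pM; [by rewrite invr_ge0 ltW | by rewrite mulr_ge0 // ltW | | exact: RcN].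
exact: case_constant_ge.
Qed.

(** The exponents p_j theta_j q of the q-th power only require q theta_j <= 1. *)
Lemma cone_average (G : X -> R) (q b : R) : 0 < q <= 1 -> measurable_fun setT G ->
  (forall x, 0 <= G x) -> 0 <= b ->
  (forall f, (\int[mu]_x (G x * test_product f x `^ q)%:E <= (b * norm_product f `^ q)%:E)%E) ->
  forall S : 'I_d -> X -> R, (forall j, cone j (S j)) ->
  (\int[mu]_x (geom_product (fun j => q * theta j) G S x)%:E <= b%:E)%E.
Proof.
move=> /andP[q0 q1] mG G0 b0 H S KS.
apply: (@averaging _ _ _ _ mu _ Y N T p r kap Rc (fun j => q * theta j) G b) => //.
- by move=> j; have [] := RcP j.
- by move=> j; have [] := RcP j.
- by move=> j; rewrite mulr_gt0//= mulr_ile1 ?(ltW q0) ?(ltW (theta0 j)) ?theta_le1.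
- move=> f.
  have expE (j : 'I_d) y : y `^ (p j * (q * theta j)) = (y `^ (p j * theta j)) `^ q.
    by rewrite -powRrM mulrCA mulrC.
  under [X in (_ * X)%:E]eq_bigr do rewrite expE.
  rewrite -powR_prod; last by move=> j; rewrite powR_ge0.
  under eq_integral => x _.
    under eq_bigr do rewrite expE.
    rewrite -powR_prod; last by move=> j; rewrite powR_ge0.
    over.
  exact: H.
Qed.

Lemma weighted_disentanglement (G : X -> R) (b : R) : measurable_fun setT G ->
  (forall x, 0 <= G x) -> 0 <= b ->
  (forall f, (\int[mu]_x (G x * test_product f x)%:E <= (b * norm_product f)%:E)%E) ->
  exists phi : 'I_d -> X -> R,
        [/\ forall j, measurable_fun setT (phi j),
            forall j x, 0 <= phi j x,
            {ae mu, forall x, G x <= \prod_(j < d) phi j x `^ theta j} &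
            forall j (f : Y j),
              ((\int[mu]_x (modulus (T f x) `^ p j * phi j x)%:E)
                 `^ (p j)^-1
               <= (case_constant * b `^ (p j)^-1 * rademacher_const (@N j) (r j)
                   * N f)%:E)%E].
Proof.
move=> mG G0 b0 H.
have mK j f : cone j f -> measurable_fun setT f by exact: power_cone_measurable.
have K0 j f : cone j f -> forall x, 0 <= f x by move=> Kf x; exact: power_cone_ge0 Kf.
have cK j f g t : cone j f -> cone j g -> 0 <= t <= 1 ->
    cone j (fun x => (1 - t) * f x + t * g x) by exact: power_cone_convex.
have KA S : (forall j, cone j (S j)) -> (\int[mu]_x (geom_product theta G S x)%:E <= b%:E)%E.
  move=> KS; have := @cone_average G 1 b _ mG G0 b0 _ S KS.
  rewrite ltr01 lexx => /(_ isT) h.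
  have tE : (fun j => 1 * theta j) = theta by apply/funext => j; rewrite mul1r.
  rewrite tE in h; apply: h => f; under eq_integral do rewrite powRr1 ?test_product_ge0//.
  by rewrite powRr1 ?norm_product_ge0.
have Kinh : exists S, forall j, cone j (S j).
  by exists (fun _ _ => 0) => j; exact: power_cone0.
have satK j E : measurable E -> (0 < mu E)%E -> exists f E',
    [/\ cone j f, measurable E', E' `<=` E, (0 < mu E')%E & forall x, E' x -> 0 < f x].
  by move=> mE E0; apply: power_cone_saturates => //; exact: cone_budget_gt0 (Rc_gt0 j).
have [phi [mphi phi0 Gphi Kphi]] :=
  disentanglement theta0 theta1 mG G0 mK K0 cK b0 KA Kinh satK.
exists phi; split => // j f; apply: weighted_norm_bound => // S; exact: Kphi.
Qed.

(** The additional coordinate None carries the constants in [0, 1]. Its multiplier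
will have integral at most b, whence a bound for the integral of the reciprocal
power of the other multipliers. *)
Definition reciprocal_cone (o : option 'I_d) : set (X -> R) :=
  if o is Some j then cone j else [set f | exists2 c : R, 0 <= c <= 1 & f = cst c].

Definition reciprocal_exponent (q : R) (o : option 'I_d) : R :=
  if o is Some j then q * theta j else 1 - q.

(** The factor c^(1-q) <= 1 of the additional coordinate does no harm to the averaged
inequality, and it completes the exponents q theta_j to a sum of 1. *)
Lemma reciprocal_disentanglement (q b : R) : 0 < q < 1 -> 0 <= b ->
  (forall f, (\int[mu]_x (test_product f x `^ q)%:E <= (b * norm_product f `^ q)%:E)%E) ->
  exists phi : option 'I_d -> X -> R,
  [/\ forall o, measurable_fun setT (phi o), forall o x, 0 <= phi o x,
     {ae mu, forall x, 1 <= phi None x `^ (1 - q) * \prod_j phi (Some j) x `^ (q * theta j)} &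
     forall o f, reciprocal_cone o f -> (\int[mu]_x (f x * phi o x)%:E <= b%:E)%E].
Proof.
move=> /andP[q0 q1] b0 H.
have one0 (x : X) : 0 <= cst (1 : R) x by [].
have t0 o : 0 < reciprocal_exponent q o by case: o => [j|]/=; rewrite ?mulr_gt0// subr_gt0.
have t1 : \sum_o reciprocal_exponent q o = 1.
  by rewrite sum_option/= -mulr_sumr theta1 mulr1 subrK.
have prod_option (F : option 'I_d -> R) : \prod_o F o = F None * \prod_j F (Some j).
  rewrite (bigD1 None)//=; congr (_ * _).
  rewrite (reindex_omap Some id)/=; last by case.
  by apply: eq_bigl => j; rewrite eqxx.
have mK o f : reciprocal_cone o f -> measurable_fun setT f.
  by case: o => [j|[c _ ->]]; [exact: power_cone_measurable | exact: measurable_cst].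
have K0 o f : reciprocal_cone o f -> forall x, 0 <= f x.
  by case: o => [j Kf x|[c /andP[c0 _] ->]//]; exact: power_cone_ge0 Kf.
have cK o f g (t : R) : reciprocal_cone o f -> reciprocal_cone o g -> 0 <= t <= 1 ->
    reciprocal_cone o (fun x => (1 - t) * f x + t * g x).
  case: o => [j|]; first exact: power_cone_convex.
  move=> [c /andP[c0 c1] ->] [c' /andP[c0' c1'] ->] /andP[t0' t1'].
  exists ((1 - t) * c + t * c') => //; apply/andP; split.
    by rewrite addr_ge0 ?mulr_ge0 ?subr_ge0.
  apply: (@le_trans _ _ ((1 - t) * 1 + t * 1)); last by rewrite !mulr1 subrK.
  by rewrite lerD ?ler_wpM2l ?subr_ge0.
have KA S : (forall o, reciprocal_cone o (S o)) ->
    (\int[mu]_x (geom_product (reciprocal_exponent q) (cst 1) S x)%:E <= b%:E)%E.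
  move=> KS; have [c /andP[c0 c1] SN] := KS None.
  have KSs j : cone j (S (Some j)) by exact: (KS (Some j)).
  have h : (\int[mu]_x (geom_product (fun j => q * theta j) (cst 1) (fun j => S (Some j)) x)%:E <= b%:E)%E.
    apply: cone_average => //; first by rewrite q0 ltW.
    by move=> f; under eq_integral do rewrite mul1r; exact: H.
  apply: le_trans h; apply: ge0_int_le.
  - by apply: measurable_geom_product => // o; exact: mK (KS o).
  - by apply: measurable_geom_product => // j; exact: mK (KS (Some j)).
  - by move=> x; exact: geom_product_ge0.
  - by move=> x; exact: geom_product_ge0.
  - apply: nearW => x; rewrite /geom_product prod_option/= !mul1r ler_piMl//.
      by apply: prodr_ge0 => j _; rewrite powR_ge0.
    by rewrite SN powR_le1// subr_ge0 ltW.
have Kinh : exists S, forall o, reciprocal_cone o (S o).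
  exists (fun _ _ => 0) => -[j|]; first exact: power_cone0.
  by exists 0; rewrite ?lexx ?ler01.
have satK o E : measurable E -> (0 < mu E)%E -> exists f E',
    [/\ reciprocal_cone o f, measurable E', E' `<=` E, (0 < mu E')%E & forall x, E' x -> 0 < f x].
  move=> mE E0; case: o => [j|].
    by apply: power_cone_saturates => //; exact: cone_budget_gt0 (Rc_gt0 j).
  by exists (cst 1), E; split => //; exists 1; rewrite ?lexx ?ler01.
have m1 : measurable_fun setT (cst (1 : R) : X -> R) by exact: measurable_cst.
have [phi [mphi phi0 Gphi Kphi]] := disentanglement t0 t1 m1 one0 mK K0 cK b0 KA Kinh satK.
by exists phi; split => //; apply: filterS Gphi => x; rewrite prod_option.
Qed.

(** Let h be the product of the phi_j^theta_j. The product inequality reads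
h^(q/(q-1)) <= phi_None, so the integral I of h^(q/(q-1)) is at most B^q; it is
positive because mu is not zero. Multiplying all phi_j by
I^((1-q)/q) normalises this integral to 1 and turns the bound B^q into B. *)
Lemma small_exponent_factorisation (q B : R) : 0 < q < 1 -> 0 <= B -> (0 < mu setT)%E ->
  (forall f, (\int[mu]_x (test_product f x `^ q)%:E <= ((B * norm_product f) `^ q)%:E)%E) ->
  exists g : 'I_d -> X -> R,
        [/\ forall j, measurable_fun setT (g j),
            forall j x, 0 <= g j x,
            signed_Lnorm mu (q / (q - 1)) (fun x => \prod_(j < d) g j x `^ theta j) = 1%:E &
            forall j (f : Y j),
              ((\int[mu]_x (modulus (T f x) `^ p j * g j x)%:E)
                 `^ (p j)^-1
               <= (case_constant * B `^ (p j)^-1 * rademacher_const (@N j) (r j)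
                   * N f)%:E)%E].
Proof.
move=> /andP[q0 q1] B0 muX H.
have A0 : 0 <= B `^ q by rewrite powR_ge0.
have [||phi [mphi phi0 Gphi Kphi]] := @reciprocal_disentanglement q (B `^ q) _ A0.
- by rewrite q0.
- by move=> f; rewrite -powRM ?norm_product_ge0.
set s := q / (q - 1).
have q10 : 0 < 1 - q by rewrite subr_gt0.
have s0 : s < 0 by rewrite /s -(opprB 1) invrN mulrN oppr_lt0 divr_gt0.
(* Null sets are harmless, but only positive values make the negative powers real
   numbers at every point. *)
pose psi j x := if phi (Some j) x == 0 then 1 else phi (Some j) x.
have psi0 j x : 0 < psi j x.
  by rewrite /psi; case: eqVneq => // ne; rewrite lt_neqAle eq_sym ne phi0.
have mpsi j : measurable_fun setT (psi j).
  by apply: measurable_fun_ifT => //; exact: measurable_fun_eqr.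
pose h x := \prod_(j < d) psi j x `^ theta j.
have h0 x : 0 < h x by apply: prodr_gt0 => j _; rewrite powR_gt0.
have mh : measurable_fun setT (fun x => h x `^ s).
  apply: (measurableT_comp (measurable_powR _)).
  by apply: measurable_prod => j _; exact: (measurableT_comp (measurable_powR _)).
have good : {ae mu, forall x, (forall j, psi j x = phi (Some j) x) /\ h x `^ s <= phi None x}.
  apply: filterS Gphi => x Gx.
  have ne j : phi (Some j) x != 0.
    apply/negP => /eqP e; move: Gx; rewrite (bigD1 j)//= e powR0 ?mul0r ?mulr0 ?ler10//.
    by rewrite gt_eqF// mulr_gt0.
  have pE j : psi j x = phi (Some j) x by rewrite /psi (negbTE (ne j)).
  split => //.
  have hq : \prod_j phi (Some j) x `^ (q * theta j) = h x `^ q.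
    rewrite powR_prod; last by move=> j; rewrite powR_ge0.
    by apply: eq_bigr => j _; rewrite pE -powRrM mulrC.
  rewrite hq -ler_pdivrMr ?powR_gt0// div1r -powRN in Gx.
  have : (h x `^ (- q)) `^ (1 - q)^-1 <= (phi None x `^ (1 - q)) `^ (1 - q)^-1.
    by rewrite powR_le ?powR_ge0// invr_ge0 ltW.
  rewrite -!powRrM mulfV ?gt_eqF// powRr1//.
  by rewrite (_ : - q * (1 - q)^-1 = s)// /s -(opprB 1) invrN mulrN mulNr.
set I := (\int[mu]_x (h x `^ s)%:E)%E.
have IA : (I <= (B `^ q)%:E)%E.
  apply: (@le_trans _ _ (\int[mu]_x (phi None x)%:E)%E).
    apply: ge0_int_le => //; first by move=> x; rewrite powR_ge0.
    by apply: filterS good => x [].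
  have := Kphi None (cst 1); under eq_integral do rewrite mul1r.
  by apply; exists 1; rewrite ?lexx ?ler01.
have I0 : (0 < I)%E.
  rewrite lt_neqAle integral_ge0 ?andbT; last by move=> x _; rewrite lee_fin powR_ge0.
  apply/negP => /eqP Ie.
  have mE : measurable_fun setT (EFin \o (fun x => h x `^ s)) by exact/measurable_EFinP.
  have [+ _] := ae_eq_integral_abs mu measurableT mE.
  under eq_integral do rewrite /= ger0_norm ?powR_ge0//.
  move=> /(_ (esym Ie)) ae0.
  have [x _ /(_ Logic.I)/= []] := ae_meets_positive ae0 measurableT muX.
  by apply/eqP; rewrite gt_eqF// powR_gt0.
have Ifin : I \is a fin_num by rewrite ge0_fin_numE ?(ltW I0)// (le_lt_trans IA)// ltry.
pose i0 := fine I.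
have IE : I = i0%:E by rewrite /i0 fineK.
have i00 : 0 < i0 by rewrite -lte_fin -IE.
have i0A : i0 <= B `^ q by rewrite -lee_fin -IE.
have Bp : 0 < B by apply: (@gt0_powR _ _ q) => //; exact: lt_le_trans i0A.
pose c := i0 `^ ((1 - q) / q).
have c0 : 0 < c by rewrite powR_gt0.
exists (fun j x => c * psi j x); split.
- by move=> j; exact: measurable_funM.
- by move=> j x; rewrite mulr_ge0// ltW.
- have prodE x : \prod_(j < d) (c * psi j x) `^ theta j = c * h x.
    rewrite (eq_bigr (fun j => c `^ theta j * psi j x `^ theta j)); last first.
      by move=> j _; rewrite powRM// ltW.
    by rewrite big_split/= powR_sum_exponent// theta1 powRr1// ltW.
  have epowE (y : R) : 0 < y -> epow y%:E s = (y `^ s)%:E.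
    move=> y0; rewrite /epow s0 poweR_EFin powRN inver invr_eq0 gt_eqF ?powR_gt0//.
    by rewrite invrK.
  rewrite /signed_Lnorm.
  under eq_integral => x _.
    rewrite prodE ger0_norm ?mulr_ge0 ?(ltW c0) ?(ltW (h0 x))// epowE ?mulr_gt0//.
    rewrite powRM ?(ltW c0) ?(ltW (h0 x))//; over.
  rewrite ge0_intZ ?powR_ge0//; last by move=> x; rewrite powR_ge0.
  rewrite -/I IE -EFinM (_ : c `^ s * i0 = 1).
    by rewrite /epow invr_lt0 s0 poweR1r inve1.
  rewrite /c -powRrM (_ : (1 - q) / q * s = - 1).
    by rewrite powR_inv1 ?(ltW i00)// mulVf// gt_eqF.
  have q1n : q - 1 < 0 by rewrite subr_lt0.
  by rewrite /s; field; rewrite (lt_eqF q1n) (gt_eqF q0).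
- move=> j f; apply: (@weighted_norm_bound (fun j x => c * psi j x)) => //.
  + exact: measurable_funM.
  + by move=> x; rewrite mulr_ge0// ltW.
  + move=> S KS.
    have mS := power_cone_measurable (linT j) KS.
    have S0 x := power_cone_ge0 x KS.
    have Sle : (\int[mu]_x (S x * psi j x)%:E <= (B `^ q)%:E)%E.
      apply: le_trans (Kphi (Some j) S KS); apply: ge0_int_le.
      * exact: measurable_funM.
      * exact: measurable_funM.
      * by move=> x; rewrite mulr_ge0// ltW.
      * by move=> x; rewrite mulr_ge0.
      * by apply: filterS good => x [->].
    under eq_integral do rewrite mulrCA.
    rewrite ge0_intZ ?(ltW c0)//; last 2 first.
    * exact: measurable_funM.
    * by move=> x; rewrite mulr_ge0// ltW.
    apply: (le_trans (lee_wpmul2l _ Sle)); first by rewrite lee_fin ltW.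
    rewrite -EFinM lee_fin.
    apply: (@le_trans _ _ ((B `^ q) `^ ((1 - q) / q) * B `^ q)).
      rewrite ler_wpM2r// /c powR_le ?(ltW i00)// divr_ge0 ?ltW//.
    rewrite -powRrM -powRD ?(gt_eqF Bp) ?implybT//.
    rewrite (_ : q * ((1 - q) / q) + q = 1) ?powRr1//.
    by field; rewrite gt_eqF.
Qed.

End Cases.

Section LnormBounds.
Context {dX : measure_display} {X : measurableType dX} {R : realType}.
Variable mu : {measure set X -> \bar R}.
Variables (F : X -> R) (b : R).
Hypotheses (mF : measurable_fun setT F) (F0 : forall x, 0 <= F x) (b0 : 0 <= b).

Lemma Lnorm1_le_integral :
  ('N[mu]_1 [(fun x => (F x)%:E)] <= b%:E)%E -> (\int[mu]_x (F x)%:E <= b%:E)%E.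
Proof. by rewrite Lnorm1; under eq_integral do rewrite /= ger0_norm//. Qed.

Lemma Lnorm_power_integral (q : R) : 0 < q ->
  ('N[mu]_q%:E [(fun x => (F x)%:E)] <= b%:E)%E -> (\int[mu]_x (F x `^ q)%:E <= (b `^ q)%:E)%E.
Proof.
move=> q0 H; have := @poweR_Lnorm _ _ _ mu (fun x => (F x)%:E) q (negbT (gt_eqF q0)).
under [X in _ = X]eq_integral do rewrite /= ger0_norm//.
move=> <-; rewrite -poweR_EFin; apply: gt0_ler_poweR => //; first exact: ltW.
- by rewrite in_itv/= Lnorm_ge0 leey.
- by rewrite in_itv/= leey andbT lee_fin.
Qed.

(** For q = +oo the dual exponent is 1 and the essential supremum bounds F almost
everywhere. *)
Lemma hoelder_weight (q : \bar R) (G : X -> R) : (1 < q)%E -> (forall x, 0 <= G x) ->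
  G \in Lfun mu (dual_exponent q)%:E ->
  ('N[mu]_q [(fun x => (F x)%:E)] <= b%:E)%E ->
  (\int[mu]_x (G x * F x)%:E <= b%:E * 'N[mu]_(dual_exponent q)%:E [EFin \o G])%E.
Proof.
move=> q1 G0 GL H.
have mG : measurable_fun setT G by have := sub_Lfun_mfun GL; rewrite inE.
have GF0 x : 0 <= G x * F x by rewrite mulr_ge0.
have E1 : (\int[mu]_x (G x * F x)%:E = 'N[mu]_1 [EFin \o (F \* G)%R])%E.
  by rewrite Lnorm1; apply: eq_integral => x _; rewrite /= ger0_norm mulrC.
move: q q1 GL H => [q| |]//; rewrite ?lte_fin => q1 GL H.
  have q0 : 0 < q by exact: lt_trans q1.
  rewrite E1; apply: (@le_trans _ _ ('N[mu]_q%:E [EFin \o F] * 'N[mu]_(q / (q - 1))%:E [EFin \o G])%E).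
    apply: hoelder => //; first by rewrite divr_gt0// subr_gt0.
    by rewrite invf_div; field; rewrite gt_eqF.
  by apply: lee_wpmul2r => //; exact: Lnorm_ge0.
have Fb : {ae mu, forall x, F x <= b}.
  have [mu0|mu0] := leP (mu setT) 0%E.
    by exists setT; split => //; apply/eqP; rewrite eq_le mu0 measure_ge0.
  move: H; rewrite unlock mu0 => /ess_sup_inf.ess_supP; apply: filterS => x /=.
  by rewrite lee_fin ger0_norm.
rewrite /= Lnorm1.
have -> : (\int[mu]_x `|(EFin \o G) x| = \int[mu]_x (G x)%:E)%E.
  by apply: eq_integral => x _; rewrite /= ger0_norm.
rewrite -ge0_intZ//; apply: ge0_int_le => //.
- exact: measurable_funM.
- exact: measurable_funM.
- by move=> x; rewrite mulr_ge0.
- by apply: filterS Fb => x Fx; rewrite mulrC ler_wpM2r.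
Qed.

End LnormBounds.

Unset Implicit Arguments.

Theorem theorem5p2 (R : realType) (d : nat) (theta p r : 'I_d -> R)
    (hp : forall j, 0 < p j <= 2)
    (htheta : forall j, 0 < theta j)
    (htheta1 : \sum_(j < d) theta j = 1)
    (hr2 : forall j, p j = 2 -> r j = 2)
    (hrp : forall j, p j < 2 -> p j < r j) :
  exists C : R,
  forall (k : scalar_kind) (dX : measure_display) (X : measurableType dX)
    (mu : {sigma_finite_measure set X -> \bar R})
    (Y : 'I_d -> lmodType (scalarType R k)) (N : forall j, Y j -> R)
    (T : forall j, Y j -> X -> scalarType R k) (q : \bar R) (B : R),
  (forall j, quasi_norm (N j)) ->
  (forall j, linear_operator mu (T j)) ->
  (forall j, saturates mu (T j)) ->
  (0 < q)%E ->
  0 <= B ->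
  (forall f : forall j, Y j,
     ('N[mu]_q [(fun x =>
        (\prod_(j < d) modulus (T j (f j) x) `^ (p j * theta j))%:E)]
      <= (B * \prod_(j < d) N j (f j) `^ (p j * theta j))%:E)%E) ->
  (forall j, has_rademacher_type (N j) (r j)) ->
  [/\ (* Case I: disentanglement *)
      q = 1%:E ->
      exists phi : 'I_d -> X -> R,
        [/\ forall j, measurable_fun setT (phi j),
            forall j x, 0 <= phi j x,
            {ae mu, forall x, 1 <= \prod_(j < d) phi j x `^ theta j} &
            forall j (f : Y j),
              ((\int[mu]_x (modulus (T j f x) `^ p j * phi j x)%:E)
                 `^ (p j)^-1
               <= (C * B `^ (p j)^-1 * rademacher_const (N j) (r j)
                   * N j f)%:E)%E],
      (* Case II: multilinear duality *)
      (1 < q)%E ->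
      forall G : X -> R,
        (forall x, 0 <= G x) ->
        G \in Lfun mu (dual_exponent q)%:E ->
      exists g : 'I_d -> X -> R,
        [/\ forall j, measurable_fun setT (g j),
            forall j x, 0 <= g j x,
            {ae mu, forall x, G x <= \prod_(j < d) g j x `^ theta j} &
            forall j (f : Y j),
              ((\int[mu]_x (modulus (T j f x) `^ p j * g j x)%:E)
                 `^ (p j)^-1
               <= (C * B `^ (p j)^-1 * rademacher_const (N j) (r j))%:E
                  * 'N[mu]_(dual_exponent q)%:E [EFin \o G] `^ (p j)^-1
                  * (N j f)%:E)%E] &
      (* Case III: multilinear Maurey factorisation *)
      (q < 1)%E -> (0 < mu setT)%E ->
      exists g : 'I_d -> X -> R,
        [/\ forall j, measurable_fun setT (g j),
            forall j x, 0 <= g j x,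
            signed_Lnorm mu (dual_exponent q)
              (fun x => \prod_(j < d) g j x `^ theta j) = 1%:E &
            forall j (f : Y j),
              ((\int[mu]_x (modulus (T j f x) `^ p j * g j x)%:E)
                 `^ (p j)^-1
               <= (C * B `^ (p j)^-1 * rademacher_const (N j) (r j)
                   * N j f)%:E)%E]].
Proof.
have p0 j : 0 < p j by case/andP: (hp j).
have hk : forall j, exists2 kap : R, 0 < kap & randomizes (p j) (r j) kap.
  move=> j; apply: randomization => //.
  case/andP: (hp j) => _; rewrite le_eqVlt => /predU1P[pj|pj].
    by left; split => //; exact: hr2.
  by right; exact: hrp.
have /choice[kap kapP] : forall j : 'I_d, exists kap : R, 0 < kap /\ randomizes (p j) (r j) kap.
  by move=> j; have [kap ? ?] := hk j; exists kap.
have kap0 j := (kapP j).1.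
have rand j := (kapP j).2.
exists (case_constant p kap) => k dX X mu Y N T q B qN linT satT q0 B0 H typ.
have [Rc RcP] := type_bounds qN typ.
have mF (f : forall j, Y j) := measurable_test_product theta p linT f.
have F0 (f : forall j, Y j) := test_product_ge0 theta p T f.
have b0 (f : forall j, Y j) : 0 <= B * norm_product theta p N f.
  by rewrite mulr_ge0// norm_product_ge0.
split.
- move=> q1; rewrite q1 in H.
  have m1 : measurable_fun setT (cst (1 : R) : X -> R) by exact: measurable_cst.
  apply: (weighted_disentanglement p0 htheta htheta1 kap0 rand qN linT satT RcP m1) => //.
  move=> f; under eq_integral do rewrite mul1r.
  exact: (Lnorm1_le_integral (F0 f) (H f)).
- move=> q1 G G0 GL.
  have mG : measurable_fun setT G by have := sub_Lfun_mfun GL; rewrite inE.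
  set nG := ('N[mu]_(dual_exponent q)%:E [EFin \o G])%E.
  have nG0 : (0 <= nG)%E by exact: Lnorm_ge0.
  have nGfin : nG \is a fin_num.
    rewrite ge0_fin_numE//; have := sub_Lfun_finLfun GL; rewrite inE//.
  have nGE : nG = (fine nG)%:E by rewrite fineK.
  have n0 : 0 <= fine nG by rewrite fine_ge0.
  move: (fine nG) nGE n0 => n nGE n0.
  have c0 : 0 <= B * n by rewrite mulr_ge0.
  have [|g [mg g0 Gg Tg]] := weighted_disentanglement p0 htheta htheta1 kap0 rand qN linT satT RcP mG G0 c0.
    move=> f; apply: (le_trans (hoelder_weight (mF f) (F0 f) (b0 f) q1 G0 GL (H f))).
    by rewrite -/nG nGE -EFinM lee_fin mulrAC.
  exists g; split => // j f; apply: (le_trans (Tg j f)).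
  rewrite nGE poweR_EFin -!EFinM lee_fin powRM//.
  by rewrite le_eqVlt; apply/orP; left; apply/eqP; ring.
- move=> q1 muX.
  move: q q0 q1 H => [q| |]// ; rewrite !lte_fin => q0 q1 H.
  apply: (small_exponent_factorisation p0 htheta htheta1 kap0 rand qN linT satT RcP) => //.
    by rewrite q0.
  by move=> f; apply: (Lnorm_power_integral (F0 f) (b0 f) q0); exact: H.
Qed.
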